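(* Let $p,q\in[1,+\infty)$ with $q\ge p'$, where $\frac1p+\frac1{p'}=1$, and let $r$ be defined by $\frac1r=\frac1p+\frac1q$. Let $a\in W^{1,p}_{\mathrm{loc}}(\mathbb R^n)$ and $f\in L^q_{\mathrm{loc}}(\mathbb R^n)$. Then for every compact $K\subset\mathbb R^n$, $$\|(a*\rho_\varepsilon)(f*\rho_\varepsilon)-(af)*\rho_\varepsilon\|_{W^{1,r}(K)}\longrightarrow0\quad\text{as }\varepsilon\to0.$$
   Context: $\rho_\varepsilon$ is the standard mollifier: $\rho:\mathbb R^n\to\mathbb R$ is a smooth nonnegative function supported in the unit ball with $\int\rho=1$, and $\rho_\varepsilon(x)=\varepsilon^{-n}\rho(x/\varepsilon)$ for $\varepsilon\in(0,1]$. $p'$ is the conjugate exponent, with the convention $p'=\infty$ if $p=1$. *)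

(* Defs.v *)
From HB Require Import structures.
From mathcomp Require Import all_boot all_order all_algebra.
From mathcomp Require Import all_classical all_reals all_analysis.

Set Implicit Arguments.
Unset Strict Implicit.
Unset Printing Implicit Defensive.
Import Order.TTheory GRing.Theory Num.Theory.
Import numFieldNormedType.Exports.

Local Open Scope classical_set_scope.
Local Open Scope ring_scope.

(* R^n is 'rV[R]_n, with the topology, the normed module structure and the
   directional derivatives that the library puts on it. The library has neither
   a sigma-algebra nor Lebesgue measure on this type: the former is taken to be
   the one generated by the n coordinates (for R^n, the Borel one), the latter
   is the n-fold product of the Lebesgue measure of R. *)

Section measurable_rV.
Context {d} {T : sigmaRingType d} (n : nat).

Let coord : 'I_n -> 'rV[T]_n -> T := fun i v => v ord0 i.

Let rV_set0 : g_sigma_preimage coord set0.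
Proof. exact: sigma_algebra0. Qed.

Let rV_setC A : g_sigma_preimage coord A -> g_sigma_preimage coord (~` A).
Proof. exact: sigma_algebraC. Qed.

Let rV_bigcup (F : (set 'rV[T]_n)^nat) :
  (forall i, g_sigma_preimage coord (F i)) ->
  g_sigma_preimage coord (\bigcup_i F i).
Proof. exact: sigma_algebra_bigcup. Qed.

HB.instance Definition _ := @isMeasurable.Build (measure_tuple_display d)
  'rV[T]_n (g_sigma_preimage coord) rV_set0 rV_setC rV_bigcup.

End measurable_rV.

Lemma measurable_coord d (T : sigmaRingType d) n (i : 'I_n) :
  measurable_fun [set: 'rV[T]_n] (fun v => v ord0 i).
Proof.
move=> _ Y mY; rewrite setTI; apply: sub_sigma_algebra => /=.
rewrite -bigcup_seq/=; exists i => /=; first by rewrite mem_index_enum.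
by exists Y => //; rewrite setTI.
Qed.

Lemma measurable_fun_rVP d1 d2 (T1 : measurableType d1)
    (T2 : measurableType d2) n (f : T1 -> 'rV[T2]_n) :
  measurable_fun [set: T1] f <->
  forall i, measurable_fun [set: T1] (fun x => f x ord0 i).
Proof.
split=> [mf i|mf].
  exact: (measurableT_comp (measurable_coord i) mf).
move=> _ Y mY; rewrite setTI.
suff : g_sigma_preimage (fun i (v : 'rV[T2]_n) => v ord0 i) `<=`
    [set A | measurable (f @^-1` A)] by exact.
apply: smallest_sub.
  split=> /=.
  - by rewrite preimage_set0.
  - by move=> A mA; rewrite setTD preimage_setC; exact: measurableC.
  - by move=> F mF; rewrite preimage_bigcup; exact: bigcupT_measurable.
move=> A; rewrite -bigcup_seq => -[i _ [B mB <-]] /=.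
by rewrite setTI -[X in measurable X]setTI; exact: mf.
Qed.

(* The library's sigma-finite structure on m1 \x m2 is shadowed by the one for
   subprobabilities and is not found by unification. *)
Lemma sigma_finite_product d1 d2 (T1 : measurableType d1)
    (T2 : measurableType d2) (R : realType)
    (m1 : {sigma_finite_measure set T1 -> \bar R})
    (m2 : {sigma_finite_measure set T2 -> \bar R}) :
  sigma_finite setT (m1 \x m2)%E.
Proof.
have /sigma_finiteP[F [TF ndF Foo]] := sigma_finiteT m1.
have /sigma_finiteP[G [TG ndG Goo]] := sigma_finiteT m2.
exists (fun k => F k `*` G k) => [|k].
  rewrite -setXTT TF TG predeqE => -[x y]; split.
    move=> [/= [k _ Fkx] [l _ Gly]]; exists (maxn k l) => //; split.
    - by move: x Fkx; exact/subsetPset/ndF/leq_maxl.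
    - by move: y Gly; exact/subsetPset/ndG/leq_maxr.
  by move=> [k _ []/= ? ?]; split; exists k.
have [? ?] := Foo k; have [? ?] := Goo k.
split; first exact: measurableX.
by rewrite product_measure1E// lte_mul_pinfty// ge0_fin_numE.
Qed.

Section lebesgue_measure_rV.
Context {R : realType}.

Definition cons_rV n (x : R * 'rV[R]_n) : 'rV[R]_n.+1 :=
  row_mx (const_mx x.1 : 'rV[R]_1) x.2.

Definition uncons_rV n (v : 'rV[R]_n.+1) : R * 'rV[R]_n :=
  (v ord0 ord0, \row_j v ord0 (lift ord0 j)).

Lemma cons_rV0 n (x : R * 'rV[R]_n) : cons_rV x ord0 ord0 = x.1.
Proof.
have -> : ord0 = lshift n (ord0 : 'I_1) :> 'I_(1 + n) by exact/val_inj.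
by rewrite (row_mxEl (const_mx x.1 : 'rV_1)) mxE.
Qed.

Lemma cons_rVS n (x : R * 'rV[R]_n) j :
  cons_rV x ord0 (lift ord0 j) = x.2 ord0 j.
Proof.
have -> : lift ord0 j = rshift 1 j :> 'I_(1 + n) by exact/val_inj.
by rewrite (row_mxEr (const_mx x.1 : 'rV_1)).
Qed.

Lemma cons_rVK n : cancel (@cons_rV n) (@uncons_rV n).
Proof.
move=> [t v]; rewrite /uncons_rV cons_rV0; congr pair.
by apply/rowP => j; rewrite mxE cons_rVS.
Qed.

Lemma uncons_rVK n : cancel (@uncons_rV n) (@cons_rV n).
Proof.
move=> v; apply/rowP => i; case: (unliftP ord0 i) => [j|] ->.
  by rewrite cons_rVS mxE.
by rewrite cons_rV0.
Qed.

Lemma measurable_cons_rV n : measurable_fun setT (@cons_rV n).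
Proof.
apply/measurable_fun_rVP => i; case: (unliftP ord0 i) => [j|] ->.
  under eq_fun do rewrite cons_rVS.
  exact: (measurableT_comp (measurable_coord j) measurable_snd).
under eq_fun do rewrite cons_rV0.
exact: measurable_fst.
Qed.

Lemma measurable_uncons_rV n : measurable_fun setT (@uncons_rV n).
Proof.
apply: measurable_fun_pair => /=; first exact: measurable_coord.
apply/measurable_fun_rVP => i.
by under eq_fun do rewrite mxE; exact: measurable_coord.
Qed.

Section step.
Variables (n : nat) (m : {sigma_finite_measure set 'rV[R]_n -> \bar R}).

Definition cons_measure : set 'rV[R]_n.+1 -> \bar R :=
  pushforward (lebesgue_measure \x m)%E (@cons_rV n).

Let measurable_preimage_cons (A : set 'rV[R]_n.+1) : measurable A ->
  measurable (@cons_rV n @^-1` A : set (measurableTypeR R * 'rV[R]_n)).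
Proof.
by move=> mA; rewrite -[X in measurable X]setTI; exact: measurable_cons_rV.
Qed.

Let cons_measure0 : cons_measure set0 = 0%E.
Proof. by rewrite /cons_measure /pushforward preimage_set0 measure0. Qed.

Let cons_measure_ge0 A : (0 <= cons_measure A)%E.
Proof. by rewrite /cons_measure /pushforward; exact: measure_ge0. Qed.

Let cons_measure_sigma_additive : semi_sigma_additive cons_measure.
Proof.
move=> F mF tF mUF; rewrite /cons_measure /pushforward preimage_bigcup.
apply: measure_semi_sigma_additive => [k||].
- exact: measurable_preimage_cons.
- apply/trivIsetP => /= i j _ _ ij; rewrite -preimage_setI.
  by move/trivIsetP : tF => /(_ _ _ _ _ ij) ->//; rewrite preimage_set0.
- by rewrite -preimage_bigcup; exact: measurable_preimage_cons.
Qed.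

HB.instance Definition _ := isMeasure.Build _ _ _ cons_measure
  cons_measure0 cons_measure_ge0 cons_measure_sigma_additive.

Let cons_measure_sigma_finite : sigma_finite setT cons_measure.
Proof.
have [F FT Foo] := sigma_finite_product lebesgue_measure m.
exists (fun k => @uncons_rV n @^-1` F k).
  by rewrite -preimage_bigcup -FT preimage_setT.
move=> k; have [mF Fk] := Foo k; split.
  by rewrite -[X in measurable X]setTI; exact: measurable_uncons_rV.
rewrite /cons_measure /pushforward -comp_preimage.
rewrite (_ : @uncons_rV n \o @cons_rV n = id) ?preimage_id//.
by apply/funext => x /=; rewrite cons_rVK.
Qed.

HB.instance Definition _ := @Measure_isSigmaFinite.Build _ _ _ cons_measure
  cons_measure_sigma_finite.

End step.

Fixpoint lebesgue_rV n : {sigma_finite_measure set 'rV[R]_n -> \bar R} :=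
  match n with
  | 0 => dirac (0 : 'rV[R]_0)
  | n'.+1 => cons_measure (lebesgue_rV n')
  end.

Lemma lebesgue_rV_box n (A : 'I_n -> set R) :
  (forall i, measurable (A i)) ->
  lebesgue_rV n [set v | forall i, A i (v ord0 i)] =
  (\prod_(i < n) lebesgue_measure (A i))%E.
Proof.
elim: n A => [A _|n ih A mA] /=.
  rewrite big_ord0 diracE mem_set//= => -[]//.
pose B := [set v : 'rV[R]_n | forall i, A (lift ord0 i) (v ord0 i)].
have mB : measurable B.
  have -> : B = \bigcap_(i in setT)
      ((fun v : 'rV[R]_n => v ord0 i) @^-1` A (lift ord0 i)).
    by apply/seteqP; split=> [v /= h i _|v /= h i]; [exact: h|exact: (h i I)].
  apply: fin_bigcap_measurable => // i _.
  by rewrite -[X in measurable X]setTI; exact: measurable_coord.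
rewrite big_ord_recl -ih// -product_measure1E//; last exact: (mA ord0).
rewrite /cons_measure /pushforward; congr (_ _).
apply/seteqP; split=> [[t v] /= h|[t v] /= [h1 h2] i].
  split; first by have := h ord0; rewrite cons_rV0.
  by move=> i; have := h (lift ord0 i); rewrite cons_rVS.
case: (unliftP ord0 i) => [j|] ->; first by rewrite cons_rVS; exact: h2.
by rewrite cons_rV0.
Qed.

End lebesgue_measure_rV.
Arguments lebesgue_rV {R} n.

Section Sobolev.
Context {R : realType} {n : nat}.
Local Notation V := 'rV[R]_n.
Local Notation mu := (lebesgue_rV n : {measure set V -> \bar R}).
Implicit Types (u g f phi rho : V -> R) (K : set V) (p : R).

Definition partial (i : 'I_n) u : V -> R := 'D_(delta_mx ord0 i) u.

Definition partials (s : seq 'I_n) u : V -> R := foldr partial u s.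

Definition smooth u := forall s x, differentiable (partials s u) x.

Definition test_function phi :=
  smooth phi /\ compact (closure [set x | phi x != 0]).

Definition Lnorm_on p K u : \bar R := 'N[mu]_(p%:E)[EFin \o (u \_ K)].

Definition Lloc p u :=
  measurable_fun setT u /\ forall K, compact K -> (Lnorm_on p K u < +oo)%E.

Definition weak_gradient u (g : 'I_n -> V -> R) :=
  Lloc 1 u /\ forall i, Lloc 1 (g i) /\
    forall phi, test_function phi ->
      \int[mu]_x (u x * partial i phi x) = - \int[mu]_x (g i x * phi x).

Definition W1loc p u :=
  Lloc p u /\ exists2 g, weak_gradient u g & forall i, Lloc p (g i).

(* The norm of W^{1,p}(K), for u defined on R^n. As a weak gradient is unique up
   to a null set, the infimum is over at most one value; it is +oo if u has no
   locally integrable weak gradient. *)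
Definition W1norm p K u : \bar R :=
  ereal_inf [set (Lnorm_on p K u + \sum_(i < n) Lnorm_on p K (g i))%E
            | g in weak_gradient u].

Definition mollifier rho :=
  [/\ smooth rho,
      forall x, 0 <= rho x,
      forall x, rho x != 0 -> \sum_(i < n) x ord0 i ^+ 2 <= 1 &
      \int[mu]_x rho x = 1].

Definition rescale rho (e : R) : V -> R :=
  fun x => e ^- n * rho (e^-1 *: x).

Definition convolution f g : V -> R := fun x => \int[mu]_y (f y * g (x - y)).

End Sobolev.

(* Main.v *)
From HB Require Import structures.
Require Import Defs.
From mathcomp Require Import all_boot all_order all_algebra.
From mathcomp Require Import all_classical all_reals all_analysis.
From mathcomp Require Import measurable_realfun ring lra.

(* For a kernel k supported in the unit cube put S_k u x = \int u (x - e z) k z,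
   the integral being over that cube; S_rho u is the mollification of u at scale
   e.  With g the weak gradient of a and r_e the commutator,

     partial_i r_e = (S_rho g_i . S_rho f - g_i f) + A_e . S_(partial_i rho) f
                     + \sum_j g_j (S_(z_j partial_i rho) f + delta_ij f) - Q_e,

   where A_e = (S_rho a - a) / e, where Q_e x = \int f (x - e z) partial_i rho z
   D_e (x, z), and where D_e (x, z) = (a (x - e z) - a x) / e + g x . z is the
   remainder of the first-order expansion of a.  Each term tends to 0 in L^r by
   Hoelder's inequality: A_e is bounded in L^p_loc, D_e tends to 0 in L^p_loc
   uniformly in z (fundamental theorem of calculus for the mollifications of a,
   then a passage to the limit), and S_k f tends to (\int k) f in L^q_loc with
   \int partial_i rho = 0 and \int z_j partial_i rho = - delta_ij.  Everything is
   measured by Jp, the integral of |u|^p, instead of norms; Hoelder's inequality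
   then becomes Young's inequality with a free scaling parameter. *)

Set Implicit Arguments.
Unset Strict Implicit.
Unset Printing Implicit Defensive.
Import Order.TTheory GRing.Theory Num.Theory.
Import numFieldNormedType.Exports.
Local Open Scope classical_set_scope.
Local Open Scope ring_scope.

(** * Lebesgue measure under affine maps and on cubes *)

(** Since f and a f need not have weak derivatives, differentiation falls on the kernel and leaves a
    factor 1/e in front of averages that come with no rate of convergence. Subtracting a x, and then
    the linear part of a, inside the average of a f gathers this singular factor into the two
    quotients A_e and D_e; the moments of partial_i rho account for the rest. D_e is controlled in
    L^p in x for each fixed z, not pointwise: on each slice it is paired with f (x - e z), and
    Jensen's inequality in z followed by Tonelli's theorem reassembles the slices. The only rate
    available is the L^p modulus of continuity of g, and it tends to 0 because p is finite; q is
    finite for the same reason on the side of f. Continuity of translations is read off the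
    sigma-algebra: the sets whose indicators are translation continuous form a sigma-algebra
    containing the half-spaces, and simple functions do the rest. The condition q >= p' says r >= 1,
    so that a f is locally integrable and its mollifications converge in L^r. As [W1norm] is an
    infimum, it is bounded through one weak gradient, given by the classical partial derivatives. *)

Section change_of_variables.
Context {R : realType}.

(** The pushforward of Lebesgue measure by the affine map, scaled by [|b|], gives half-open
    intervals their length, so uniqueness of Lebesgue measure applies. *)
Lemma lebesgue_measure_affine (b c : R) (F : R -> \bar R) :
  b != 0 -> measurable_fun [set: R] F -> (forall x, 0 <= F x)%E ->
  (`|b|%:E * \int[lebesgue_measure]_t F (c + b * t)%R =
  \int[lebesgue_measure]_t F t)%E.
Proof.
move=> b0 mF F0; pose phi (t : R) : measurableTypeR R := c + b * t.
have mphi : measurable_fun [set: measurableTypeR R] phi.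
  by apply: measurable_funD => //; exact: measurable_funM.
have Nb : 0 <= `|b| by [].
pose m : {measure set (measurableTypeR R) -> \bar R} := mscale (NngNum Nb)
  (pushforward lebesgue_measure phi).
transitivity (\int[m mphi]_t F t)%E.
  by rewrite ge0_integral_mscale// ge0_integral_pushforward.
apply: eq_measure_integral => A mA _; apply/esym.
apply: (@lebesgue_measure_unique _ (m mphi)) => // _ [[x y]] _ <-/=.
rewrite /mscale/= /pushforward lebesgue_measure_itv/= lte_fin.
have [b1|b1] := ltP 0 b.
  have -> : phi @^-1` `]x, y]%classic = `](x - c) / b, (y - c) / b]%classic.
    apply/seteqP; split=> t; rewrite /phi /= !in_itv/= ltr_pdivrMr// ler_pdivlMr//;
    by rewrite ltrBlDl lerBrDl mulrC.
  rewrite lebesgue_measure_itv/= lte_fin ltr_pM2r ?invr_gt0// ltrD2r.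
  case: ifPn => xy; rewrite ?mule0//.
  rewrite -EFinB -EFinM; congr EFin.
  rewrite gtr0_norm// -mulrBl mulrC divfK//.
  by rewrite opprB addrA subrK.
(* A decreasing map swaps the open and the closed end of the interval, which leaves the length
   unchanged. *)
have {}b1 : b < 0 by rewrite lt_neqAle b0.
have -> : phi @^-1` `]x, y]%classic = `[(y - c) / b, (x - c) / b[%classic.
  apply/seteqP; split=> t; rewrite /phi /= !in_itv/= ler_ndivrMr// ltr_ndivlMr//;
  by rewrite andbC ltrBlDl lerBrDl mulrC.
rewrite lebesgue_measure_itv/= lte_fin ltr_nM2r ?invr_lt0// ltrD2r.
case: ifPn => xy; rewrite ?mule0//.
rewrite -EFinB -EFinM; congr EFin.
rewrite ltr0_norm// -mulrBl mulNr mulrC divfK//.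
by rewrite opprB opprB addrA subrK.
Qed.

Lemma measurable_affine_rV n (b : R) : measurable_fun setT
  (fun x : 'rV[R]_n * 'rV[R]_n => x.1 + b *: x.2).
Proof.
apply/measurable_fun_rVP => i.
under eq_fun do rewrite !mxE.
apply: measurable_funD.
  exact: (measurableT_comp (measurable_coord i) measurable_fst).
apply: measurable_funM => //.
exact: (measurableT_comp (measurable_coord i) measurable_snd).
Qed.

(** Induction on the dimension: the affine map acts separately on the first coordinate and on the
    others, so Tonelli's theorem reduces to the one-dimensional case and the induction hypothesis,
    each coordinate giving one factor [|b|]. *)
Lemma lebesgue_rV_affine n (b : R) (c : 'rV[R]_n) (F : 'rV[R]_n -> \bar R) :
  b != 0 -> measurable_fun setT F -> (forall x, 0 <= F x)%E ->
  ((`|b| ^+ n)%:E * \int[lebesgue_rV n]_x F (c + b *: x)%R =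
  \int[lebesgue_rV n]_x F x)%E.
Proof.
move=> b0; elim: n c F => [|n ih] c F mF F0.
  rewrite expr0 mul1e; apply: eq_integral => x _; congr F.
  by apply/rowP => -[].
have consE (G : 'rV[R]_n.+1 -> \bar R) : measurable_fun setT G -> (forall x, 0 <= G x)%E ->
    (\int[lebesgue_rV n.+1]_x G x =
    \int[lebesgue_measure]_t \int[lebesgue_rV n]_v G (cons_rV (t, v)))%E.
  move=> mG G0; transitivity (\int[lebesgue_measure \x lebesgue_rV n]_z G (cons_rV z))%E.
    have mc : measurable_fun
        [set: measurableTypeR R * 'rV[R]_n] (@cons_rV R n).
      exact: measurable_cons_rV.
    have := ge0_integral_pushforward mc
      (lebesgue_measure \x lebesgue_rV n)%E measurableT mG (fun x _ => G0 x).
    rewrite preimage_setT => <-.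
    apply: eq_measure_integral => A _ _.
    reflexivity.
  rewrite fubini_tonelli1//.
  by apply: measurableT_comp => //; exact: measurable_cons_rV.
have maff : measurable_fun setT (fun x : 'rV[R]_n.+1 => c + b *: x).
  exact: (measurableT_comp (@measurable_affine_rV n.+1 b) (measurable_pair1 c)).
rewrite consE//; last first.
  by apply: measurableT_comp => //.
rewrite consE//.
pose c' : 'rV[R]_n := \row_j c ord0 (lift ord0 j).
have affE t v : c + b *: cons_rV (t, v) =
    cons_rV (c ord0 ord0 + b * t, c' + b *: v).
  have addE m (u w : 'rV[R]_m) i :
    (u + b *: w) ord0 i = u ord0 i + b * w ord0 i by rewrite !mxE.
  apply/rowP => i; rewrite addE; case: (unliftP ord0 i) => [j|] ->.
    by rewrite !cons_rVS addE mxE.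
  by rewrite !cons_rV0.
have mG : measurable_fun setT (F \o @cons_rV R n).
  by apply: measurableT_comp => //; exact: measurable_cons_rV.
have mGt t : measurable_fun setT (fun v => F (cons_rV (t, v))).
  apply: (measurableT_comp mG (measurable_pair1 t)).
pose H t := (\int[lebesgue_rV n]_v F (cons_rV (t, v)))%E.
have mH : measurable_fun [set: measurableTypeR R] H.
  exact: (measurable_fun_fubini_tonelli_F (m2 := lebesgue_rV n)
    (fun z : measurableTypeR R * 'rV[R]_n => F (cons_rV z)) mG (fun z => F0 _)).
have H0 t : (0 <= H t)%E by apply: integral_ge0.
rewrite -(lebesgue_measure_affine (c ord0 ord0) b0 mH H0).
rewrite exprS EFinM -muleA; congr (_ * _)%E.
rewrite -ge0_integralZl_EFin//.
- apply: eq_integral => t _; rewrite /H -(ih c' (fun v => F (cons_rV (_, v))))//.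
  by congr (_ * _)%E; apply: eq_integral => v _; rewrite affE.
- by move=> t _; exact: integral_ge0.
- apply: (measurable_fun_fubini_tonelli_F (m2 := lebesgue_rV n)
    (fun z : measurableTypeR R * 'rV[R]_n => F (c + b *: cons_rV z))) => //.
  apply: (measurableT_comp mF); apply: measurableT_comp maff _.
  exact: measurable_cons_rV.
Qed.
End change_of_variables.

(** The norm on row vectors is the maximum norm, so its closed balls are products of intervals; they
    serve as the exhaustion of the space by compact sets. *)
Definition cube {R : realType} n (M : R) : set 'rV[R]_n := [set x | `|x| <= M].

(** * Cubes, boxes and Borel sets of R^n *)

Section borel_rV.
Context {R : realType} {n : nat}.
Local Notation V := 'rV[R]_n.
Local Notation mu := (lebesgue_rV n : {measure set V -> \bar R}).

Lemma coord_norm_le (x : V) i : `|x ord0 i| <= `|x|.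
Proof.
rewrite [leRHS]/Num.norm /= mx_normrE.
by apply: (@le_bigmax _ _ _ 0 (fun ij : 'I_1 * 'I_n => `|x ij.1 ij.2|) (ord0, i)).
Qed.

Lemma norm_rV_le (x : V) M : 0 <= M ->
  (forall i, `|x ord0 i| <= M) -> `|x| <= M.
Proof.
move=> M0 xM; rewrite [leLHS]/Num.norm /= mx_normrE.
by apply/bigmax_leP; split=> // -[j i] _ /=; rewrite ord1.
Qed.

Lemma cubeE (M : R) : 0 <= M ->
  cube M = [set v : V | forall i, `[- M, M]%classic (v ord0 i)].
Proof.
move=> M0; apply/seteqP; split=> x /=; rewrite /cube /= => xM.
  by move=> i; rewrite in_itv/= -ler_norml (le_trans (coord_norm_le x i)).
by apply: norm_rV_le => // i; have := xM i; rewrite in_itv/= -ler_norml.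
Qed.

Lemma cube_lt0 (M : R) : M < 0 -> cube M = set0 :> set V.
Proof.
move=> M0; apply/seteqP; split=> x //=; rewrite /cube/= => xM.
by have := le_lt_trans xM M0; rewrite normr_lt0.
Qed.

Lemma measurable_box (A : 'I_n -> set R) : (forall i, measurable (A i)) ->
  measurable [set v : V | forall i, A i (v ord0 i)].
Proof.
move=> mA; have -> : [set v : V | forall i, A i (v ord0 i)] =
    \bigcap_(i in setT) ((fun v : V => v ord0 i) @^-1` A i).
  by apply/seteqP; split=> [v /= h i _|v /= h i]; [exact: h|exact: (h i I)].
apply: fin_bigcap_measurable => // i _.
by rewrite -[X in measurable X]setTI; exact: measurable_coord.
Qed.

Lemma measurable_cube (M : R) : measurable (cube M : set V).
Proof.
have [M0|M0] := leP 0 M; last by rewrite cube_lt0.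
by rewrite cubeE//; exact: (measurable_box (A := fun=> `[- M, M]%classic)).
Qed.

Lemma compact_cube (M : R) : compact (cube M : set V).
Proof.
have [M0|M0] := leP 0 M; last by rewrite cube_lt0//; exact: compact0.
rewrite cubeE//; apply: (@rV_compact _ _ (fun=> `[- M, M]%classic)) => _.
exact: segment_compact.
Qed.

Lemma lebesgue_cube_fin (M : R) : (mu (cube M) < +oo)%E.
Proof.
have [M0|M0] := leP 0 M; last by rewrite cube_lt0// measure0.
have -> : mu (cube M) = (\prod_(i < n) lebesgue_measure (`[(- M)%R, M]%classic : set R))%E.
  rewrite cubeE//.
  exact: (@lebesgue_rV_box R n (fun=> `[- M, M]%classic) (fun=> measurable_itv _)).
rewrite (eq_bigr (fun=> (M + M)%:E)); last first.
  move=> i _; rewrite lebesgue_measure_itv/= lte_fin opprK -EFinD.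
  case: ltP => // MM; have -> : M = 0; last by rewrite addr0.
  by apply/eqP; rewrite eq_le M0 andbT; move: MM; rewrite -subr_le0 opprK -mulr2n pmulrn_lle0.
by rewrite prodEFin ltry.
Qed.

Lemma compact_sub_cube (K : set V) : compact K -> exists2 M, 0 < M & K `<=` cube M.
Proof.
move=> /compact_bounded[M [_ KM]]; exists (`|M| + 1).
  by rewrite ltr_wpDl.
by move=> x Kx; apply: (KM (`|M| + 1)) => //; rewrite ltr_pwDr// ler_norm.
Qed.

(** An open set is the union of the half-open grid cubes it contains, of side 1/(k+1) and integer
    corner q/(k+1). There are countably many of them, and each is a box, hence in the sigma-algebra
    generated by the coordinates. *)
Lemma open_measurable_rV (U : set V) : open U -> measurable U.
Proof.
move=> oU.
pose box (kq : nat * 'rV[int]_n) := [set v : V | forall i,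
  [set t | Num.floor (t * kq.1.+1%:R) = kq.2 ord0 i] (v ord0 i)].
pose F kq := if `[< box kq `<=` U >] then box kq else set0.
have -> : U = \bigcup_kq F kq.
  apply/seteqP; split=> [x Ux|x [kq _]]; last first.
    by rewrite /F; case: asboolP => // h /h.
  move: oU; rewrite openE => /(_ _ Ux) /nbhs_ballP[e /= e0 eU].
  have [k ke] : exists k : nat, k.+1%:R^-1 < e.
    have := near_infty_natSinv_lt (PosNum e0) => -[N _ /(_ N)] /=.
    by move=> /(_ (leqnn _)) h; exists N.
  pose q : 'rV[int]_n := \row_i Num.floor (x ord0 i * k.+1%:R).
  exists (k, q) => //; rewrite /F; case: asboolP => [_|].
    by move=> i /=; rewrite mxE.
  case=> y /= yq; apply: eU; rewrite -ball_normE/=.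
  apply: le_lt_trans ke; apply: norm_rV_le; first by rewrite invr_ge0.
  move=> i; have := yq i; rewrite !mxE => xy.
  (* Reals whose multiples by k+1 have the same floor are at distance at most 1/(k+1). *)
  have k0 : 0 < k.+1%:R :> R by rewrite ltr0n.
  rewrite -(ler_pM2r k0) mulVf ?gt_eqF// -{1}(gtr0_norm k0) -normrM mulrBl.
  have /andP[x1 x2] := floor_itv (x ord0 i * k.+1%:R).
  have /andP[y1 y2] := floor_itv (y ord0 i * k.+1%:R).
  move: y1 y2; rewrite xy => y1 y2.
  rewrite intrD in x2 y2.
  rewrite ler_norml; apply/andP; split.
    by rewrite lerBrDl; apply: (le_trans _ x1); rewrite lerBlDr ltW.
  by rewrite lerBlDl; apply: (le_trans (ltW x2)); rewrite lerD2r.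
apply: countable_bigcupT_measurable => [|kq]; first exact: countableP.
rewrite /F; case: asboolP => // _; apply: (measurable_box (A := fun i =>
  [set t | Num.floor (t * kq.1.+1%:R) = kq.2 ord0 i])) => i.
set m := kq.2 ord0 i.
rewrite (_ : [set t | _] = `[m%:~R / kq.1.+1%:R, (m + 1)%:~R / kq.1.+1%:R[%classic).
  exact: measurable_itv.
apply/seteqP; split=> t /=; rewrite in_itv/= ler_pdivrMr ?ltr0n// ltr_pdivlMr ?ltr0n//.
  by move=> <-; exact: floor_itv.
by move=> tm; exact: floor_def.
Qed.

Lemma continuous_measurable_rV (f : V -> R) : continuous f -> measurable_fun setT f.
Proof.
move=> /continuousP cf; apply: (measurability _ (RGenOpens.measurableE R)).
move=> _ [_ [a [b ->] <-]]; rewrite setTI; apply: open_measurable_rV.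
exact/cf/interval_open.
Qed.

Lemma compact_measurable_rV (K : set V) : compact K -> measurable K.
Proof.
move=> cK; rewrite -(setCK K); apply: measurableC; apply: open_measurable_rV.
by apply: closed_openC; apply: compact_closed => //; exact: norm_hausdorff.
Qed.

End borel_rV.

(** * Integrals of p-th powers *)

Section powers.
Context {R : realType}.
Implicit Types x y p q r : R.

Lemma le_powR p x y : 0 <= p -> 0 <= x -> x <= y -> x `^ p <= y `^ p.
Proof. by move=> p0 x0 xy; apply: ge0_ler_powR => //; rewrite nnegrE// (le_trans x0). Qed.

(** A sum is at most twice its larger term. This covers every exponent [p >= 0] without convexity,
    and the crude constant is harmless for quantities that tend to 0. *)
Lemma powRD_le p x y : 0 <= p ->
  `|x + y| `^ p <= 2 `^ p * (`|x| `^ p + `|y| `^ p).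
Proof.
move=> p0; wlog xy : x y / `|x| <= `|y|.
  by move=> h; have [/h//|/ltW/h] := leP `|x| `|y|; rewrite addrC [_ `^ _ + _]addrC.
apply: (@le_trans _ _ (2 `^ p * `|y| `^ p)); last first.
  by rewrite ler_wpM2l ?powR_ge0// lerDr powR_ge0.
rewrite -powRM//; apply: le_powR => //.
by rewrite (le_trans (ler_normD _ _))// mulrC mulr_natr mulr2n lerD2r.
Qed.

Lemma powR_sum_le p n (u : 'I_n -> R) : 0 < p ->
  `|\sum_(i < n) u i| `^ p <= n%:R `^ p * \sum_(i < n) `|u i| `^ p.
Proof.
move=> p0; case: n u => [|n] u.
  by rewrite !big_ord0 normr0 powR0 ?gt_eqF// mul0r.
have [j /= jP] : exists j, forall i, `|u i| <= `|u j|.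
  by exists [arg max_(i > ord0) `|u i|]%O; case: arg_maxP => //= j _ h i; exact: h.
apply: (@le_trans _ _ (n.+1%:R `^ p * `|u j| `^ p)).
  rewrite -powRM//; apply: le_powR => //; first exact: ltW.
  apply: (le_trans (ler_norm_sum _ _ _)).
  apply: (le_trans (ler_sum _ (fun i _ => jP i))).
  by rewrite sumr_const card_ord mulr_natl.
rewrite ler_wpM2l ?powR_ge0// (bigD1 j)//= lerDl.
by apply: sumr_ge0 => i _; exact: powR_ge0.
Qed.

(* Young's inequality for the exponents p/r and q/r, with a free scaling
   parameter *)
Lemma powRM_le p q r l x y : 0 < p -> 0 < q -> r^-1 = p^-1 + q^-1 -> 0 < l ->
  `|x * y| `^ r <= l `^ p * `|x| `^ p + l `^ (- q) * `|y| `^ q.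
Proof.
move=> p0 q0 rE l0.
have r0 : 0 < r by rewrite -invr_gt0 rE addr_gt0// invr_gt0.
(* Moving [l] from one factor to the other leaves the product unchanged and produces the free
   parameter. *)
have -> : `|x * y| = (l * `|x|) * (l^-1 * `|y|).
  by rewrite normrM mulrACA mulfV ?gt_eqF// mul1r.
have lx : 0 <= l * `|x| by rewrite mulr_ge0// ltW.
have ly : 0 <= l^-1 * `|y| by rewrite mulr_ge0// invr_ge0 ltW.
rewrite -(powRM p (ltW l0))//.
have -> : l `^ (- q) * `|y| `^ q = (l^-1 * `|y|) `^ q.
  have l0' := ltW l0; rewrite powRM ?invr_ge0//; congr (_ * _).
  by rewrite -[l^-1]powR_inv1// -powRrM mulN1r.
move: (l * _) (l^-1 * _) lx ly => X Y X0 Y0.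
have pr : r <= p.
  by rewrite -(lef_pV2 p0 r0)// rE lerDl invr_ge0 ltW.
have qr : r <= q.
  by rewrite -(lef_pV2 q0 r0)// rE lerDr invr_ge0 ltW.
have := @conjugate_powR R (X `^ r) (Y `^ r) (p / r) (q / r).
rewrite -!powRrM ![r * _]mulrC !divfK ?gt_eqF// -powRM// => h.
apply: le_trans (h _ _ _ _ _) _; rewrite ?powR_ge0 ?divr_gt0//.
  by rewrite !invfM !invrK -mulrDl -rE mulVf ?gt_eqF.
by rewrite lerD// ler_pdivrMr ?divr_gt0// ler_peMr ?powR_ge0// ler_pdivlMr// mul1r.
Qed.

(** Beyond the threshold [c], the factor [|x| ^ (1 - p)] is at most [c ^ (1 - p)] because [p >= 1].
    Integrated over a set of finite measure and optimised in [c], this replaces Hoelder's inequality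
    against the constant 1. *)
Lemma norm_le_powR p c x : 1 <= p -> 0 < c ->
  `|x| <= c + c `^ (1 - p) * `|x| `^ p.
Proof.
move=> p1 c0; have [xc|cx] := leP `|x| c.
  by rewrite (le_trans xc)// lerDl mulr_ge0// powR_ge0.
have x0 : 0 < `|x| by rewrite (lt_trans c0).
apply: (@le_trans _ _ (c `^ (1 - p) * `|x| `^ p)); last by rewrite lerDr ltW.
rewrite -[leLHS](powRr1 (ltW x0)).
have {1}-> : 1 = (1 - p) + p by rewrite subrK.
rewrite powRD ?(gt_eqF x0) ?implybT// ler_wpM2r ?powR_ge0//.
rewrite -opprB !powRN lef_pV2 ?posrE ?powR_gt0//.
by apply: le_powR; rewrite ?subr_ge0// ltW.
Qed.

End powers.

(** * The integral of |u|^p *)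

HB.lock Definition Jp {d} {T : measurableType d} {R : realType}
    (m : {measure set T -> \bar R}) (D : set T) (p : R) (u : T -> R) : \bar R :=
  (\int[m]_(x in D) (`|u x| `^ p)%:E)%E.
Canonical locked_Jp := Unlockable Jp.unlock.

Section Jp.
Context d (T : measurableType d) (R : realType).
Variable m : {measure set T -> \bar R}.
Implicit Types (D E : set T) (u v : T -> R) (p q r c l : R).

Local Notation Jp := (Jp m).

Lemma JpE D p u : Jp D p u = (\int[m]_(x in D) (`|u x| `^ p)%:E)%E.
Proof. by rewrite unlock. Qed.

Section ge0_real.
Variables (D : set T) (f g : T -> R).
Hypotheses (mD : measurable D) (mf : measurable_fun setT f)
  (mg : measurable_fun setT g) (f0 : forall x, 0 <= f x)
  (g0 : forall x, 0 <= g x).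

Lemma ge0_int_le : (forall x, D x -> f x <= g x) ->
  (\int[m]_(x in D) (f x)%:E <= \int[m]_(x in D) (g x)%:E)%E.
Proof.
move=> fg; apply: ge0_le_integral => //.
- by move=> x _; rewrite lee_fin.
- by apply/measurable_EFinP; exact: measurable_funTS.
- by apply/measurable_EFinP; exact: measurable_funTS.
Qed.

Lemma ge0_intD : (\int[m]_(x in D) (f x)%:E + \int[m]_(x in D) (g x)%:E =
  \int[m]_(x in D) (f x + g x)%:E)%E.
Proof.
rewrite -ge0_integralD//.
- by move=> x _; rewrite lee_fin.
- by apply/measurable_EFinP; exact: measurable_funTS.
- by move=> x _; rewrite lee_fin.
- by apply/measurable_EFinP; exact: measurable_funTS.
Qed.

Lemma ge0_intZ c : 0 <= c -> (c%:E * \int[m]_(x in D) (f x)%:E =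
  \int[m]_(x in D) (c * f x)%:E)%E.
Proof.
move=> c0; rewrite -ge0_integralZl_EFin//.
- by move=> x _; rewrite lee_fin.
- by apply/measurable_EFinP; exact: measurable_funTS.
Qed.

End ge0_real.

Lemma ge0_int_sum D n (f : 'I_n -> T -> R) : measurable D ->
  (forall i, measurable_fun setT (f i)) -> (forall i x, 0 <= f i x) ->
  (\sum_(i < n) \int[m]_(x in D) (f i x)%:E =
   \int[m]_(x in D) (\sum_(i < n) f i x)%:E)%E.
Proof.
move=> mD mf f0; rewrite -ge0_integral_sum//.
- by apply: eq_integral => x _; rewrite sumEFin.
- by move=> i; apply/measurable_EFinP; exact: measurable_funTS.
- by move=> i x _; rewrite lee_fin.
Qed.

Lemma measurable_powR_norm p u : measurable_fun setT u ->
  measurable_fun setT (fun x => `|u x| `^ p).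
Proof.
by move=> mu; apply: (measurableT_comp (measurable_powR p)); exact: measurableT_comp.
Qed.
#[local] Hint Resolve measurable_powR_norm powR_ge0 : core.

Lemma Jp_ge0 D p u : (0 <= Jp D p u)%E.
Proof. by rewrite JpE; apply: integral_ge0 => x _; rewrite lee_fin powR_ge0. Qed.

Lemma Jp_subset D E p u : measurable D -> measurable E ->
  measurable_fun setT u -> D `<=` E -> (Jp D p u <= Jp E p u)%E.
Proof.
move=> mD mE mu DE; rewrite !JpE; apply: ge0_subset_integral => //.
by apply/measurable_EFinP; apply: measurable_funTS; exact: measurable_powR_norm.
Qed.

Lemma Jp_le D p u v : measurable D -> measurable_fun setT u ->
  measurable_fun setT v -> 0 <= p -> (forall x, D x -> `|u x| <= `|v x|) ->
  (Jp D p u <= Jp D p v)%E.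
Proof.
move=> mD mu mv p0 uv; rewrite !JpE; apply: ge0_int_le => //; [exact: measurable_powR_norm..|].
by move=> x Dx; apply: le_powR => //; exact: uv.
Qed.

Lemma JpD D p u v : measurable D -> measurable_fun setT u ->
  measurable_fun setT v -> 0 <= p ->
  (Jp D p (fun x => u x + v x)%R <= (2 `^ p)%:E * (Jp D p u + Jp D p v))%E.
Proof.
move=> mD mu mv p0; have mup := measurable_powR_norm p mu.
have mvp := measurable_powR_norm p mv; rewrite !JpE ge0_intD// ge0_intZ//.
- apply: ge0_int_le => //.
  + by apply: measurable_powR_norm; exact: measurable_funD.
  + by apply: measurable_funM => //; exact: measurable_funD.
  + by move=> x Dx; rewrite powRD_le.
- exact: measurable_funD.
Qed.

Lemma JpN D p u : Jp D p (fun x => - u x) = Jp D p u.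
Proof. by rewrite !JpE; apply: eq_integral => x _; rewrite normrN. Qed.

Lemma JpZ D p c u : measurable D -> measurable_fun setT u ->
  (Jp D p (fun x => c * u x)%R = (`|c| `^ p)%:E * Jp D p u)%E.
Proof.
move=> mD mu; rewrite !JpE ge0_intZ//; last exact: measurable_powR_norm.
by apply: eq_integral => x _; rewrite normrM powRM.
Qed.

Lemma Jp_sum D p n (u : 'I_n -> T -> R) : measurable D ->
  (forall i, measurable_fun setT (u i)) -> 0 < p ->
  (Jp D p (fun x => \sum_(i < n) u i x)%R <=
    (n%:R `^ p)%:E * \sum_(i < n) Jp D p (u i))%E.
Proof.
move=> mD mu p0; have mup i := measurable_powR_norm p (mu i).
have s0 x : 0 <= \sum_(i < n) `|u i x| `^ p by exact: sumr_ge0.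
rewrite JpE (eq_bigr _ (fun i _ => JpE _ _ _)) ge0_int_sum// ge0_intZ//.
- apply: ge0_int_le => //; last 1 first.
  + by move=> x Dx; rewrite powR_sum_le.
  + by apply: measurable_powR_norm; exact: measurable_sum.
  + by apply: measurable_funM => //; exact: measurable_sum.
- exact: measurable_sum.
Qed.

Lemma JpM D p q r l u v : measurable D -> measurable_fun setT u ->
  measurable_fun setT v -> 0 < p -> 0 < q -> r^-1 = p^-1 + q^-1 -> 0 < l ->
  (Jp D r (fun x => u x * v x)%R <=
    (l `^ p)%:E * Jp D p u + (l `^ (- q))%:E * Jp D q v)%E.
Proof.
move=> mD mu mv p0 q0 rE l0.
have mup := measurable_powR_norm p mu; have mvp := measurable_powR_norm q mv.
have mup' : measurable_fun setT (fun x => l `^ p * `|u x| `^ p).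
  exact: measurable_funM.
have mvp' : measurable_fun setT (fun x => l `^ (- q) * `|v x| `^ q).
  exact: measurable_funM.
rewrite !JpE (ge0_intZ mD mup)//.
rewrite (ge0_intZ mD mvp)//.
rewrite ge0_intD//.
- apply: ge0_int_le => //.
  + by apply: measurable_powR_norm; exact: measurable_funM.
  + exact: measurable_funD.
  + by move=> x Dx; rewrite powRM_le.
- by move=> x; apply: mulr_ge0; exact: powR_ge0.
- by move=> x; apply: mulr_ge0; exact: powR_ge0.
Qed.

Lemma Jp_integral_le D p c u : measurable D -> measurable_fun setT u ->
  1 <= p -> 0 < c ->
  (\int[m]_(x in D) `|u x|%:E <= c%:E * m D + (c `^ (1 - p))%:E * Jp D p u)%E.
Proof.
move=> mD mu p1 c0; have mup := measurable_powR_norm p mu.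
have mup' : measurable_fun setT (fun x => c `^ (1 - p) * `|u x| `^ p).
  exact: measurable_funM.
rewrite !JpE ge0_intZ//.
rewrite -(integral_cst m mD c%:E)/= ge0_intD//.
- apply: ge0_int_le => //.
  + exact: measurableT_comp.
  + exact: measurable_funD.
  + by move=> x Dx; rewrite norm_le_powR.
- by move=> x; rewrite ltW.
- by move=> x; apply: mulr_ge0; exact: powR_ge0.
Qed.

Lemma Jp_integrable D p u : measurable D -> measurable_fun setT u -> 1 <= p ->
  (m D < +oo)%E -> (Jp D p u < +oo)%E -> m.-integrable D (EFin \o u).
Proof.
move=> mD mu p1 mDoo Joo; apply/integrableP; split.
  by apply/measurable_EFinP; exact: measurable_funTS.
apply: le_lt_trans (Jp_integral_le mD mu p1 ltr01) _.
by rewrite powR1 !mul1e lte_add_pinfty.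
Qed.

(** [Jp_integral_le] holds for every threshold [c]; choosing [c] as the p-th root of [Jp D p u]
    makes the right-hand side [c * (1 + m D)]. The summand 1 also keeps the constant positive on
    null sets, so the bound is infinite when [Jp D p u] is. *)
Lemma Jensen_Jp D p u : measurable D -> measurable_fun setT u -> 1 <= p ->
  (m D < +oo)%E ->
  ((`|\int[m]_(x in D) u x|%R `^ p)%:E <= ((1 + fine (m D)) `^ p)%:E * Jp D p u)%E.
Proof.
move=> mD mu p1 mDoo.
have p0 : 0 < p by rewrite (lt_le_trans ltr01).
have M0 : 0 <= fine (m D) by exact: fine_ge0.
have C0 : 0 < (1 + fine (m D)) `^ p by rewrite powR_gt0// ltr_pwDl.
have [Joo|] := ltP (Jp D p u) +oo%E; last first.
  by rewrite leye_eq => /eqP ->; rewrite gt0_muley ?leey// lte_fin.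
have iu := Jp_integrable mD mu p1 mDoo Joo.
have J0 := Jp_ge0 D p u.
have JE : Jp D p u = (fine (Jp D p u))%:E by rewrite fineK// ge0_fin_numE.
have mE : m D = (fine (m D))%:E by rewrite fineK// ge0_fin_numE.
have key c : 0 < c -> `|\int[m]_(x in D) u x|%R <=
    c * fine (m D) + c `^ (1 - p) * fine (Jp D p u).
  move=> c0; rewrite -lee_fin EFin_normr_Rintegral//.
  apply: le_trans (le_abse_integral _ _ _) _ => //.
    by apply/measurable_EFinP; exact: measurable_funTS.
  apply: le_trans (Jp_integral_le mD mu p1 c0) _.
  by rewrite EFinD !EFinM -JE -mE.
rewrite JE -EFinM lee_fin.
have : 0 <= fine (Jp D p u) by exact: fine_ge0.
(* If [Jp D p u] is 0 that threshold is not positive; the threshold is then made arbitrarily small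
   instead. *)
rewrite le_eqVlt => /predU1P[J0'|Jgt0].
  have -> : `|\int[m]_(x in D) u x|%R = 0; last first.
    by rewrite powR0 ?gt_eqF// -J0' mulr0.
  apply/eqP; rewrite eq_le normr_ge0 andbT; apply/ler_addgt0Pr => e e0.
  have c0 : 0 < e / (1 + fine (m D)) by rewrite divr_gt0// ltr_pwDl.
  apply: le_trans (key _ c0) _; rewrite -J0' mulr0 addr0 add0r.
  rewrite mulrAC ler_pdivrMr ?ltr_pwDl// ler_wpM2l ?(ltW e0)//.
  by rewrite lerDr.
pose c := fine (Jp D p u) `^ p^-1.
have c0 : 0 < c by rewrite powR_gt0.
have cp : c `^ p = fine (Jp D p u).
  by rewrite -powRrM mulVf ?gt_eqF// powRr1// ltW.
rewrite -cp -powRM ?addr_ge0 ?(ltW c0)//.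
apply: le_powR => //; first exact: ltW.
apply: le_trans (key _ c0) _; rewrite -cp -powRD ?subrK ?(gt_eqF c0) ?implybT//.
by rewrite powRr1 ?(ltW c0)// mulrDl mul1r addrC mulrC.
Qed.

End Jp.

(** * Quantities vanishing with the scale *)

Section vanish.
Context {R : realType}.
Implicit Types (F G H : R -> \bar R) (e eta c k : R).

(** Right convergence to 0 written with upper bounds alone, so that extended values need no
    finiteness argument; for nonnegative [F] it gives the usual limit by [vanish_cvg]. *)
Definition vanish F := forall eta, 0 < eta ->
  exists2 delta, 0 < delta & forall e, 0 < e < delta -> (F e <= eta%:E)%E.

(** The factor [k] may depend on [eta]: a parameter can be fixed in terms of [eta], at the cost of a
    large constant, before [e] tends to 0. *)
Lemma vanish_bound F H :
  (forall eta, 0 < eta -> exists2 k, 0 < k &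
    forall e, 0 < e <= 1 -> (F e <= eta%:E + k%:E * H e)%E) ->
  vanish H -> vanish F.
Proof.
move=> FH vH eta eta0; have eta2 : 0 < eta / 2 by rewrite divr_gt0.
have [k k0 FHk] := FH _ eta2.
have [delta d0 dH] := vH _ (divr_gt0 eta2 k0).
exists (Num.min delta 1); first by rewrite lt_min d0/=.
move=> e /andP[e0]; rewrite lt_min => /andP[ed e1].
apply: le_trans (FHk _ _) _; first by rewrite e0 ltW.
rewrite [in leRHS](splitr eta) EFinD leeD2l//.
apply: (@le_trans _ _ (k%:E * (eta / 2 / k)%:E)%E).
  by rewrite lee_wpmul2l ?lee_fin ?(ltW k0)// dH// e0.
by rewrite -EFinM lee_fin mulrC divfK ?gt_eqF.
Qed.

Lemma vanish_le F G : (forall e, 0 < e <= 1 -> (F e <= G e)%E) ->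
  vanish G -> vanish F.
Proof.
move=> FG; apply: vanish_bound => eta eta0; exists 1 => // e e1.
by rewrite mul1e (le_trans (FG _ e1))// leeDr// lee_fin ltW.
Qed.

Lemma vanishZ F c : 0 <= c -> vanish F -> vanish (fun e => c%:E * F e)%E.
Proof.
move=> c0 vF; have c1 : 0 < c + 1 by rewrite ltr_wpDl.
move=> eta eta0; have [delta d0 dF] := vF _ (divr_gt0 eta0 c1).
exists delta => // e /dF Fe; apply: (@le_trans _ _ (c%:E * (eta / (c + 1))%:E)%E).
  by rewrite lee_wpmul2l.
rewrite -EFinM lee_fin mulrCA ger_pMr// ler_pdivrMr// mul1r.
by rewrite lerDl.
Qed.

Lemma vanishD F G : vanish F -> vanish G -> vanish (fun e => F e + G e)%E.
Proof.
move=> vF vG eta eta0; have eta2 : 0 < eta / 2 by rewrite divr_gt0.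
have [d1 d10 dF] := vF _ eta2; have [d2 d20 dG] := vG _ eta2.
exists (Num.min d1 d2); first by rewrite lt_min d10.
move=> e /andP[e0]; rewrite lt_min => /andP[e1 e2].
by rewrite (splitr eta) EFinD leeD ?dF ?dG ?e0.
Qed.

Lemma vanish0 : vanish (fun=> 0%E).
Proof. by move=> eta eta0; exists 1 => // e _; rewrite lee_fin ltW. Qed.

Lemma vanish_sum n (F : 'I_n -> R -> \bar R) : (forall i, vanish (F i)) ->
  vanish (fun e => \sum_(i < n) F i e)%E.
Proof.
move=> vF; rewrite (_ : (fun e => _) = \sum_(i < n) F i); last first.
  by apply/funext => e; rewrite fct_sumE.
elim/big_ind : _ => //; first exact: vanish0.
by move=> G H; exact: vanishD.
Qed.

Lemma vanish_cvg F : (forall e, 0 <= F e)%E -> vanish F -> F e @[e --> 0^'+] --> 0%E.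
Proof.
move=> F0 vF; apply/fine_cvgP; split.
  have [d d0 dF] := vF _ ltr01; near=> e.
  rewrite ge0_fin_numE// (le_lt_trans (dF _ _)) ?ltry//.
  by apply/andP; split; near: e; [exact: nbhs_right_gt|exact: nbhs_right_lt].
apply/cvgrPdist_le => eta eta0; have [d d0 dF] := vF _ eta0; near=> e.
have {}dF : (F e <= eta%:E)%E.
  apply: dF; apply/andP; split; near: e; [exact: nbhs_right_gt|exact: nbhs_right_lt].
rewrite sub0r normrN /= ger0_norm ?fine_ge0// -lee_fin fineK//.
by rewrite ge0_fin_numE// (le_lt_trans dF)// ltry.
Unshelve. all: by end_near. Qed.

(** The parameter [l] is chosen first, to bring the bounded term below [eta]; the constant
    [l ^ (- q)] is then fixed and does not hinder the vanishing of the other term. *)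
Lemma vanish_young F H (B p q : R) : 0 < p ->
  (forall l e, 0 < l -> 0 < e <= 1 ->
    (F e <= (l `^ p)%:E * B%:E + (l `^ (- q))%:E * H e)%E) ->
  vanish H -> vanish F.
Proof.
move=> p0 FBH; apply: vanish_bound => eta eta0.
(* [|B| + 1] is a positive upper bound of [B], whatever the sign of [B], by which one can divide. *)
have B1 : 0 < `|B| + 1 by rewrite ltr_wpDl.
pose l := (eta / (`|B| + 1)) `^ p^-1.
have l0 : 0 < l by rewrite powR_gt0// divr_gt0.
have lp : l `^ p = eta / (`|B| + 1).
  by rewrite -powRrM mulVf ?gt_eqF// powRr1// ltW// divr_gt0.
exists (l `^ (- q)); first by rewrite powR_gt0.
move=> e e1; apply: le_trans (FBH l e l0 e1) _.
rewrite leeD2r// lp -EFinM lee_fin mulrAC ler_pdivrMr// ler_pM2l//.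
by rewrite (le_trans (ler_norm B))// lerDl.
Qed.

Lemma vanish_poweR F (s : R) : 0 < s ->
  (forall e, 0 <= F e)%E -> vanish F -> vanish (fun e => F e `^ s)%E.
Proof.
move=> s0 F0 vF eta eta0; have es0 : 0 < eta `^ s^-1 by rewrite powR_gt0.
have [d d0 dF] := vF _ es0; exists d => // e /dF Fe.
have := F0 e; move: Fe; case: (F e) => [a||]//; rewrite !lee_fin => ae a0.
rewrite (le_trans (le_powR (ltW s0) a0 ae))//.
by rewrite -powRrM mulVf ?gt_eqF// powRr1// ltW.
Qed.

End vanish.

(** * Sums and products of families converging in L^p *)

Section Jp_vanish.
Context d (T : measurableType d) (R : realType).
Variables (m : {measure set T -> \bar R}) (D : set T).
Hypothesis mD : measurable D.
Implicit Types (u v : T -> R) (p q r e B : R).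

Lemma Jp_vanishD p (u v : R -> T -> R) : 0 <= p ->
  (forall e, 0 < e <= 1 -> measurable_fun setT (u e)) ->
  (forall e, 0 < e <= 1 -> measurable_fun setT (v e)) ->
  vanish (fun e => Jp m D p (u e)) -> vanish (fun e => Jp m D p (v e)) ->
  vanish (fun e => Jp m D p (fun x => u e x + v e x)).
Proof.
move=> p0 mu mv vu vv; apply: (vanish_le _ (vanishZ (powR_ge0 2 p) (vanishD vu vv))).
by move=> e e1; apply: JpD => //; [exact: mu|exact: mv].
Qed.

Lemma Jp_vanishM p q r B (u v : R -> T -> R) :
  0 < p -> 0 < q -> r^-1 = p^-1 + q^-1 ->
  (forall e, 0 < e <= 1 -> measurable_fun setT (u e)) ->
  (forall e, 0 < e <= 1 -> measurable_fun setT (v e)) ->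
  (forall e, 0 < e <= 1 -> (Jp m D p (u e) <= B%:E)%E) ->
  vanish (fun e => Jp m D q (v e)) ->
  vanish (fun e => Jp m D r (fun x => u e x * v e x)).
Proof.
move=> p0 q0 rE mu mv uB vv; apply: (vanish_young p0 _ vv (B := B) (q := q)) => l e l0 e1.
apply: le_trans (JpM m mD (mu _ e1) (mv _ e1) p0 q0 rE l0) _.
by rewrite leeD2r// lee_wpmul2l ?uB// lee_fin powR_ge0.
Qed.

(** Uses u v - u0 v0 = (u - u0) (v - v0) + u0 (v - v0) + v0 (u - u0): in the last two products one
    factor is fixed, and in the first both tend to 0, so Young's inequality with parameter 1 is
    enough. *)
Lemma Jp_cvgM p q r (u v : R -> T -> R) u0 v0 :
  0 < p -> 0 < q -> r^-1 = p^-1 + q^-1 ->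
  (forall e, 0 < e <= 1 -> measurable_fun setT (u e)) ->
  (forall e, 0 < e <= 1 -> measurable_fun setT (v e)) ->
  measurable_fun setT u0 -> measurable_fun setT v0 ->
  (Jp m D p u0 < +oo)%E -> (Jp m D q v0 < +oo)%E ->
  vanish (fun e => Jp m D p (fun x => u e x - u0 x)%R) ->
  vanish (fun e => Jp m D q (fun x => v e x - v0 x)%R) ->
  vanish (fun e => Jp m D r (fun x => u e x * v e x - u0 x * v0 x)%R).
Proof.
move=> p0 q0 rE mu mv mu0 mv0 u0oo v0oo vu vv.
have r0 : 0 < r by rewrite -invr_gt0 rE addr_gt0// invr_gt0.
have mB (f : R -> T -> R) (f0 : T -> R) : (forall e, 0 < e <= 1 -> measurable_fun setT (f e)) ->
    measurable_fun setT f0 ->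
    forall e, 0 < e <= 1 -> measurable_fun setT (fun x => f e x - f0 x).
  by move=> mf mf0 e e1; apply: measurable_funB => //; exact: mf.
have bnd s (f0 : T -> R) : (Jp m D s f0 < +oo)%E -> (Jp m D s f0 <= (fine (Jp m D s f0))%:E)%E.
  by move=> foo; rewrite fineK// ge0_fin_numE// Jp_ge0.
have rE' : r^-1 = q^-1 + p^-1 by rewrite addrC.
have v1 : vanish (fun e => Jp m D r (fun x => u0 x * (v e x - v0 x))%R).
  apply: (@Jp_vanishM p q r (fine (Jp m D p u0)) (fun=> u0)) => //; first exact: mB.
  by move=> e _; exact: bnd.
have v2 : vanish (fun e => Jp m D r (fun x => v0 x * (u e x - u0 x))%R).
  apply: (@Jp_vanishM q p r (fine (Jp m D q v0)) (fun=> v0)) => //; first exact: mB.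
  by move=> e _; exact: bnd.
have v3 : vanish (fun e => Jp m D r (fun x => (u e x - u0 x) * (v e x - v0 x))%R).
  apply: (vanish_le (G := fun e => Jp m D p (fun x => u e x - u0 x)%R +
     Jp m D q (fun x => v e x - v0 x)%R))%E; last exact: vanishD.
  move=> e e1; apply: le_trans (JpM m mD _ _ p0 q0 rE ltr01) _; [exact: mB..|].
  by rewrite !powR1 !mul1e.
have := Jp_vanishD (ltW r0) _ _ v3 (Jp_vanishD (ltW r0) _ _ v1 v2).
rewrite (_ : (fun e => Jp _ _ _ (fun x => _ + _)) =
  (fun e => Jp m D r (fun x => u e x * v e x - u0 x * v0 x))).
  apply; move=> e e1.
  - by apply: measurable_funM; exact: mB.
  - by apply: measurable_funD; apply: measurable_funM => //; exact: mB.
  - by apply: measurable_funM => //; exact: mB.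
  - by apply: measurable_funM => //; exact: mB.
by apply/funext => e; congr Jp; apply/funext => x; ring.
Qed.

End Jp_vanish.

(** * Tonelli's theorem over a product of measurable sets *)

Section tonelli.
Context d1 d2 (T1 : measurableType d1) (T2 : measurableType d2) (R : realType).
Variables (m1 : {sigma_finite_measure set T1 -> \bar R}).
Variables (m2 : {sigma_finite_measure set T2 -> \bar R}).
Variables (D1 : set T1) (D2 : set T2) (f : T1 * T2 -> R).
Hypotheses (mD1 : measurable D1) (mD2 : measurable D2)
  (mf : measurable_fun setT f) (f0 : forall x, 0 <= f x).

Let g : T1 * T2 -> \bar R := (EFin \o f) \_ (D1 `*` D2).

Let mg : measurable_fun setT g.
Proof.
apply/(measurable_restrictT _ _).1; first exact: measurableX.
by apply: measurable_funTS; exact/measurable_EFinP.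
Qed.

Let g0 x : (0 <= g x)%E.
Proof. by apply: erestrict_ge0 => y _; rewrite lee_fin. Qed.

Let gE1 x : (\int[m2]_y g (x, y) =
  ((fun x => \int[m2]_(y in D2) (f (x, y))%:E) \_ D1) x)%E.
Proof.
rewrite patchE; case: ifPn => xD; last first.
  apply: integral0_eq => y _; rewrite /g patchE ifF//.
  by apply/negP; rewrite inE/= => -[/mem_set]; rewrite (negbTE xD).
rewrite [RHS]integral_mkcond; apply: eq_integral => y _; rewrite /g !patchE.
by rewrite in_setX/= xD.
Qed.

Let gE2 y : (\int[m1]_x g (x, y) =
  ((fun y => \int[m1]_(x in D1) (f (x, y))%:E) \_ D2) y)%E.
Proof.
rewrite patchE; case: ifPn => yD; last first.
  apply: integral0_eq => x _; rewrite /g patchE ifF//.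
  by apply/negP; rewrite inE/= => -[_ /mem_set]; rewrite (negbTE yD).
rewrite [RHS]integral_mkcond; apply: eq_integral => x _; rewrite /g !patchE.
by rewrite in_setX/= yD andbT.
Qed.

Lemma tonelli_in : (\int[m1]_(x in D1) \int[m2]_(y in D2) (f (x, y))%:E =
  \int[m2]_(y in D2) \int[m1]_(x in D1) (f (x, y))%:E)%E.
Proof.
rewrite integral_mkcond [RHS]integral_mkcond.
under eq_integral do rewrite -gE1.
under [RHS]eq_integral do rewrite -gE2.
exact: fubini_tonelli.
Qed.

Lemma measurable_tonelli_in :
  measurable_fun D1 (fun x => \int[m2]_(y in D2) (f (x, y))%:E)%E.
Proof.
apply/(measurable_restrictT _ mD1).2.
rewrite (_ : _ \_ _ = (fun x => \int[m2]_y g (x, y))%E); last first.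
  by apply/funext => x; rewrite gE1.
exact: measurable_fun_fubini_tonelli_F.
Qed.

End tonelli.

(** * Continuity of translations in L^p *)

Lemma in_mkset T (P : pred T) x : (x \in [set y | P y]) = P x.
Proof. by apply/idP/idP => [/set_mem|Px]; last exact: mem_set. Qed.

Section translation.
Context {R : realType} {n : nat}.
Local Notation V := 'rV[R]_n.
Local Notation mu := (lebesgue_rV n : {measure set V -> \bar R}).
Implicit Types (u v : V -> R) (h : V) (M t eta delta p b : R).

Lemma measurable_affine b (c : V) : measurable_fun setT (fun x : V => c + b *: x).
Proof. exact: (measurableT_comp (@measurable_affine_rV R n b) (measurable_pair1 c)). Qed.

Lemma measurable_shift h u : measurable_fun setT u ->
  measurable_fun setT (fun x : V => u (x + h)).
Proof.
move=> mu'; rewrite (_ : (fun x => _) = u \o (fun x => h + 1 *: x)).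
  by apply: measurableT_comp => //; exact: measurable_affine.
by apply/funext => x /=; rewrite scale1r addrC.
Qed.

Lemma cube_shift M t x h : cube M x -> `|h| <= t -> cube (M + t) (x + h).
Proof. by move=> xM ht; apply: le_trans (ler_normD _ _) _; exact: lerD. Qed.

Lemma sub_cube M t : M <= t -> cube M `<=` (cube t : set V).
Proof. by move=> Mt x; exact: (fun y => le_trans y Mt). Qed.

(** Translation invariance for the extension of [F] by zero; the cube grows by [t] because the
    translate of [cube M] by [h] lies in [cube (M + t)]. *)
Lemma int_shift_le h M t (F : V -> R) : measurable_fun setT F ->
  (forall x, 0 <= F x) -> `|h| <= t ->
  (\int[mu]_(x in cube M) (F (x + h)%R)%:E <= \int[mu]_(x in cube (M + t)) (F x)%:E)%E.
Proof.
move=> mF F0 ht; rewrite integral_mkcond [leRHS]integral_mkcond.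
have mF' K : measurable K -> measurable_fun setT ((fun x => (F x)%:E) \_ K).
  move=> mK; suff : measurable_fun K (fun x => (F x)%:E).
    by move/(measurable_restrictT _ mK).
  by apply/measurable_EFinP; exact: measurable_funTS.
have F'0 (G : V -> R) (K : set V) x : (forall x, 0 <= G x) ->
    (0 <= ((fun x => (G x)%:E) \_ K) x)%E.
  by move=> G0; apply: erestrict_ge0 => y _; rewrite lee_fin.
rewrite -[leRHS](@lebesgue_rV_affine R n 1 h)//; last 2 first.
- by apply: mF'; exact: measurable_cube.
- by move=> x; exact: F'0.
rewrite normr1 expr1n mul1e; apply: ge0_le_integral => //.
- by move=> x _; apply: F'0.
- suff : measurable_fun (cube M) (fun x => (F (x + h)%R)%:E).
    by move/(measurable_restrictT _ (measurable_cube _)).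
  by apply/measurable_EFinP; apply: measurable_funTS; exact: measurable_shift.
- apply: (measurableT_comp (mF' _ (measurable_cube _))).
  exact: measurable_affine.
- move=> x _; rewrite !patchE; case: ifPn => xM; last first.
    by case: ifPn => // _; rewrite lee_fin.
  rewrite mem_set/=; first by rewrite scale1r addrC.
  by rewrite scale1r [h + x]addrC; apply: cube_shift ht; exact: set_mem xM.
Qed.

Lemma Jp_shift_le h M t p u : measurable_fun setT u -> `|h| <= t ->
  (Jp mu (cube M) p (fun x => u (x + h))%R <= Jp mu (cube (M + t)) p u)%E.
Proof.
move=> mu' ht; rewrite !JpE.
apply: (@int_shift_le h M t (fun x => `|u x| `^ p)) => //.
exact: measurable_powR_norm.
Qed.

Definition shift_cvg p u := forall M eta, 0 < eta ->
  exists2 delta, 0 < delta & forall h, `|h| <= delta ->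
    (Jp mu (cube M) p (fun x => u (x + h) - u x)%R <= eta%:E)%E.

Section fixed_p.
Variable p : R.
Hypothesis p0 : 0 < p.

Lemma shift_cvgD u v : measurable_fun setT u -> measurable_fun setT v ->
  shift_cvg p u -> shift_cvg p v -> shift_cvg p (fun x => u x + v x).
Proof.
move=> mu' mv su sv M eta eta0.
have c0 : 0 < 2 `^ p :> R by rewrite powR_gt0.
have eta2 : 0 < eta / 2 `^ p / 2 by rewrite !divr_gt0.
have [d1 d10 h1] := su M _ eta2; have [d2 d20 h2] := sv M _ eta2.
exists (Num.min d1 d2); first by rewrite lt_min d10.
move=> h; rewrite le_min => /andP[hd1 hd2].
rewrite (_ : (fun x => _) = (fun x => (u (x + h) - u x) + (v (x + h) - v x))); last first.
  by apply/funext => x; ring.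
apply: le_trans (JpD _ _ _ _ _) _; [exact: measurable_cube| | |exact: ltW|].
- by apply: measurable_funB => //; exact: measurable_shift.
- by apply: measurable_funB => //; exact: measurable_shift.
apply: (@le_trans _ _ ((2 `^ p)%:E * ((eta / 2 `^ p / 2)%:E + (eta / 2 `^ p / 2)%:E))%E).
  by rewrite lee_wpmul2l ?lee_fin ?(ltW c0)// leeD ?h1 ?h2.
by rewrite -EFinD -splitr -EFinM mulrC divfK ?gt_eqF.
Qed.

Lemma shift_cvgZ c u : measurable_fun setT u -> shift_cvg p u -> shift_cvg p (fun x => c * u x).
Proof.
move=> mu' su M eta eta0; have c0 : 0 < `|c| `^ p + 1 by rewrite ltr_wpDl// powR_ge0.
have [d d0 hd] := su M _ (divr_gt0 eta0 c0); exists d => // h /hd uh.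
rewrite (_ : (fun x => _) = (fun x => c * (u (x + h) - u x))); last first.
  by apply/funext => x; ring.
rewrite JpZ; last 2 first.
- exact: measurable_cube.
- by apply: measurable_funB => //; exact: measurable_shift.
apply: (@le_trans _ _ ((`|c| `^ p)%:E * (eta / (`|c| `^ p + 1))%:E)%E).
  by rewrite lee_wpmul2l ?lee_fin ?powR_ge0.
rewrite -EFinM lee_fin mulrCA ger_pMr// ler_pdivrMr// mul1r.
by rewrite lerDl.
Qed.

Lemma shift_cvg_sum k (u : 'I_k -> V -> R) : (forall i, measurable_fun setT (u i)) ->
  (forall i, shift_cvg p (u i)) -> shift_cvg p (fun x => \sum_(i < k) u i x).
Proof.
move=> mu' su; suff : measurable_fun setT (\sum_(i < k) u i) /\ shift_cvg p (\sum_(i < k) u i).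
  rewrite (_ : \sum_(i < k) u i = (fun x => \sum_(i < k) u i x)); first by case.
  by apply/funext => x; rewrite fct_sumE.
apply: (big_ind (fun f => measurable_fun setT f /\ shift_cvg p f)).
- split; first exact: measurable_cst.
  move=> M eta eta0; exists 1 => // h _; rewrite !JpE.
  rewrite (eq_integral (cst 0%E)) ?integral0 ?lee_fin ?(ltW eta0)// => x _.
  by rewrite /GRing.zero/= subrr normr0 powR0// gt_eqF.
- move=> f g [mf sf] [mg sg]; split; first exact: measurable_funD.
  exact: shift_cvgD.
- by move=> i _; split; [exact: mu'|exact: su].
Qed.

Let good (A : set V) := measurable A /\ shift_cvg p (\1_A : V -> R).

(** The symmetric difference of [A] and its translate by [- h], that is, the set where the two
    indicators differ. *)
Let flip h (A : set V) := [set x | (x + h \in A) (+) (x \in A)].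

Let measurable_flip h (A : set V) : measurable A -> measurable (flip h A).
Proof.
move=> mA; have mAx : measurable_fun setT (\1_A : V -> R) by exact: measurable_indic.
rewrite (_ : flip h A = (fun x => \1_A (x + h) - \1_A x : R) @^-1` [set~ 0]).
  rewrite -[X in measurable X]setTI; apply: measurable_funB => //.
    exact: measurable_shift.
  by apply: measurableC; exact: measurable_set1.
apply/seteqP; split=> x; rewrite /flip /= !indicE.
  by case: (_ \in _); case: (_ \in _) => //= _; lra.
by case: (_ \in _); case: (_ \in _) => //= ; rewrite subrr.
Qed.

(** The difference of two indicators takes the values 0, 1 and -1, so its p-th power is again an
    indicator: for sets, continuity of translations is a statement on measures in which [p]
    disappears. *)
Lemma Jp_indic_shift M h (A : set V) : measurable A ->
  Jp mu (cube M) p (fun x => \1_A (x + h) - \1_A x : R) = mu (flip h A `&` cube M).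
Proof.
move=> mA; rewrite JpE -integral_indic; last 2 first.
- exact: measurable_cube.
- exact: measurable_flip.
apply: eq_integral => x _; congr EFin; rewrite !indicE.
rewrite (in_mkset (fun x => (x + h \in A) (+) (x \in A))).
case: (_ \in _); case: (_ \in _) => /=;
  by rewrite ?subrr ?subr0 ?sub0r ?normrN ?normr1 ?normr0 ?powR1 ?powR0 ?gt_eqF.
Qed.

Let le_mu2 (X Y Z : set V) : measurable X -> measurable Y -> measurable Z ->
  X `<=` Y `|` Z -> (mu X <= mu Y + mu Z)%E.
Proof.
move=> mX mY mZ XYZ; apply: le_trans (measureU2 _ mY mZ).
by apply: le_measure; rewrite ?inE//; exact: measurableU.
Qed.

Let measurable_shift_set h (E : set V) : measurable E ->
  measurable [set x : V | x + h \in E].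
Proof.
move=> mE; rewrite (_ : mkset _ = (fun x : V => h + 1 *: x) @^-1` E); last first.
  by apply/seteqP; split=> x /=; rewrite scale1r [h + x]addrC;
    [exact: set_mem|exact: mem_set].
by rewrite -[X in measurable X]setTI; exact: measurable_affine.
Qed.

Let mu_shift M h (E : set V) : measurable E -> `|h| <= 1 ->
  (mu ([set x | (x + h)%R \in E] `&` cube M) <= mu (E `&` cube (M + 1)))%E.
Proof.
move=> mE h1; have mEx : measurable_fun setT (\1_E : V -> R) by exact: measurable_indic.
rewrite -integral_indic; last 2 first.
- exact: measurable_cube.
- exact: measurable_shift_set.
rewrite -integral_indic//; last exact: measurable_cube.
apply: le_trans (int_shift_le _ _ _ h1) => //.
rewrite le_eqVlt; apply/orP; left; apply/eqP; apply: eq_integral => x _.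
by rewrite !indicE (in_mkset (fun x => x + h \in E)).
Qed.

(** A point changes side of the hyperplane only if its i-th coordinate is within [|h|] of [t];
    inside a cube such points fill a thin box. *)
Lemma shift_cvg_halfspace i t : shift_cvg p (\1_[set v : V | t < v ord0 i] : V -> R).
Proof.
move=> M eta eta0; have N0 : 0 < `|M| + 1 by rewrite ltr_wpDl.
pose N := `|M| + 1; have N0' : 0 < (N + N) ^+ n.-1 by rewrite exprn_gt0// addr_gt0.
(* The box has one side [2 * delta] and n-1 sides [2 * N], so this choice gives it volume exactly
   [eta]. *)
pose delta := eta / (N + N) ^+ n.-1 / 2; have d0 : 0 < delta by rewrite !divr_gt0.
exists delta => // h hd.
have mA : measurable [set v : V | t < v ord0 i].
  rewrite (_ : mkset _ = (fun v : V => v ord0 i) @^-1` `]t, +oo[%classic).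
    by rewrite -[X in measurable X]setTI; exact: measurable_coord.
  by apply/seteqP; split=> v /=; rewrite in_itv/= andbT.
rewrite Jp_indic_shift//.
pose B (j : 'I_n) : set R := if j == i then `[t - delta, t + delta]%classic else `[- N, N]%classic.
have mB j : measurable (B j) by rewrite /B; case: ifP.
apply: (@le_trans _ _ (mu [set v | forall j, B j (v ord0 j)])).
  apply: le_measure; rewrite ?inE.
  - by apply: measurableI; [exact: measurable_flip|exact: measurable_cube].
  - exact: measurable_box.
  - move=> x [/= xA xM] j; rewrite /B; have [->|_] := eqVneq j i; last first.
      rewrite /= in_itv/= -ler_norml (le_trans (coord_norm_le x j))// (le_trans xM)//.
      by rewrite (le_trans (ler_norm M))// lerDl.
    rewrite /= in_itv/=; have := le_trans (coord_norm_le h i) hd.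
    rewrite ler_norml => /andP[h1 h2].
    move: xA; rewrite /flip /= !(in_mkset (fun x : V => t < x ord0 i)) mxE.
    case: ltP => tx; case: ltP => tx' //= _; apply/andP; split; lra.
have -> : mu [set v | forall j, B j (v ord0 j)] = (\prod_(j < n) lebesgue_measure (B j))%E.
  exact: lebesgue_rV_box.
rewrite (bigD1 i)//= (eq_bigr (fun=> (N + N)%:E)); last first.
  move=> j /negbTE ji; rewrite /B ji lebesgue_measure_itv/= lte_fin opprK -EFinD.
  by rewrite ifT// gtrN.
rewrite {1}/B eqxx lebesgue_measure_itv/= lte_fin ifT; last by lra.
rewrite -EFinD prodEFin -EFinM lee_fin.
rewrite prodr_const cardC1 card_ord (_ : _ - _ = delta + delta); last by lra.
by rewrite -splitr divfK// gt_eqF.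
Qed.

(** The good sets are closed under complements, finite unions and countable unions, and they contain
    the half-spaces orthogonal to the axes, which generate the sigma-algebra. *)
Lemma good_indic (A : set V) : measurable A -> good A.
Proof.
suff : (g_sigma_preimage (fun (i : 'I_n) (v : V) => v ord0 i)) `<=` good by exact.
move: A => _; have goodC (A : set V) : good A -> good (~` A).
  case=> mA sA; split; first exact: measurableC.
  move=> M eta eta0; have [d d0 hd] := sA M _ eta0; exists d => // h /hd.
  rewrite (_ : (fun x => \1_(~` A) _ - _) = (fun x => - (\1_A (x + h) - \1_A x))).
    by rewrite JpN.
  apply/funext => x; rewrite !indicE !in_setC.
  by case: (_ \in _); case: (_ \in _) => /=; lra.
have goodU (A A' : set V) : good A -> good A' -> good (A `|` A').
  move=> [mA sA] [mA' sA']; split; first exact: measurableU.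
  move=> M eta eta0; have eta2 : 0 < eta / 2 by rewrite divr_gt0.
  have [d d0 hd] := sA M _ eta2; have [d' d'0 hd'] := sA' M _ eta2.
  exists (Num.min d d'); first by rewrite lt_min d0.
  move=> h; rewrite le_min => /andP[/hd h1 /hd' h2]; move: h1 h2.
  rewrite !Jp_indic_shift//; last exact: measurableU.
  move=> h1 h2; rewrite (splitr eta) EFinD; apply: le_trans (leeD h1 h2).
  apply: le_mu2.
  - by apply: measurableI; [apply: measurable_flip; exact: measurableU|exact: measurable_cube].
  - by apply: measurableI; [exact: measurable_flip|exact: measurable_cube].
  - by apply: measurableI; [exact: measurable_flip|exact: measurable_cube].
  move=> x [/= + xM]; rewrite /flip /= !in_setU => xA.
  have : (x + h \in A) (+) (x \in A) \/ (x + h \in A') (+) (x \in A').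
    by move: xA; case: (_ \in A); case: (_ \in A); case: (_ \in A');
      case: (_ \in A') => //=; by [left|right].
  by move=> [xA'|xA']; [left|right].
have good0 : good set0.
  split => // M eta eta0; exists 1 => // h _.
  rewrite Jp_indic_shift// (_ : flip h set0 = set0) ?set0I ?measure0 ?lee_fin ?ltW//.
  by apply/seteqP; split=> x //=; rewrite /flip/= !in_set0.
(* A countable union is replaced by a finite one [B m]. The tail [E m] has small measure by
   continuity from above, since the cube has finite measure. It is taken in [cube (M + 1)], so that
   its translates by [|h| <= 1] remain under control in [cube M]. *)
have good_bigcup (F : (set V)^nat) : (forall k, good (F k)) -> good (\bigcup_k F k).
  move=> gF; have mF : measurable (\bigcup_k F k).
    by apply: bigcupT_measurable => k; case: (gF k).
  split=> // M eta eta0.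
  pose B m := \big[setU/set0]_(k < m) F k.
  have gB m : good (B m).
    elim: m => [|m IH]; rewrite /B; first by rewrite big_ord0; exact: good0.
    by rewrite big_ord_recr; exact: goodU IH (gF m).
  pose E m := (\bigcup_k F k `\` B m) `&` cube (M + 1).
  have mE m : measurable (\bigcup_k F k `\` B m).
    by apply: measurableD => //; case: (gB m).
  have mE' m : measurable (E m) by apply: measurableI => //; exact: measurable_cube.
  have E0 : \bigcap_m E m = set0.
    apply/seteqP; split=> x //= Ex; have [[[k _ Fkx] _] _] := Ex 0%N I.
    have [[_ +] _] := Ex k.+1 I; apply; rewrite /B -bigcup_mkord.
    by exists k => //=.
  have : (mu \o E) m @[m --> \oo] --> 0%E.
    rewrite -[X in _ --> X](measure0 mu) -E0; apply: nonincreasing_cvg_mu => //.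
    - apply: le_lt_trans (lebesgue_cube_fin (M + 1)).
      apply: le_measure; rewrite ?inE//; first exact: measurable_cube.
      by move=> x [].
    - by rewrite E0.
    - move=> k l kl; apply/subsetPset => x [[xF xB] xM]; split=> //; split=> // xk.
      apply: xB; move: xk; rewrite /B -!bigcup_mkord => -[j /= jk Fj].
      by exists j => //=; exact: leq_trans kl.
  (* Half of [eta] goes to the flip of [B m], a quarter to the tail and a quarter to its
     translate. *)
  have eta4 : 0 < eta / 2 / 2 by rewrite !divr_gt0.
  move=> /fine_cvgP[Efin] /cvgrPdist_le /(_ _ eta4) Em.
  have [m _ /(_ m (leqnn m))] := filterI Efin Em.
  move=> [/= Emfin]; rewrite sub0r normrN ger0_norm ?fine_ge0// -lee_fin fineK// => {}Em.
  have eta2 : 0 < eta / 2 by rewrite divr_gt0.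
  have [mBm sBm] := gB m; have [d d0 hd] := sBm M _ eta2.
  exists (Num.min d 1); first by rewrite lt_min d0/=.
  move=> h; rewrite le_min => /andP[/hd + h1]; rewrite !Jp_indic_shift// => hB.
  (* A point flipped for the whole union is flipped for [B m], or is moved into the tail, or lies in
     the tail itself. *)
  have flip_sub : flip h (\bigcup_k F k) `&` cube M `<=` (flip h (B m) `&` cube M) `|`
      (([set x | (x + h) \in (\bigcup_k F k `\` B m)] `&` cube M) `|` E m).
    move=> x [+ xM]; rewrite /flip /=.
    have BF y : y \in B m -> y \in \bigcup_k F k.
      by move/set_mem; rewrite /B -bigcup_mkord => -[k _ Fk]; apply: mem_set; exists k.
    have xM1 : cube (M + 1) x by apply: sub_cube xM; rewrite lerDl.
    have [xB|xB] := boolP (x + h \in B m).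
      rewrite (BF _ xB)/= => xF; left; split=> //.
      by apply: contra xF; exact: BF.
    have [xF|xF] := boolP (x + h \in \bigcup_k F k) => /= xF'.
      right; left; split=> //=; apply: mem_set; split; first exact: set_mem.
      by move/mem_set; exact/negP.
    have [xB'|xB'] := boolP (x \in B m).
      by left; split=> //; rewrite /flip /= (negbTE xB) xB'.
    right; right; split=> //; split; first exact: set_mem.
    by move/mem_set; exact/negP.
  have mS : measurable ([set x | (x + h) \in (\bigcup_k F k `\` B m)] `&` cube M).
    apply: measurableI; last exact: measurable_cube.
    exact: measurable_shift_set.
  have mS' : measurable (flip h (B m) `&` cube M).
    by apply: measurableI; [exact: measurable_flip|exact: measurable_cube].
  have mS2 : measurable (flip h (\bigcup_k F k) `&` cube M).
    by apply: measurableI; [exact: measurable_flip|exact: measurable_cube].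
  apply: le_trans (le_mu2 mS2 mS' (measurableU _ _ mS (mE' m)) flip_sub) _.
  rewrite (splitr eta) EFinD leeD//.
  apply: le_trans (le_mu2 _ mS (mE' m) (@subset_refl _ _)) _; first exact: measurableU.
  rewrite (splitr (eta / 2)) EFinD leeD//.
  exact: le_trans (mu_shift M (mE m) h1) Em.
apply: smallest_sub.
  by split=> //; move=> A; rewrite setTD; exact: goodC.
move=> A; rewrite -bigcup_seq => -[i _ [B mB <-]] /=.
rewrite setTI.
(* For each coordinate the problem descends to the line, where the rays []t, +oo[] generate the
   Borel sets. *)
suff : (@ocitv R).-sigma.-measurable `<=` [set B : set R | good ((fun v : V => v ord0 i) @^-1` B)] by exact.
rewrite RGenOInfty.measurableE; apply: smallest_sub.
  split=> /=.
  - by rewrite preimage_set0.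
  - by move=> C; rewrite setTD preimage_setC; exact: goodC.
  - by move=> F hF; rewrite preimage_bigcup; exact: good_bigcup.
move=> _ [t ->] /=; rewrite (_ : _ @^-1` _ = [set v : V | t < v ord0 i]); last first.
  by apply/seteqP; split=> v /=; rewrite in_itv/= andbT.
split; last exact: shift_cvg_halfspace.
rewrite (_ : mkset _ = (fun v : V => v ord0 i) @^-1` `]t, +oo[%classic).
  by rewrite -[X in measurable X]setTI; exact: measurable_coord.
by apply/seteqP; split=> v /=; rewrite in_itv/= andbT.
Qed.

End fixed_p.
End translation.

Lemma cvg_powR_norm0 {R : realType} (p : R) (y : R^nat) : 0 < p ->
  y @ \oo --> (0 : R) -> (`|y k| `^ p)%:E @[k --> \oo] --> 0%E.
Proof.
move=> p0 /cvgrPdist_le y0; apply: cvg_EFin; first by near=> k.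
apply/cvgrPdist_le => e e0; have ep : 0 < e `^ p^-1 by rewrite powR_gt0.
near=> k; rewrite sub0r normrN ger0_norm ?powR_ge0//=.
have -> : e = (e `^ p^-1) `^ p by rewrite -powRrM mulVf ?gt_eqF// powRr1// ltW.
apply: le_powR => //; first exact: ltW.
by rewrite -normrN -sub0r; near: k; exact: y0.
Unshelve. all: by end_near. Qed.

(** * From indicators to L^p functions by simple approximation *)

Section Lp_translation.
Context {R : realType} {n : nat}.
Local Notation V := 'rV[R]_n.
Local Notation mu := (lebesgue_rV n : {measure set V -> \bar R}).
Implicit Types (u v : V -> R) (h : V) (M t eta delta p b : R).
Variable p : R.
Hypothesis p0 : 0 < p.

(** The three-term splitting through [g]. The approximation is required on [cube (M + 1)] because
    [u - g] is also evaluated at [x + h], with [|h| <= 1]. *)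
Lemma shift_cvg_approx u : measurable_fun setT u ->
  (forall M eta, 0 < eta -> exists g : V -> R, [/\ measurable_fun setT g,
     shift_cvg p g & (Jp mu (cube M) p (fun x => u x - g x)%R <= eta%:E)%E]) ->
  shift_cvg p u.
Proof.
move=> mu' ug M eta eta0.
have [c c0 cE] : exists2 c : R, 0 < c & 2 `^ p = c by exists (2 `^ p); rewrite ?powR_gt0.
(* The solution [z] of [c * (z + c * (z + z)) = eta], which is what two successive uses of [JpD]
   produce. *)
have z0 : 0 < eta / (c + c * (c + c)) by rewrite divr_gt0// addr_gt0// mulr_gt0// addr_gt0.
set z := eta / _ in z0; have [g [mg sg ugz]] := ug (M + 1) _ z0.
have [d d0 hd] := sg M _ z0; exists (Num.min d 1); first by rewrite lt_min d0/=.
move=> h; rewrite le_min => /andP[/hd gz h1].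
have mug : measurable_fun setT (fun x => u x - g x) by exact: measurable_funB.
have msug : measurable_fun setT (fun x : V => u (x + h) - g (x + h)).
  by apply: (measurable_shift h) mug.
have msg : measurable_fun setT (fun x : V => g (x + h) - g x).
  by apply: measurable_funB => //; exact: measurable_shift.
have mgu : measurable_fun setT (fun x => g x - u x) by exact: measurable_funB.
have -> : (fun x => u (x + h) - u x) = (fun x => (u (x + h) - g (x + h)) +
    ((g x - u x) + (g (x + h) - g x))) by apply/funext => x; ring.
have z1 : (Jp mu (cube M) p (fun x => u (x + h) - g (x + h))%R <= z%:E)%E.
  exact: le_trans (Jp_shift_le _ _ mug h1) ugz.
have z2 : (Jp mu (cube M) p (fun x => g x - u x)%R <= z%:E)%E.
  apply: le_trans ugz; rewrite -JpN; under eq_fun do rewrite opprB.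
  apply: Jp_subset => //; [exact: measurable_cube..|].
  by apply: sub_cube; rewrite lerDl.
apply: le_trans (JpD _ _ _ _ _) _ => //; [exact: measurable_cube| |exact: ltW|].
  exact: measurable_funD.
have etaE : eta = c * (z + c * (z + z)).
  rewrite /z; field; rewrite gt_eqF// addr_gt0// mulr_gt0//; lra.
have c0' : (0 <= c%:E)%E by rewrite lee_fin ltW.
rewrite cE etaE EFinM; apply: lee_wpmul2l => //; rewrite EFinD; apply: leeD => //.
apply: le_trans (JpD _ _ _ _ _) _ => //; [exact: measurable_cube|exact: ltW|].
by rewrite cE EFinM; apply: lee_wpmul2l => //; rewrite EFinD; apply: leeD.
Qed.

Import HBSimple HBNNSimple.

Lemma shift_cvg_sfun (f : {sfun V >-> R}) : shift_cvg p f.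
Proof.
rewrite [X in shift_cvg p X](funext (fimfunEord f)).
have mi r : measurable (f @^-1` [set r]).
  by rewrite -[X in measurable X]setTI; exact: measurable_funP.
apply: shift_cvg_sum => // i.
  by apply: measurable_funM => //; exact: measurable_indic.
apply: shift_cvgZ => //.
exact: (good_indic p0 (mi _)).2.
Qed.

(** Simple functions increasing to [u] converge to it in L^p on each cube, by dominated convergence
    with dominating function [|u| ^ p]. *)
Lemma ge0_Lp_shift_cvg u : measurable_fun setT u -> (forall x, 0 <= u x) ->
  (forall M, (Jp mu (cube M) p u < +oo)%E) -> shift_cvg p u.
Proof.
move=> mu' u0 uoo; apply: shift_cvg_approx => // M eta eta0.
have mue : measurable_fun setT (EFin \o u) by exact/measurable_EFinP.
pose g := nnsfun_approx measurableT mue.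
have gu x : g k x @[k --> \oo] --> u x.
  have := @cvg_nnsfun_approx _ _ _ _ measurableT _ mue (fun x _ => u0 x) x I.
  by move/fine_cvgP => [_].
have g_le k x : g k x <= u x.
  have -> : u x = limn (fun k => g k x) by apply/esym/cvg_lim => //; exact: gu.
  apply: (@nondecreasing_cvgn_le _ (fun k => g k x)); last by apply/cvg_ex; exists (u x); exact: gu.
  by move=> i j ij; have /lefP := nd_nnsfun_approx measurableT mue ij; exact.
have mg k : measurable_fun setT (g k) by exact: measurable_funP.
have key : (Jp mu (cube M) p (fun x => u x - g k x)%R @[k --> \oo] --> 0)%E.
  rewrite (_ : (fun k => _) = (fun k => \int[mu]_(x in cube M) (`|u x - g k x| `^ p)%:E)%E); last first.
    by apply/funext => k; rewrite JpE.
  have [] // := @dominated_convergence _ _ _ mu (cube M) (measurable_cube M)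
    (fun k x => (`|u x - g k x| `^ p)%:E) (cst 0%E) (fun x => (`|u x| `^ p)%:E).
  - move=> k; apply/measurable_EFinP; apply: measurable_funTS.
    by apply: measurable_powR_norm; exact: measurable_funB.
  - apply/nearW => x _; apply: cvg_powR_norm0 => //.
    rewrite -(subrr (u x)); apply: cvgB; [exact: cvg_cst|exact: gu].
  - apply/integrableP; split.
      by apply/measurable_EFinP; apply: measurable_funTS; exact: measurable_powR_norm.
    rewrite (eq_integral (fun x => (`|u x| `^ p)%:E)); first by rewrite -JpE; exact: uoo.
    by move=> x _; rewrite gee0_abs// lee_fin powR_ge0.
  - apply/nearW => x k _; rewrite gee0_abs ?lee_fin ?powR_ge0//.
    apply: le_powR => //; first exact: ltW.
    by rewrite !ger0_norm// ?subr_ge0// lerBlDr lerDl.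
  - by rewrite integral0.
move: key => /fine_cvgP[fin /cvgrPdist_le /(_ _ eta0) dk].
have [k _ /(_ k (leqnn k))] := filterI fin dk.
move=> [/= kfin]; rewrite sub0r normrN ger0_norm ?fine_ge0 ?Jp_ge0// -lee_fin fineK// => key'.
by exists (g k); split => //; exact: shift_cvg_sfun.
Qed.

Lemma Lp_shift_cvg u : measurable_fun setT u ->
  (forall M, (Jp mu (cube M) p u < +oo)%E) -> shift_cvg p u.
Proof.
move=> mu' uoo.
have mp : measurable_fun setT (fun x => Num.max (u x) 0) by exact: measurable_maxr.
have mn : measurable_fun setT (fun x => Num.max (- u x) 0).
  by apply: measurable_maxr => //; exact: measurable_funN.
have -> : u = (fun x => Num.max (u x) 0 + (- 1) * Num.max (- u x) 0).
  apply/funext => x; have [u0|u0] := ltP (u x) 0.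
    by rewrite max_l ?oppr_ge0 ?ltW//; ring.
  by rewrite max_r ?oppr_le0//; ring.
apply: shift_cvgD => //; first exact: measurable_funM.
- apply: ge0_Lp_shift_cvg => // [x|M]; first by rewrite le_max lexx orbT.
  apply: le_lt_trans (uoo M); apply: Jp_le => //; [exact: measurable_cube|exact: ltW|].
  by move=> x _; rewrite /Num.max; case: ifP => _; rewrite ?normr0.
- apply: shift_cvgZ => //; apply: ge0_Lp_shift_cvg => // [x|M].
    by rewrite le_max lexx orbT.
  apply: le_lt_trans (uoo M); apply: Jp_le => //; [exact: measurable_cube|exact: ltW|].
  by move=> x _; rewrite /Num.max; case: ifP => _; rewrite ?normr0 ?normrN.
Qed.

End Lp_translation.

(** * Averages against a kernel *)

Lemma mule_subr {R : realType} (k : R) (a b : \bar R) : 0 < k ->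
  (k%:E * (a - b) = k%:E * a - k%:E * b)%E.
Proof.
move=> k0; have k0' : (0 < k%:E)%E by rewrite lte_fin.
case: a b => [a||] [b||]; rewrite ?(gt0_muley k0') ?(gt0_muleNy k0')//=.
by rewrite -EFinB -!EFinM -EFinB mulrBr.
Qed.

(** Infinite values cause no exception, as [fine] sends both of them to 0. *)
Lemma fineZ {R : realType} (k : R) (a : \bar R) : fine (k%:E * a) = k * fine a.
Proof.
have [->|k0] := eqVneq k 0; first by rewrite mul0e mul0r.
case: a => [a//||].
- by rewrite /= mulr0 mulry; case: (sgrP k) k0 => //; rewrite ?mul1e ?mulN1e ?mul0e.
- by rewrite /= mulr0 mulrNy; case: (sgrP k) k0 => //; rewrite ?mul1e ?mulN1e ?mul0e.
Qed.

(** * Integrals depending on a parameter *)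

Section param.
Context d1 d2 (T1 : measurableType d1) (T2 : measurableType d2) (R : realType).
Variables (m1 : {sigma_finite_measure set T1 -> \bar R}).
Variables (m2 : {sigma_finite_measure set T2 -> \bar R}).
Variables (D1 : set T1) (D2 : set T2).
Hypotheses (mD1 : measurable D1) (mD2 : measurable D2).
Variable w : T1 * T2 -> R.
Hypothesis mw : measurable_fun setT w.

(** The real integral is [fine] of the difference of the integrals of the positive and negative
    parts; each is measurable by Tonelli's theorem, even at points where the integral diverges. *)
Lemma measurable_Rint_param :
  measurable_fun setT (fun x => \int[m2]_(z in D2) w (x, z)).
Proof.
have mp : measurable_fun setT (fun z => Num.max (w z) 0) by exact: measurable_maxr.
have mn : measurable_fun setT (fun z => Num.max (- w z) 0).
  by apply: measurable_maxr => //; exact: measurable_funN.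
rewrite (_ : (fun x => _) = fine \o (fun x =>
   \int[m2]_(z in D2) (Num.max (w (x, z)) 0)%:E
   - \int[m2]_(z in D2) (Num.max (- w (x, z)) 0)%:E)%E).
  apply: measurableT_comp; first exact: fine_measurable.
  apply: emeasurable_funB.
    apply: (measurable_tonelli_in m2 measurableT mD2 (f := fun z => Num.max (w z) 0)) => // z.
    by rewrite le_max lexx orbT.
  apply: (measurable_tonelli_in m2 measurableT mD2 (f := fun z => Num.max (- w z) 0)) => // z.
  by rewrite le_max lexx orbT.
apply/funext => x /=; rewrite /Rintegral integralE; congr (fine (_ - _)%E);
  by apply: eq_integral => z _ /=; rewrite ?funeposE ?funenegE /= EFin_max.
Qed.

(** The constant of [Jensen_Jp], times the measure of [D2] that comes from integrating a constant
    bound over [D2]. *)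
Definition Jensen_cst p : R := (1 + fine (m2 D2)) `^ p * fine (m2 D2).

Lemma Jensen_cst_ge0 p : 0 <= Jensen_cst p.
Proof. by rewrite mulr_ge0 ?powR_ge0 ?fine_ge0. Qed.

(** A form of Minkowski's integral inequality, up to a constant: Jensen's inequality in [z] at each
    [x], exchange of the integrals, then the bound on each slice. *)
Lemma Jp_param_le p (B : \bar R) : 1 <= p -> (m2 D2 < +oo)%E -> 
  (forall z, D2 z -> (Jp m1 D1 p (fun x => w (x, z)) <= B)%E) ->
  (Jp m1 D1 p (fun x => \int[m2]_(z in D2) w (x, z))%R <= (Jensen_cst p)%:E * B)%E.
Proof.
move=> p1 D2oo JB; have p0 : 0 <= p by rewrite (le_trans ler01).
have mwp : measurable_fun setT (fun z => `|w z| `^ p) by exact: measurable_powR_norm.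
have mI := measurable_Rint_param.
apply: (@le_trans _ _ (\int[m1]_(x in D1) (((1 + fine (m2 D2)) `^ p)%:E *
    \int[m2]_(z in D2) (`|w (x, z)| `^ p)%:E))%E).
  rewrite JpE; apply: ge0_le_integral => //.
  - by apply/measurable_EFinP; apply: measurable_funTS; exact: measurable_powR_norm.
  - apply: measurable_funeM.
    by apply: (measurable_tonelli_in m2 mD1 mD2 (f := fun z => `|w z| `^ p)) => // z; exact: powR_ge0.
  - move=> x Dx; rewrite -JpE; apply: Jensen_Jp => //.
    exact: (measurableT_comp mw (measurable_pair1 x)).
rewrite ge0_integralZl_EFin//; last 3 first.
- by move=> x _; apply: integral_ge0 => z _; rewrite lee_fin powR_ge0.
- by apply: (measurable_tonelli_in m2 mD1 mD2 (f := fun z => `|w z| `^ p)) => // z; exact: powR_ge0.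
- exact: powR_ge0.
rewrite EFinM -muleA lee_wpmul2l ?lee_fin ?powR_ge0//.
rewrite (tonelli_in m1 m2 mD1 mD2 mwp (fun=> powR_ge0 _ _)).
apply: (@le_trans _ _ (\int[m2]_(z in D2) B)%E).
  apply: ge0_le_integral => //.
  - by move=> z _; apply: integral_ge0 => x _; rewrite lee_fin powR_ge0.
  - apply: (measurable_tonelli_in m1 mD2 mD1 (f := fun z => `|w (z.2, z.1)| `^ p)).
      by apply: (measurableT_comp mwp); exact: measurable_swap.
    by move=> z; exact: powR_ge0.
  - by move=> z /JB; rewrite JpE.
by rewrite integral_cst// muleC fineK// ge0_fin_numE.
Qed.

End param.

Section Rintegral_affine.
Context {R : realType} {n : nat}.
Local Notation V := 'rV[R]_n.
Local Notation mu := (lebesgue_rV n : {measure set V -> \bar R}).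

Lemma Rintegral_affine (b : R) (c : V) (F : V -> R) : b != 0 ->
  measurable_fun setT F ->
  `|b| ^+ n * \int[mu]_x F (c + b *: x) = \int[mu]_x F x.
Proof.
move=> b0 mF; have mFe : measurable_fun setT (EFin \o F) by exact/measurable_EFinP.
have k0 : 0 < `|b| ^+ n by rewrite exprn_gt0// normr_gt0.
rewrite /Rintegral; rewrite [in RHS]integralE.
have posE := @lebesgue_rV_affine R n b c ((EFin \o F)^\+)%E b0 (measurable_funepos mFe) (fun x => funepos_ge0 _ x).
have negE := @lebesgue_rV_affine R n b c ((EFin \o F)^\-)%E b0 (measurable_funeneg mFe) (fun x => funeneg_ge0 _ x).
rewrite -posE -negE -mule_subr// fineZ; congr (_ * fine _).
rewrite [LHS]integralE; congr (_ - _)%E; apply: eq_integral => x _;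
  by rewrite ?funeposE ?funenegE.
Qed.

(** [e ^+ n] is the Jacobian of z |-> x - e z, which maps [cube N] into [cube (|x| + N)] because
    [e <= 1]. *)
Lemma int_affine_le (e N : R) (x : V) (F : V -> R) : 0 < e <= 1 -> 
  measurable_fun setT F -> (forall x, 0 <= F x) ->
  ((e ^+ n)%:E * \int[mu]_(z in cube N) (F (x - e *: z)%R)%:E <=
   \int[mu]_(y in cube (`|x| + N)) (F y)%:E)%E.
Proof.
move=> /andP[e0 e1] mF F0.
rewrite integral_mkcond [leRHS]integral_mkcond.
have mF' K : measurable K -> measurable_fun setT ((fun x => (F x)%:E) \_ K).
  move=> mK; suff : measurable_fun K (fun x => (F x)%:E).
    by move/(measurable_restrictT _ mK).
  by apply/measurable_EFinP; exact: measurable_funTS.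
have F'0 (G : V -> R) (K : set V) y : (forall x, 0 <= G x) ->
    (0 <= ((fun x => (G x)%:E) \_ K) y)%E.
  by move=> G0; apply: erestrict_ge0 => z _; rewrite lee_fin.
have Ne0 : - e != 0 by rewrite oppr_eq0 gt_eqF.
rewrite -[leRHS](@lebesgue_rV_affine R n (- e) x _ Ne0 (mF' _ (measurable_cube _)) (fun y => F'0 _ _ _ F0)).
rewrite normrN gtr0_norm// lee_wpmul2l ?lee_fin ?exprn_ge0 ?(ltW e0)//.
have mFx : measurable_fun setT (fun z : V => F (x + (- e) *: z)).
  by apply: (measurableT_comp mF); exact: measurable_affine.
apply: ge0_le_integral => //.
- by move=> y _; apply: (F'0 (fun z => F (x - e *: z))) => z.
- suff : measurable_fun (cube N) (fun z : V => (F (x - e *: z)%R)%:E).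
    by move/(measurable_restrictT _ (measurable_cube _)).
  apply/measurable_EFinP; apply: measurable_funTS.
  by move: mFx; under eq_fun do rewrite scaleNr.
- apply: (measurableT_comp (mF' _ (measurable_cube _))).
  exact: measurable_affine.
- move=> z _; rewrite !patchE; case: ifPn => zN; last first.
    by case: ifPn => // _; rewrite lee_fin.
  rewrite mem_set/=; first by rewrite scaleNr.
  rewrite scaleNr; apply: le_trans (ler_normB _ _) _; rewrite lerD2l normrZ gtr0_norm//.
  have := set_mem zN; rewrite /cube/= => zN'.
  by apply: le_trans zN'; rewrite ler_piMl.
Qed.
End Rintegral_affine.

(** * Averages at scale e and the L^p modulus of continuity *)

Section averaging.
Context {R : realType} {n : nat}.
Local Notation V := 'rV[R]_n.
Local Notation mu := (lebesgue_rV n : {measure set V -> \bar R}).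
Implicit Types (u v kappa : V -> R) (h x y z : V) (M t e p C : R).

Definition locLp p u := measurable_fun setT u /\
  forall M, (Jp mu (cube M) p u < +oo)%E.

Definition bounded_kernel C kappa := [/\ measurable_fun setT kappa,
  forall z, `|kappa z| <= C & forall z, kappa z != 0 -> cube 1 z].

(** The convolution with the rescaled kernel after the substitution y = x - e z: the scale has left
    the kernel, and the domain is a fixed cube. The two forms agree by [averageE]. *)
Definition average kappa e u : V -> R :=
  fun x => \int[mu]_(z in cube 1) (u (x - e *: z) * kappa z).

(** The L^p modulus of continuity, raised to the power [p]; it measures every error of the proof
    that comes from translations. *)
Definition modulus p M u t : \bar R :=
  ereal_sup [set Jp mu (cube M) p (fun x => u (x + h) - u x) | h in cube t].

Lemma le_modulus p M u t h : `|h| <= t ->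
  (Jp mu (cube M) p (fun x => u (x + h) - u x)%R <= modulus p M u t)%E.
Proof. by move=> ht; apply: ereal_sup_ubound; exists h. Qed.

Lemma modulus_ge0 p M u t : 0 <= t -> (0 <= modulus p M u t)%E.
Proof.
by move=> t0; apply: le_trans (le_modulus _ _ _ (h := 0) _); rewrite ?Jp_ge0 ?normr0.
Qed.

Lemma modulus_vanish p M u : 0 < p -> locLp p u -> vanish (modulus p M u).
Proof.
move=> p0 [mu' uoo] eta eta0; have [d d0 hd] := Lp_shift_cvg p0 mu' uoo M eta0.
exists d => // e /andP[_ ed]; apply: ge_ereal_sup => _ [h /= he <-].
by apply: hd; apply: le_trans he (ltW ed).
Qed.

Lemma locLp_integrable p M u : 1 <= p -> locLp p u ->
  mu.-integrable (cube M) (EFin \o u).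
Proof.
move=> p1 [mu' uoo]; apply: Jp_integrable (uoo M) => //; first exact: measurable_cube.
exact: lebesgue_cube_fin.
Qed.

Lemma measurable_pair_affine u e : measurable_fun setT u ->
  measurable_fun setT (fun xz : V * V => u (xz.1 - e *: xz.2)).
Proof.
move=> mu'; under eq_fun do rewrite -scaleNr.
exact: (measurableT_comp mu' (@measurable_affine_rV R n (- e))).
Qed.

Lemma measurable_affine_comp u e x : measurable_fun setT u ->
  measurable_fun setT (fun z : V => u (x - e *: z)).
Proof. by move=> /(measurable_pair_affine e) h; exact: (measurableT_comp h (measurable_pair1 x)). Qed.

(** By [int_affine_le] a positive multiple of this integral of [|u|] is at most its integral over a
    larger cube, which is finite. *)
Lemma affine_integrable p e u x : 1 <= p -> locLp p u -> 0 < e <= 1 ->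
  mu.-integrable (cube 1) (fun z => (u (x - e *: z))%:E).
Proof.
move=> p1 uL /andP[e0 e1]; have [mu' _] := uL; apply/integrableP; split.
  by apply/measurable_EFinP; apply: measurable_funTS; exact: measurable_affine_comp.
have := int_affine_le (e := e) 1 x (F := fun y => `|u y|) _ _ (fun y => normr_ge0 _).
rewrite e0 e1 => /(_ isT) /(_ _)/wrap[]; first exact: measurableT_comp.
move=> h; have /integrableP[_ uoo] := locLp_integrable (`|x| + 1) p1 uL.
have := le_lt_trans h uoo; rewrite ltey; apply: contraTlt.
rewrite leye_eq => /eqP ->.
by rewrite gt0_muley// lte_fin exprn_gt0.
Qed.

Lemma average_integrable p C kappa e u x : 1 <= p -> locLp p u -> bounded_kernel C kappa ->
  0 < e <= 1 -> mu.-integrable (cube 1) (fun z => (u (x - e *: z) * kappa z)%:E).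
Proof.
move=> p1 uL [mk kC _] e01; have [mu' _] := uL.
have h := affine_integrable x p1 uL e01.
apply: (le_integrable (measurable_cube 1) (g := fun z => C%:E * (u (x - e *: z))%:E)%E).
- by apply/measurable_EFinP; apply: measurable_funTS; apply: measurable_funM => //; exact: measurable_affine_comp.
- move=> z _; rewrite -EFinM !abse_EFin lee_fin !normrM mulrC ler_wpM2r//.
  by apply: le_trans (kC z) _; exact: ler_norm.
- exact: (integrableZl (measurable_cube 1) C h).
Qed.

Lemma average_measurable kappa C e u : measurable_fun setT u -> bounded_kernel C kappa ->
  measurable_fun setT (average kappa e u).
Proof.
move=> mu' [mk _ _]; apply: (measurable_Rint_param (lebesgue_rV n) (measurable_cube 1)
  (w := fun xz : V * V => u (xz.1 - e *: xz.2) * kappa xz.2)).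
apply: measurable_funM; first exact: measurable_pair_affine.
exact: (measurableT_comp mk measurable_snd).
Qed.

Lemma averageE p C kappa e u x : 1 <= p -> locLp p u -> bounded_kernel C kappa ->
  0 < e <= 1 -> convolution u (rescale kappa e) x = average kappa e u x.
Proof.
move=> p1 uL kk e01; have [mu' _] := uL; have [mk kC ks] := kk.
have /andP[e0 e1] := e01; have Ne0 : - e != 0 by rewrite oppr_eq0 gt_eqF.
rewrite /convolution -(Rintegral_affine x Ne0); last first.
  apply: measurable_funM => //; apply: measurable_funM => //.
  apply: (measurableT_comp mk); have := @measurable_affine R n (- e^-1) (e^-1 *: x).
  by under eq_fun do rewrite scaleNr -scalerBr.
rewrite normrN gtr0_norm//.
rewrite (_ : (fun z => _) = (fun z => e ^- n * (u (x - e *: z) * kappa z))); last first.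
  apply/funext => z; rewrite /rescale scaleNr subKr scalerA mulVf ?gt_eqF// scale1r.
  by rewrite mulrCA.
(* The kernel is 0 off the unit cube, and the Jacobian [e ^+ n] cancels the normalisation of
   [rescale]. *)
rewrite (_ : (fun z => _) = (fun z => e ^- n * (u (x - e *: z) * kappa z)) \_ (cube 1)).
  rewrite -Rintegral_mkcond RintegralZl; last 2 first.
  - exact: measurable_cube.
  - exact: (average_integrable x p1 uL kk e01).
  by rewrite mulrA mulfV ?mul1r// gt_eqF// exprn_gt0.
apply/funext => z; rewrite patchE; case: ifPn => // zn.
have [->|/ks zc] := eqVneq (kappa z) 0; first by rewrite !mulr0.
by move: zn; rewrite mem_set.
Qed.

Lemma kernel_integrable C kappa : bounded_kernel C kappa ->
  mu.-integrable (cube 1) (EFin \o kappa).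
Proof.
move=> [mk kC _]; apply: (measurable_bounded_integrable (measurable_cube 1)).
- exact: lebesgue_cube_fin.
- exact: measurable_funTS.
- exists C; split; first exact: num_real.
  by move=> x Cx z _; apply: le_trans (kC z) (ltW Cx).
Qed.

Lemma locLp_shift p u h : locLp p u -> locLp p (fun x => u (x + h)).
Proof.
move=> [mu' uoo]; split; first exact: measurable_shift.
by move=> M; apply: le_lt_trans (Jp_shift_le _ _ mu' (lexx `|h|)) (uoo _).
Qed.

Lemma locLpD p u v : 0 <= p -> locLp p u -> locLp p v -> locLp p (fun x => u x + v x).
Proof.
move=> p0 [mu' uoo] [mv voo]; split=> [|M]; first exact: measurable_funD.
apply: le_lt_trans (JpD _ _ _ _ _) _ => //; first exact: measurable_cube.
apply: lte_mul_pinfty; [by rewrite lee_fin powR_ge0|by []|].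
exact: lte_add_pinfty.
Qed.

Lemma locLpZ p u C : locLp p u -> locLp p (fun x => C * u x).
Proof.
move=> [mu' uoo]; split=> [|M]; first exact: measurable_funM.
rewrite JpZ//; last exact: measurable_cube.
by apply: lte_mul_pinfty; [rewrite lee_fin powR_ge0|by []|exact: uoo].
Qed.

Lemma locLpB p u v : 0 <= p -> locLp p u -> locLp p v -> locLp p (fun x => u x - v x).
Proof.
move=> p0 uL vL; rewrite (_ : (fun x => _) = (fun x => u x + (-1) * v x)).
  by apply: locLpD => //; exact: locLpZ.
by apply/funext => x; rewrite mulN1r.
Qed.

Section fixed_average.
Variables (p C e : R) (kappa : V -> R).
Hypotheses (p1 : 1 <= p) (kk : bounded_kernel C kappa) (e01 : 0 < e <= 1).

Let step_le z : cube 1 z -> `|- (e *: z)| <= 1.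
Proof.
have /andP[e0 e1] := e01; move=> z1; rewrite normrN normrZ gtr0_norm//.
by apply: le_trans e1; rewrite ler_piMr// ltW.
Qed.

Lemma averageB u v x : locLp p u -> locLp p v ->
  average kappa e (fun y => u y - v y) x = average kappa e u x - average kappa e v x.
Proof.
move=> uL vL; rewrite /average -RintegralB//; last 3 first.
- exact: measurable_cube.
- exact: (average_integrable x p1 uL kk e01).
- exact: (average_integrable x p1 vL kk e01).
by apply: eq_Rintegral => z _; rewrite mulrBl.
Qed.

Let K : R := Jensen_cst (lebesgue_rV n) (cube 1) p * C `^ p.

Lemma Jp_average_le M u : locLp p u ->
  (Jp mu (cube M) p (average kappa e u) <= K%:E * Jp mu (cube (M + 1)) p u)%E.
Proof.
move=> [mu' _]; have [mk kC _] := kk; rewrite /K EFinM -muleA.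
apply: (Jp_param_le (m1 := lebesgue_rV n) (m2 := lebesgue_rV n) (measurable_cube M) (measurable_cube 1)
  (w := fun xz : V * V => u (xz.1 - e *: xz.2) * kappa xz.2)) => //.
- apply: measurable_funM; first exact: measurable_pair_affine.
  exact: (measurableT_comp mk measurable_snd).
- exact: lebesgue_cube_fin.
move=> z z1 /=; under eq_fun do rewrite mulrC.
have muz : measurable_fun setT (fun x : V => u (x - e *: z)).
  exact: (measurable_shift (- (e *: z)) mu').
rewrite JpZ//; last exact: measurable_cube.
apply: lee_pmul; rewrite ?Jp_ge0 ?lee_fin ?powR_ge0//.
  by apply: le_powR => //; rewrite (le_trans ler01).
exact: (Jp_shift_le M p mu' (step_le z1)).
Qed.

(** Averaging commutes with translations. Hence the modulus of continuity of an average is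
    controlled by that of [u], with a constant independent of [e]. *)
Lemma Jp_average_shift_le M u h : locLp p u -> 
  (Jp mu (cube M) p (fun x => average kappa e u (x + h) - average kappa e u x)%R <=
   K%:E * Jp mu (cube (M + 1)) p (fun x => u (x + h) - u x)%R)%E.
Proof.
move=> uL; have p0 : 0 <= p by rewrite (le_trans ler01).
have uhL := locLp_shift h uL.
rewrite (_ : (fun x => average kappa e u (x + h) - _) =
    average kappa e (fun x => u (x + h) - u x)); last first.
  apply/funext => x; rewrite averageB//; congr (_ - _).
  by apply: eq_Rintegral => z _; rewrite addrAC.
by apply: Jp_average_le; exact: locLpB.
Qed.

(** Bringing the subtracted term under the integral turns the integrand into
    [(u (x - e *: z) - u x) * kappa z], and every slice in [z] is a translation by at most [e]. *)
Lemma Jp_average_approx M u : locLp p u ->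
  (Jp mu (cube M) p (fun x => average kappa e u x - (\int[mu]_(z in cube 1) kappa z) * u x)%R
   <= K%:E * modulus p M u e)%E.
Proof.
move=> uL; have [mu' _] := uL; have [mk kC _] := kk; rewrite /K EFinM -muleA.
have /andP[e0 e1] := e01.
rewrite (_ : (fun x => _) =
    (fun x => \int[mu]_(z in cube 1) ((u (x - e *: z) - u x) * kappa z))); last first.
  apply/funext => x; rewrite [_ * u x]mulrC -RintegralZl; last 2 first.
  - exact: measurable_cube.
  - exact: kernel_integrable kk.
  rewrite -RintegralB; last 3 first.
  - exact: measurable_cube.
  - exact: (average_integrable x p1 uL kk e01).
  - exact: (integrableZl (measurable_cube 1) (u x) (kernel_integrable kk)).
  by apply: eq_Rintegral => z _; rewrite mulrBl.
apply: (Jp_param_le (m1 := lebesgue_rV n) (m2 := lebesgue_rV n) (measurable_cube M) (measurable_cube 1)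
  (w := fun xz : V * V => (u (xz.1 - e *: xz.2) - u xz.1) * kappa xz.2)) => //.
- apply: measurable_funM; last exact: (measurableT_comp mk measurable_snd).
  apply: measurable_funB; first exact: measurable_pair_affine.
  exact: (measurableT_comp mu' measurable_fst).
- exact: lebesgue_cube_fin.
move=> z z1 /=; under eq_fun do rewrite mulrC.
have muz : measurable_fun setT (fun x : V => u (x - e *: z) - u x).
  by apply: measurable_funB => //; exact: (measurable_shift (- (e *: z)) mu').
rewrite JpZ//; last exact: measurable_cube.
apply: lee_pmul; rewrite ?Jp_ge0 ?lee_fin ?powR_ge0//.
  by apply: le_powR => //; rewrite (le_trans ler01).
apply: le_modulus; rewrite normrN normrZ gtr0_norm// ler_piMr// ltW//.
Qed.

End fixed_average.

Lemma average_vanish p C kappa M u : 1 <= p -> bounded_kernel C kappa -> locLp p u ->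
  vanish (fun e => Jp mu (cube M) p
    (fun x => average kappa e u x - (\int[mu]_(z in cube 1) kappa z) * u x)).
Proof.
move=> p1 kk uL; have p0 : 0 < p by rewrite (lt_le_trans ltr01).
apply: vanish_le (vanishZ _ (modulus_vanish M p0 uL)).
  by move=> e e01; exact: (Jp_average_approx p1 kk e01).
by rewrite mulr_ge0 ?Jensen_cst_ge0 ?powR_ge0.
Qed.

Lemma average_cvg p C kappa M u : \int[mu]_(z in cube 1) kappa z = 1 ->
  1 <= p -> bounded_kernel C kappa -> locLp p u ->
  vanish (fun e => Jp mu (cube M) p (fun x => average kappa e u x - u x)).
Proof.
move=> kappa1 p1 kk uL; have := average_vanish M p1 kk uL; rewrite kappa1.
by under [X in vanish X -> _]eq_fun do under eq_fun do rewrite mul1r.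
Qed.

End averaging.

(** * Smooth kernels and weak gradients *)

Section directional.
Context {R : realType} {n : nat}.
Local Notation V := 'rV[R]_n.
Local Notation mu := (lebesgue_rV n : {measure set V -> \bar R}).
Implicit Types (f k phi psi u : V -> R) (x y z v : V) (s t b C M : R).

(** A directional difference quotient is the one-variable quotient along a line; the theorems on one
    real variable (differentiation under the integral, fundamental theorem) thus become
    available. *)
Let quotient_line f x v t :
  (fun h : R => h^-1 *: ((f \o shift (x + t *: v)) (h *: v) - f (x + t *: v))) =
  (fun h : R => h^-1 *: (((fun s : R => f (x + s *: v)) \o shift t) (h *: (1 : R))
     - f (x + t *: v))).
Proof.
apply/funext => h /=; congr (_ *: (f _ - _)).
by rewrite [h *: 1]mulr1 scalerDl addrCA.
Qed.

Lemma derivable_line f x v t :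
  derivable f (x + t *: v) v <-> derivable (fun s : R => f (x + s *: v)) t 1.
Proof. by rewrite /derivable quotient_line. Qed.

Lemma derive_line f x v t :
  'D_1 (fun s : R => f (x + s *: v)) t = 'D_v f (x + t *: v).
Proof. by rewrite /derive quotient_line. Qed.

Lemma derivable_line0 f x v :
  derivable f x v <-> derivable (fun s : R => f (x + s *: v)) 0 1.
Proof. by rewrite -derivable_line scale0r addr0. Qed.

Lemma derive_line0 f x v : 'D_1 (fun s : R => f (x + s *: v)) 0 = 'D_v f x.
Proof. by rewrite derive_line scale0r addr0. Qed.

Lemma supported_derive0 M k v x : (forall z, k z != 0 -> cube M z) ->
  ~ cube M x -> 'D_v k x = 0.
Proof.
move=> ks xM; rewrite (near_eq_derive _ (g := cst 0)) ?derive_cst//.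
have : open (~` (cube M : set V)).
  apply: closed_openC; apply: compact_closed; [exact: norm_hausdorff|exact: compact_cube].
rewrite openE => /(_ x xM); apply: filterS => y yM /=.
by have [//|/ks] := eqVneq (k y) 0.
Qed.

(** Differentiation under the integral along the line s |-> x + s v, with dominating function
    [C * |u|] over a cube that serves for all [|s| < 1]. *)
Lemma convolution_derive p C k v u : 1 <= p -> locLp p u ->
  bounded_kernel C k -> bounded_kernel C ('D_v k) -> (forall x, derivable k x v) ->
  forall x, derivable (convolution u k) x v /\
    'D_v (convolution u k) x = convolution u ('D_v k) x.
Proof.
move=> p1 uL [mk kC ks] [mdk dkC dks] dk x; have [mu' _] := uL.
(* For [|s| < 1] the kernel centred at [x + s *: v] is supported in [cube N]. *)
pose N := `|x| + `|v| + 1.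
have shift_out (s : R) y : -1 < s < 1 -> ~ cube N y -> ~ cube 1 (x + s *: v - y).
  move=> /andP[s1 s2] yN xy; apply: yN; rewrite /cube/=.
  rewrite -[y](subKr (x + s *: v)); apply: le_trans (ler_normB _ _) _.
  rewrite /N lerD//; apply: le_trans (ler_normD _ _) _; rewrite lerD2l normrZ.
  by rewrite ler_piMl// ler_norml !ltW.
have convE (k' : V -> R) (s : R) : -1 < s < 1 -> (forall z, k' z != 0 -> cube 1 z) ->
    convolution u k' (x + s *: v) = \int[mu]_(y in cube N) (u y * k' (x + s *: v - y)).
  move=> s1 k's; rewrite /convolution [RHS]Rintegral_mkcond; congr Rintegral.
  apply/funext => y; rewrite patchE; case: ifPn => // yN.
  have [->|/k's] := eqVneq (k' (x + s *: v - y)) 0; first by rewrite mulr0.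
  by move/(shift_out _ _ s1); case; move/mem_set; exact/negP.
have s0 : -1 < (0 : R) < 1 by rewrite ltrN10 ltr01.
have mkx (k' : V -> R) z : measurable_fun setT k' -> measurable_fun setT (fun y : V => k' (z - y)).
  move=> mk'; apply: (measurableT_comp mk').
  have := @measurable_affine R n (-1) z; by under eq_fun do rewrite scaleN1r.
pose F (s : R) y := u y * k (x + s *: v - y).
have dF (s : R) y : derivable (F ^~ y) s 1.
  apply: derivableM => //.
  rewrite (_ : (fun s => _) = (fun s : R => k ((x - y) + s *: v))).
    by apply/derivable_line.
  by apply/funext => t; rewrite addrAC.
have dFE (s : R) y : 'D_1 (F ^~ y) s = u y * 'D_v k (x + s *: v - y).
  rewrite (_ : F ^~ y = u y *: (fun s : R => k ((x - y) + s *: v))).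
    rewrite deriveZ; last by apply/derivable_line.
    by rewrite derive_line addrAC.
  by apply/funext => t; rewrite /F addrAC.
have uI : mu.-integrable (cube N) (EFin \o u) by exact: (locLp_integrable N p1 uL).
have intF (k' : V -> R) z : measurable_fun setT k' -> (forall z, `|k' z| <= C) ->
    mu.-integrable (cube N) (fun y => (u y * k' (z - y))%:E).
  move=> mk' k'C; apply: (le_integrable (measurable_cube N) (g := fun y => C%:E * (u y)%:E)%E).
  - apply/measurable_EFinP; apply: measurable_funTS; apply: measurable_funM => //.
    exact: mkx.
  - move=> y _; rewrite -EFinM !abse_EFin lee_fin !normrM mulrC ler_wpM2r//.
    by apply: le_trans (k'C _) _; exact: ler_norm.
  - exact: (integrableZl (measurable_cube N) C uI).
have intG : mu.-integrable (cube N) (EFin \o (fun y => C * `|u y|)).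
  exact: (integrableZl (measurable_cube N) C (integrable_norm uI)).
have C0 : 0 <= C by apply: le_trans (kC 0).
have I0 : `]-1, 1[%classic (0 : R) by rewrite /= in_itv.
have intFs (s : R) : `]-1, 1[%classic s -> mu.-integrable (cube N) (EFin \o F s).
  by move=> _; exact: intF.
have G_ub (s : R) y : `]-1, 1[%classic s -> cube N y ->
    `|partial1of2 F s y| <= C * `|u y|.
  by move=> _ _; rewrite partial1of2E dFE normrM mulrC ler_wpM2r.
have G0 y : 0 <= C * `|u y| by rewrite mulr_ge0.
have lineE : \forall s \near (0 : R), convolution u k (x + s *: v) =
    \int[mu]_(y in cube N) F s y.
  apply: filterS (near_in_itvoo (a := -1) (b := 1) (x := (0 : R)) _); last by rewrite in_itv.
  by move=> s; rewrite in_itv => s1; exact: convE.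
split.
  apply/derivable_line0.
  apply: (@near_eq_derivable _ _ _ (fun s : R => \int[mu]_(y in cube N) F s y)).
    by apply: filterS lineE => s ->.
  exact: (derivable_under_integral (measurable_cube N) I0 intFs (fun s y _ _ => dF s y) G0 intG G_ub).
rewrite -derive_line0 (near_eq_derive _ lineE)//.
rewrite -derive1E (differentiation_under_integral (measurable_cube N) I0 intFs (fun s y _ _ => dF s y) G0 intG G_ub).
rewrite -[x in RHS]addr0 -[X in _ (x + X)](scale0r v) convE//.
by apply: eq_Rintegral => y _; rewrite partial1of2E dFE.
Qed.

(** The integral of [psi (y + s *: v)] in [y] does not depend on [s], by translation invariance;
    differentiating it under the integral at [s = 0] gives the claim. All integrations by parts
    below rest on this. *)
Lemma int_derive0 M C psi v : measurable_fun setT psi ->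
  measurable_fun setT ('D_v psi) -> (forall z, psi z != 0 -> cube M z) ->
  (forall x, derivable psi x v) -> (forall x, `|psi x| <= C) ->
  (forall x, `|'D_v psi x| <= C) -> \int[mu]_x 'D_v psi x = 0.
Proof.
move=> mpsi mdpsi psis dpsi psiC dpsiC.
pose N := M + `|v|; pose F (s : R) y := psi (y + s *: v).
have out (s : R) y : -1 < s < 1 -> ~ cube N y -> ~ cube M (y + s *: v).
  move=> /andP[s1 s2] yN yM; apply: yN; rewrite /cube/= -[y](addrK (s *: v)).
  apply: le_trans (ler_normB _ _) _; rewrite /N lerD// normrZ.
  by rewrite ler_piMl// ler_norml !ltW.
have mF (f : V -> R) (s : R) : measurable_fun setT f -> measurable_fun setT (fun y : V => f (y + s *: v)).
  by move=> mf; exact: measurable_shift.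
have bint (f : V -> R) : measurable_fun setT f -> (forall x, `|f x| <= C) ->
    mu.-integrable (cube N) (EFin \o f).
  move=> mf fC; apply: (measurable_bounded_integrable (measurable_cube N)).
  - exact: lebesgue_cube_fin.
  - exact: measurable_funTS.
  - exists C; split; first exact: num_real.
    by move=> x Cx z _; apply: le_trans (fC z) (ltW Cx).
have I0 : `]-1, 1[%classic (0 : R) by rewrite /= in_itv/= ltrN10 ltr01.
have intFs (s : R) : `]-1, 1[%classic s -> mu.-integrable (cube N) (EFin \o F s).
  by move=> _; apply: bint => [|x]; [exact: mF|exact: psiC].
have dF (s : R) y : `]-1, 1[%classic s -> cube N y -> derivable (F ^~ y) s 1.
  by move=> _ _; apply/derivable_line.
have dFE (s : R) y : partial1of2 F s y = 'D_v psi (y + s *: v).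
  by rewrite partial1of2E; exact: derive_line.
have C0 : 0 <= C by apply: le_trans (psiC 0).
have intG : mu.-integrable (cube N) (EFin \o (fun=> C)).
  by apply: bint => // x; rewrite ger0_norm.
have G_ub (s : R) y : `]-1, 1[%classic s -> cube N y -> `|partial1of2 F s y| <= C.
  by move=> _ _; rewrite dFE.
have := differentiation_under_integral (measurable_cube N) I0 intFs dF (fun=> C0) intG G_ub.
have domE (f : V -> R) (s : R) : -1 < s < 1 -> (forall z, ~ cube M z -> f z = 0) ->
    \int[mu]_(y in cube N) f (y + s *: v) = \int[mu]_y f (y + s *: v).
  move=> s1 fs; rewrite Rintegral_mkcond; congr Rintegral; apply/funext => y.
  rewrite patchE; case: ifPn => // yN; rewrite fs//.
  by apply: (out _ _ s1); move/mem_set; exact/negP.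
have psi0 z : ~ cube M z -> psi z = 0.
  by move=> zM; apply: contra_notP zM => /eqP; exact: psis.
have near0 : \forall s \near (0 : R), \int[mu]_(y in cube N) F s y = \int[mu]_y psi y.
  apply: filterS (near_in_itvoo (a := -1) (b := 1) (x := (0 : R)) _); last first.
    by rewrite in_itv/= ltrN10 ltr01.
  move=> s; rewrite in_itv/= => s1; rewrite /F domE//.
  have := @Rintegral_affine R n 1 (s *: v) psi (oner_neq0 _) mpsi.
  rewrite normr1 expr1n mul1r => <-; apply: eq_Rintegral => y _.
  by rewrite scale1r addrC.
have s01 : -1 < (0 : R) < 1 by rewrite ltrN10 ltr01.
have dom0 := domE ('D_v psi) 0 s01 (fun z => supported_derive0 v psis (x := z)).
rewrite derive1E (near_eq_derive _ (g := cst (\int[mu]_y psi y)) near0) derive_cst => h.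
transitivity (\int[mu]_y 'D_v psi (y + 0 *: v)).
  by apply: eq_Rintegral => y _; rewrite scale0r addr0.
rewrite -dom0; apply: etrans (esym h); apply: eq_Rintegral => y _; exact/esym/dFE.
Qed.

Lemma continuous_bounded_cube M f : continuous f ->
  exists C, forall x, cube M x -> `|f x| <= C.
Proof.
move=> cf; have /compact_bounded [C [_ hC]] : compact (f @` cube M).
  by apply: continuous_compact; [exact: continuous_subspaceT|exact: compact_cube].
by exists (C + 1) => x xM; apply: (hC (C + 1)); [rewrite ltrDl|exists x].
Qed.

Lemma smooth_continuous u : smooth u -> continuous u.
Proof. by move=> su x; apply: differentiable_continuous; exact: (su [::]). Qed.

Lemma smooth_partial i u : smooth u -> smooth (partial i u).
Proof.
move=> su s; have := su (rcons s i); rewrite /partials foldr_rcons; exact.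
Qed.

Lemma smooth_derivable u x v : smooth u -> derivable u x v.
Proof. by move=> su; apply: diff_derivable; exact: (su [::]). Qed.

Lemma smooth_supported_bounded M u : smooth u -> (forall z, u z != 0 -> cube M z) ->
  exists C, [/\ forall x, `|u x| <= C, forall i x, `|partial i u x| <= C
    & forall i z, partial i u z != 0 -> cube M z].
Proof.
move=> su us.
have dus i z : partial i u z != 0 -> cube M z.
  by move=> h; apply: contraPP (negP h) => zM /=; rewrite /partial (supported_derive0 _ us) ?eqxx.
have bnd f : continuous f -> (forall z, f z != 0 -> cube M z) -> exists C, forall x, `|f x| <= C.
  move=> cf fs; have [C fC] := continuous_bounded_cube M cf; exists `|C| => x.
  have [->|/fs/fC h] := eqVneq (f x) 0; first by rewrite normr0.
  exact: le_trans h (ler_norm C).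
have [C0 uC] := bnd _ (smooth_continuous su) us.
have h i : exists C, forall x, `|partial i u x| <= C.
  by apply: bnd; [exact/smooth_continuous/smooth_partial|exact: dus].
have {h} [C hC] := choice h.
exists (`|C0| + \sum_i `|C i|); split => //.
- move=> x; apply: le_trans (uC x) _; apply: le_trans (ler_norm _) _.
  by rewrite lerDl sumr_ge0.
- move=> i x; apply: le_trans (hC i x) _; apply: le_trans (ler_norm _) _.
  by rewrite (bigD1 i)//= addrCA lerDl addr_ge0// sumr_ge0.
Qed.

End directional.

(** * Mollification of L^p functions and of weak gradients *)

Section smooth_kernels.
Context {R : realType} {n : nat}.
Local Notation V := 'rV[R]_n.
Local Notation mu := (lebesgue_rV n : {measure set V -> \bar R}).
Implicit Types (f k phi psi u rho : V -> R) (x y z v : V) (s t b c e C M p : R).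

(** The norm is taken of the extension by zero, and 0 to the power [p] is 0 since [p > 0], so points
    off [K] contribute nothing. *)
Lemma Lnorm_onE p K u : 0 < p -> measurable K -> measurable_fun setT u ->
  Lnorm_on p K u = (Jp mu K p u `^ p^-1)%E.
Proof.
move=> p0 mK mu'; rewrite /Lnorm_on unlock; congr (_ `^ _)%E.
rewrite JpE [RHS]integral_mkcond; apply: eq_integral => x _ /=.
rewrite !patchE; case: ifPn => // _.
by rewrite normr0 powR0// gt_eqF.
Qed.

Lemma Lnorm_on_lty p K u : 0 < p -> measurable K -> measurable_fun setT u ->
  (Lnorm_on p K u < +oo)%E <-> (Jp mu K p u < +oo)%E.
Proof.
move=> p0 mK mu'; rewrite Lnorm_onE//; split; last exact: poweR_lty.
by apply: lty_poweRy; rewrite invr_eq0 gt_eqF.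
Qed.

Lemma Lloc_locLp p u : 0 < p -> Lloc p u <-> locLp p u.
Proof.
move=> p0; split=> -[mu' uoo]; split=> //.
- move=> M; apply/(Lnorm_on_lty p0 (measurable_cube M) mu').
  by apply: uoo; exact: compact_cube.
- move=> K cK; apply/(Lnorm_on_lty p0 (compact_measurable_rV cK) mu').
  have [M _ KM] := compact_sub_cube cK; apply: le_lt_trans (uoo M).
  by apply: Jp_subset => //; [exact: compact_measurable_rV|exact: measurable_cube].
Qed.

Lemma locLp_bounded p u : 0 < p -> measurable_fun setT u ->
  (forall M, exists C, forall x, cube M x -> `|u x| <= C) -> locLp p u.
Proof.
move=> p0 mu' ub; split=> // M; have [C uC] := ub M.
apply: (@le_lt_trans _ _ (Jp mu (cube M) p (cst C))).
  apply: Jp_le => //; [exact: measurable_cube|exact: ltW|].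
  by move=> x /uC h; apply: le_trans h (ler_norm _).
rewrite JpE (integral_cst _ _ (`|C| `^ p)%:E); last exact: measurable_cube.
by apply: lte_mul_pinfty; [rewrite lee_fin powR_ge0|by []|exact: lebesgue_cube_fin].
Qed.

Lemma diff_affine z b y : differentiable (fun y => z + b *: y : V) y.
Proof. by apply: differentiableD => //; exact: differentiableZ. Qed.

Lemma differentiable_affine psi z b c y : differentiable psi (z + b *: y) ->
  differentiable (fun y => c * psi (z + b *: y)) y.
Proof.
move=> dpsi; apply: (@differentiableZ _ _ _ (fun y => psi (z + b *: y)) c).
exact: (differentiable_comp (diff_affine z b y)).
Qed.

Lemma deriveZv psi x v b : differentiable psi x -> 'D_(b *: v) psi x = b * 'D_v psi x.
Proof. by move=> dpsi; rewrite !deriveE// linearZ. Qed.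

Lemma derive_affine psi z b c y v : differentiable psi (z + b *: y) ->
  'D_v (fun y => c * psi (z + b *: y)) y = c * b * 'D_v psi (z + b *: y).
Proof.
move=> dpsi; rewrite (_ : (fun y => _) = c *: (fun y => psi (z + b *: y))); last exact/funext.
rewrite deriveZ; last first.
  by apply: diff_derivable; exact: (differentiable_comp (diff_affine z b y)).
rewrite -mulrA -deriveZv//; congr (_ * _).
rewrite -derive_line0 -[RHS]derive_line0.
rewrite (_ : (fun s : R => _) = (fun s : R => psi (z + b *: y + s *: (b *: v))))//.
by apply/funext => s; rewrite scalerDr addrA !scalerA mulrC.
Qed.

(** The scalar in front makes this family of functions stable under partial derivatives, each of
    which contributes one factor [b]; smoothness is defined by iterating them. *)
Lemma partials_affine psi z b c (l : seq 'I_n) : smooth psi ->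
  partials l (fun y => c * psi (z + b *: y)) =
  (fun y => c * b ^+ size l * partials l psi (z + b *: y)).
Proof.
move=> spsi; elim: l => [|i s ih] /=; first by apply/funext => y; rewrite mulr1.
apply/funext => y; rewrite ih /partial derive_affine; last exact: spsi.
by rewrite exprSr mulrA.
Qed.

Lemma smooth_affine psi z b c : smooth psi -> smooth (fun y => c * psi (z + b *: y)).
Proof.
move=> spsi s y; rewrite partials_affine//; apply: differentiable_affine.
exact: spsi.
Qed.

Lemma derive_sum_coord psi x v : differentiable psi x ->
  'D_v psi x = \sum_(i < n) v ord0 i * partial i psi x.
Proof.
move=> dpsi; rewrite deriveE// {1}(row_sum_delta v) linear_sum/=.
by apply: eq_bigr => i _; rewrite linearZ/= /partial deriveE.
Qed.

Section rescaled.
Variable rho : V -> R.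
Hypotheses (srho : smooth rho) (rhos : forall z, rho z != 0 -> cube 1 z).

Lemma rescaleE e : rescale rho e = (fun x => e ^- n * rho (0 + e^-1 *: x)).
Proof. by apply/funext => x; rewrite add0r. Qed.

Lemma smooth_rescale e : smooth (rescale rho e).
Proof. by rewrite rescaleE; exact: smooth_affine. Qed.

Lemma derive_rescale e v : 'D_v (rescale rho e) = (fun x => e^-1 * rescale ('D_v rho) e x).
Proof.
apply/funext => x; rewrite rescaleE derive_affine; last exact: (srho [::]).
by rewrite add0r /rescale mulrA [e^-1 * _]mulrC.
Qed.

Lemma smooth_bounded_kernel : exists C, bounded_kernel C rho /\
  forall i, bounded_kernel C (partial i rho).
Proof.
have [C [rC drC drs]] := smooth_supported_bounded srho rhos.
exists C; split=> [|i]; split => //.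
- by apply: continuous_measurable_rV; exact: smooth_continuous.
- by apply: continuous_measurable_rV; apply: smooth_continuous; exact: smooth_partial.
- exact: drs.
Qed.

Lemma derive_bounded_kernel v : exists C, bounded_kernel C ('D_v rho).
Proof.
have [C [_ kC]] := smooth_bounded_kernel; exists (\sum_(i < n) `|v ord0 i| * C).
have E x : 'D_v rho x = \sum_(i < n) v ord0 i * partial i rho x.
  by rewrite derive_sum_coord//; exact: (srho [::]).
split.
- rewrite (funext E); apply: measurable_sum => i; apply: measurable_funM => //.
  by have [] := kC i.
- move=> z; rewrite E; apply: le_trans (ler_norm_sum _ _ _) _; apply: ler_sum => i _.
  by rewrite normrM ler_wpM2l//; have [_ + _] := kC i; exact.
- by move=> z h; apply: contraPP (negP h) => zM /=; rewrite (supported_derive0 _ rhos) ?eqxx.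
Qed.

Lemma rescale_bounded_kernel k C e : 0 < e <= 1 -> bounded_kernel C k ->
  bounded_kernel (e ^- n * C) (rescale k e).
Proof.
move=> /andP[e0 e1] [mk kC ks]; split.
- apply: measurable_funM => //; apply: (measurableT_comp mk).
  have := @measurable_affine R n e^-1 0; by under eq_fun do rewrite add0r.
- move=> z; rewrite /rescale normrM ger0_norm ?invr_ge0 ?exprn_ge0 ?(ltW e0)//.
  by rewrite ler_wpM2l ?invr_ge0 ?exprn_ge0 ?(ltW e0).
- move=> z; rewrite /rescale mulf_eq0 negb_or => /andP[_ /ks].
  rewrite /cube/= normrZ gtr0_norm ?invr_gt0// ler_pdivrMl// mulr1 => h.
  exact: le_trans h e1.
Qed.

Lemma bounded_kernelW C C' k : C <= C' -> bounded_kernel C k -> bounded_kernel C' k.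
Proof. by move=> CC' [mk kC ks]; split => // z; exact: le_trans CC'. Qed.

Lemma bounded_kernelZ C k c : bounded_kernel C k -> bounded_kernel (`|c| * C) (fun x => c * k x).
Proof.
move=> [mk kC ks]; split => [|z|z]; first exact: measurable_funM.
  by rewrite normrM ler_wpM2l.
by rewrite mulf_eq0 negb_or => /andP[_ /ks].
Qed.

Lemma averageZk p C k c e u x : 1 <= p -> locLp p u -> bounded_kernel C k ->
  0 < e <= 1 -> average (fun z => c * k z) e u x = c * average k e u x.
Proof.
move=> p1 uL kk e01; rewrite /average -RintegralZl; last 2 first.
- exact: measurable_cube.
- exact: (average_integrable x p1 uL kk e01).
by apply: eq_Rintegral => z _; rewrite mulrCA.
Qed.

Lemma mollified_derive p e u x v : 1 <= p -> locLp p u -> 0 < e <= 1 ->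
  derivable (convolution u (rescale rho e)) x v /\
  'D_v (convolution u (rescale rho e)) x = e^-1 * average ('D_v rho) e u x.
Proof.
move=> p1 uL e01; have [C [kC _]] := smooth_bounded_kernel.
have [C' kC'] := derive_bounded_kernel v.
have k1 := rescale_bounded_kernel e01 kC.
have k2 := bounded_kernelZ e^-1 (rescale_bounded_kernel e01 kC').
rewrite -derive_rescale in k2.
(* [convolution_derive] takes a single bound for the kernel and its derivative. *)
pose D := Num.max (e ^- n * C) (`|e^-1| * (e ^- n * C')).
have k1' : bounded_kernel D (rescale rho e) by apply: bounded_kernelW k1; rewrite le_max lexx.
have k2' : bounded_kernel D ('D_v (rescale rho e)).
  by apply: bounded_kernelW k2; rewrite le_max lexx orbT.
have [d ->] := convolution_derive p1 uL k1' k2' (fun y => @smooth_derivable R n _ y v (smooth_rescale e)) x.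
split=> //; rewrite derive_rescale -(averageZk e^-1 x p1 uL kC' e01).
rewrite -(averageE x p1 uL (bounded_kernelZ e^-1 kC') e01); congr convolution.
by apply/funext => y; rewrite /rescale mulrCA.
Qed.

Lemma test_function_rescale e x : 0 < e <= 1 ->
  test_function (fun y => rescale rho e (x - y)).
Proof.
move=> /andP[e0 e1].
have E : (fun y => rescale rho e (x - y)) =
    (fun y => e ^- n * rho (e^-1 *: x + (- e^-1) *: y)).
  by apply/funext => y; rewrite /rescale scalerBr scaleNr.
split; first by rewrite E; exact: smooth_affine.
have sub : [set y | rescale rho e (x - y) != 0] `<=` cube (`|x| + 1).
  move=> y /=; rewrite /rescale mulf_eq0 negb_or => /andP[_ /rhos].
  rewrite /cube/= normrZ gtr0_norm ?invr_gt0// ler_pdivrMl// mulr1 => h.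
  rewrite -[y](subKr x); apply: le_trans (ler_normB _ _) _.
  by rewrite lerD2l (le_trans h).
apply: (subclosed_compact _ (@compact_cube R n (`|x| + 1))); first exact: closed_closure.
have : closed (cube (`|x| + 1) : set V).
  by apply: compact_closed; [exact: norm_hausdorff|exact: compact_cube].
by move/closure_id => ->; exact: closureS.
Qed.

(** The weak gradient is tested against y |-> [rescale rho e (x - y)], whose partial derivative
    carries the factor [- e^-1]; this sign cancels the one in the definition of a weak gradient. *)
Lemma average_weak_gradient p q e u (g : 'I_n -> V -> R) i x :
  1 <= p -> 1 <= q -> locLp p u -> locLp q (g i) -> weak_gradient u g -> 0 < e <= 1 ->
  e^-1 * average (partial i rho) e u x = average rho e (g i) x.
Proof.
move=> p1 q1 uL gL [_ wg] e01; have [_ /(_ _ (test_function_rescale x e01))] := wg i.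
have [C [kC kCi]] := smooth_bounded_kernel.
rewrite -(averageE x q1 gL kC e01) => h; apply: oppr_inj; rewrite -[RHS]h -mulNr.
rewrite -(averageZk (- e^-1) x p1 uL (kCi i) e01).
rewrite -(averageE x p1 uL (bounded_kernelZ (- e^-1) (kCi i)) e01).
apply: eq_Rintegral => y _; congr (_ * _).
rewrite (_ : (fun y => rescale rho e (x - y)) =
    (fun y => e ^- n * rho (e^-1 *: x + (- e^-1) *: y))); last first.
  by apply/funext => z; rewrite /rescale scalerBr scaleNr.
rewrite [RHS]derive_affine; last exact: (srho [::]).
by rewrite /rescale scalerBr scaleNr mulrA.
Qed.

End rescaled.

End smooth_kernels.

(** * Difference quotients of Sobolev functions *)

(** Passage to the limit: both [a] and [X] are independent of the scale, so the vanishing error can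
    be removed. *)
Lemma vanish_const {R : realType} (F : R -> \bar R) (a X : \bar R) :
  (forall e : R, 0 < e <= 1 -> (a <= X + F e)%E) -> vanish F -> (a <= X)%E.
Proof.
move=> aXF vF; apply/lee_addgt0Pr => eta eta0; have [d d0 dF] := vF _ eta0.
pose e := Num.min (d / 2) 1.
have e0 : 0 < e by rewrite lt_min divr_gt0//=.
have ed : e < d by rewrite gt_min ltr_pdivrMr// ltr_pMr// ltr1n.
apply: le_trans (aXF e _) _; first by rewrite e0 ge_min lexx orbT.
by rewrite leeD2l// dF// e0.
Qed.

Lemma Rintegral_sum d (T : measurableType d) (R : realType)
    (m : {measure set T -> \bar R}) (D : set T) k (f : 'I_k -> T -> R) :
  measurable D -> (forall i, m.-integrable D (EFin \o f i)) ->
  \int[m]_(x in D) (\sum_(i < k) f i x) = \sum_(i < k) \int[m]_(x in D) f i x.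
Proof.
move=> mD; elim: k f => [|k ih] f fi.
  under eq_Rintegral do rewrite big_ord0.
  by rewrite big_ord0 Rintegral_cst// mul0r.
under eq_Rintegral do rewrite big_ord_recr.
rewrite big_ord_recr/= -ih//; apply: RintegralD => //.
rewrite (_ : _ \o _ = (fun x => \sum_(i < k) (f (widen_ord (leqnSn k) i) x)%:E)%E).
  by apply: integrable_sum => // i _; exact: fi.
by apply/funext => x /=; rewrite sumEFin.
Qed.

Section difference_quotient.
Context {R : realType} {n : nat}.
Local Notation V := 'rV[R]_n.
Local Notation mu := (lebesgue_rV n : {measure set V -> \bar R}).
Implicit Types (x y z h : V) (s t e M : R).
Variables (rho a : V -> R) (g : 'I_n -> V -> R) (p : R).
Hypotheses (srho : smooth rho) (rhos : forall z, rho z != 0 -> cube 1 z).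
Hypotheses (rho1 : \int[mu]_(z in cube 1) rho z = 1) (p1 : 1 <= p).
Hypotheses (aL : locLp p a) (gL : forall i, locLp p (g i)).
Hypothesis wg : weak_gradient a g.

Let p0 : 0 < p. Proof. exact: lt_le_trans p1. Qed.
Let ma : measurable_fun setT a. Proof. by case: aL. Qed.
Let mg i : measurable_fun setT (g i). Proof. by case: (gL i). Qed.

Let C := projT1 (cid (smooth_bounded_kernel srho rhos)).
Let kC : bounded_kernel C rho.
Proof. by rewrite /C; case: cid => /= ? []. Qed.
Let kCi i : bounded_kernel C (partial i rho).
Proof. by rewrite /C; case: cid => /= ? []. Qed.

Local Notation A e := (average rho e a).
Local Notation G e i := (average rho e (g i)).

Lemma mollified_gradient e x h : 0 < e <= 1 ->
  derivable (A e) x h /\ 'D_h (A e) x = \sum_(i < n) h ord0 i * G e i x.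
Proof.
move=> e01; have AE : A e = convolution a (rescale rho e).
  by apply/funext => y; rewrite (averageE y p1 aL kC e01).
have [dA DA] := mollified_derive srho rhos x h p1 aL e01.
rewrite AE; split=> //; rewrite DA.
rewrite (_ : average _ _ _ _ = \sum_(i < n) h ord0 i * average (partial i rho) e a x).
  rewrite mulr_sumr; apply: eq_bigr => i _; rewrite mulrCA; congr (_ * _).
  by rewrite (average_weak_gradient srho rhos x p1 p1 aL (gL i) wg e01).
under eq_bigr do rewrite -(averageZk _ x p1 aL (kCi _) e01).
rewrite -Rintegral_sum; last 2 first.
- exact: measurable_cube.
- move=> i; exact: (average_integrable x p1 aL (bounded_kernelZ (h ord0 i) (kCi i)) e01).
apply: eq_Rintegral => z _; rewrite derive_sum_coord; last exact: (srho [::]).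
by rewrite mulr_sumr.
Qed.

(** The fundamental theorem of calculus on [0, 1] along the segment from [x] to [x + h]. The linear
    part is subtracted from the primitive, so that only differences of gradients remain under the
    integral. *)
Lemma mollified_remainder e x h : 0 < e <= 1 ->
  A e (x + h) - A e x - \sum_(i < n) h ord0 i * G e i x =
  \int[lebesgue_measure]_(t in `[0, 1]) (\sum_(i < n) h ord0 i * (G e i (x + t *: h) - G e i x)).
Proof.
move=> e01.
pose f t := \sum_(i < n) h ord0 i * (G e i (x + t *: h) - G e i x).
pose F t := A e (x + t *: h) - t * \sum_(i < n) h ord0 i * G e i x.
have dF t : is_derive t 1 F (f t).
  have [dA DA] := mollified_gradient (x + t *: h) h e01.
  have d1 : is_derive t 1 (fun t => A e (x + t *: h)) (\sum_(i < n) h ord0 i * G e i (x + t *: h)).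
    by apply: DeriveDef; [exact/derivable_line|rewrite derive_line].
  apply: is_derive_eq; rewrite /f.
  under [RHS]eq_bigr do rewrite mulrBr.
  rewrite sumrB; congr (_ - _).
  by rewrite scaler0 add0r [_ *: 1]mulr1.
have cG i : continuous (fun t => G e i (x + t *: h)).
  move=> t; apply: differentiable_continuous; apply/derivable1_diffP.
  apply/derivable_line.
  rewrite (_ : G e i = convolution (g i) (rescale rho e)).
    by have [] := mollified_derive srho rhos (x + t *: h) h p1 (gL i) e01.
  by apply/funext => y; rewrite (averageE y p1 (gL i) kC e01).
have cf : continuous f.
  move=> t; apply: (cvg_big add_continuous) => i _; apply: cvgM; first exact: cvg_cst.
  by apply: cvgB; [exact: cG|exact: cvg_cst].
have cF : continuous F.
  by move=> t; apply: differentiable_continuous; apply/derivable1_diffP; have [] := dF t.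
have := @continuous_FTC2 R f F 0 1 ltr01 _ _ _.
rewrite /Rintegral => ->.
- rewrite /F /= scale1r scale0r addr0 mul1r mul0r subr0; ring.
- exact: continuous_subspaceT.
- split => [t _||]; first by have [] := dF t.
  + by apply: cvg_at_right_filter; exact: cF.
  + by apply: cvg_at_left_filter; exact: cF.
- by move=> t _; rewrite derive1E; have [_ ->] := dF t.
Qed.

Let K : R := Jensen_cst (lebesgue_rV n) (cube 1) p * C `^ p.
Let K1 : R := Jensen_cst (lebesgue_measure : {sigma_finite_measure set (measurableTypeR R) -> \bar R})
  (`[0, 1]%classic : set R) p.
(** [K1] comes from Jensen's inequality on [0, 1], [n ^ p] from the sum over the coordinates, and
    [K] from averaging the gradient. *)
Let K2 : R := K1 * (n%:R `^ p * K).

Let K_ge0 : 0 <= K.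
Proof. by rewrite mulr_ge0 ?Jensen_cst_ge0 ?powR_ge0. Qed.

(** The bound does not involve [e]: it uses the modulus of [g] itself, through
    [Jp_average_shift_le], which is what permits the limit in [remainder_le]. The factor [t ^ p]
    comes from the coordinates of [h]. *)
Lemma mollified_remainder_le e M h t : 0 < e <= 1 -> `|h| <= t ->
  (Jp mu (cube M) p (fun x => A e (x + h) - A e x - \sum_(i < n) h ord0 i * G e i x)%R
   <= (K2 * t `^ p)%:E * \sum_(i < n) modulus p (M + 1) (g i) t)%E.
Proof.
move=> e01 ht; under eq_fun do rewrite mollified_remainder//.
have mG i : measurable_fun setT (G e i) by exact: (average_measurable e (mg i) kC).
have mxt : measurable_fun setT (fun xt : V * measurableTypeR R => xt.1 + xt.2 *: h).
  apply/measurable_fun_rVP => i; under eq_fun do rewrite !mxE.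
  apply: measurable_funD.
    exact: (measurableT_comp (measurable_coord i) measurable_fst).
  by apply: measurable_funM => //; exact: measurable_snd.
have I1 : (lebesgue_measure (`[0%R, 1%R]%classic : set R) < +oo)%E.
  by rewrite lebesgue_measure_itv/= lte_fin ltr01 ltry.
rewrite /K2 -mulrA EFinM -muleA.
apply: (Jp_param_le (m1 := lebesgue_rV n) (m2 := lebesgue_measure) (measurable_cube M) (measurable_itv _)
  (w := fun xt : V * measurableTypeR R => \sum_(i < n) h ord0 i * (G e i (xt.1 + xt.2 *: h) - G e i xt.1))) => //.
- apply: measurable_sum => i; apply: measurable_funM => //; apply: measurable_funB.
    exact: (measurableT_comp (mG i) mxt).
  exact: (measurableT_comp (mG i) measurable_fst).
move=> s /=; rewrite in_itv/= => /andP[s0 s1].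
have mGs i : measurable_fun setT (fun x : V => G e i (x + s *: h) - G e i x).
  by apply: measurable_funB => //; exact: measurable_shift.
apply: le_trans (Jp_sum _ (measurable_cube M) _ p0) _.
  by move=> i; exact: measurable_funM.
rewrite -mulrA (EFinM (n%:R `^ p)) -muleA; apply: lee_wpmul2l.
  by rewrite lee_fin powR_ge0.
rewrite ge0_sume_distrr; last by move=> i _; apply: modulus_ge0; exact: le_trans ht.
apply: lee_sum => i _; rewrite JpZ//; last exact: measurable_cube.
rewrite mulrC (EFinM (t `^ p)) -muleA; apply: lee_pmul; rewrite ?Jp_ge0 ?lee_fin ?powR_ge0//.
  by apply: le_powR; rewrite ?(ltW p0)// (le_trans (coord_norm_le h i)).
apply: le_trans (Jp_average_shift_le p1 kC e01 M (s *: h) (gL i)) _.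
rewrite lee_wpmul2l ?lee_fin//; apply: le_modulus.
by rewrite normrZ ger0_norm// (le_trans _ ht)// ler_piMl.
Qed.

Let mA e : measurable_fun setT (A e).
Proof. exact: (average_measurable e ma kC). Qed.

Let mG e i : measurable_fun setT (G e i).
Proof. exact: (average_measurable e (mg i) kC). Qed.

(** The remainder of [a] is that of its mollification, [r1], plus three errors [d1], [d2], [d3] that
    vanish with [e]; neither side of the claim depends on [e]. The factor [2 ^ p] is the cost of
    separating [r1] from the errors. *)
Lemma remainder_le M h t : `|h| <= t ->
  (Jp mu (cube M) p (fun x => a (x + h) - a x - \sum_(i < n) h ord0 i * g i x)%R
   <= (2 `^ p)%:E * ((K2 * t `^ p)%:E * \sum_(i < n) modulus p (M + 1) (g i) t))%E.
Proof.
move=> ht; have p0' := ltW p0.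
pose r1 e := fun x => A e (x + h) - A e x - \sum_(i < n) h ord0 i * G e i x.
pose d1 e := fun x => - (A e (x + h) - a (x + h)).
pose d2 e := fun x => A e x - a x.
pose d3 e := fun x => \sum_(i < n) h ord0 i * (G e i x - g i x).
have mr1 e : measurable_fun setT (r1 e).
  apply: measurable_funB; last by apply: measurable_sum => i; exact: measurable_funM.
  by apply: measurable_funB => //; exact: (measurable_shift h (mA e)).
have md1 e : measurable_fun setT (d1 e).
  by apply: measurable_funN; exact: (measurable_shift h (measurable_funB (mA e) ma)).
have md2 e : measurable_fun setT (d2 e) by exact: measurable_funB.
have md3 e : measurable_fun setT (d3 e).
  by apply: measurable_sum => i; apply: measurable_funM => //; exact: measurable_funB.
have v1 : vanish (fun e => Jp mu (cube M) p (d1 e)).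
  apply: vanish_le (average_cvg (M + `|h|) rho1 p1 kC aL) => e _; rewrite JpN.
  exact: (Jp_shift_le M p (md2 e) (lexx `|h|)).
have v2 : vanish (fun e => Jp mu (cube M) p (d2 e)) by exact: (average_cvg _ rho1 p1 kC).
have v3 : vanish (fun e => Jp mu (cube M) p (d3 e)).
  apply: (@vanish_le _ _ (fun e => (n%:R `^ p)%:E * \sum_(i < n)
    ((`|h ord0 i| `^ p)%:E * Jp mu (cube M) p (fun x => G e i x - g i x)%R))%E).
    move=> e _; apply: le_trans (Jp_sum _ (measurable_cube M) _ p0) _.
      by move=> i; apply: measurable_funM => //; exact: measurable_funB.
    rewrite lee_wpmul2l ?lee_fin ?powR_ge0//; apply: lee_sum => i _.
    rewrite JpZ//; first exact: measurable_cube.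
    exact: measurable_funB.
  apply: vanishZ; first exact: powR_ge0.
  by apply: vanish_sum => i; apply: vanishZ; [exact: powR_ge0|exact: (average_cvg _ rho1 p1 kC (gL i))].
have v := Jp_vanishD (measurable_cube M) p0' (fun e _ => md1 e)
  (fun e _ => measurable_funD (md2 e) (md3 e)) v1
  (Jp_vanishD (measurable_cube M) p0' (fun e _ => md2 e) (fun e _ => md3 e) v2 v3).
apply: (vanish_const _ (vanishZ (powR_ge0 2 p) v)) => e e01.
rewrite (_ : (fun x => _) = (fun x => r1 e x + (d1 e x + (d2 e x + d3 e x)))).
  apply: le_trans (JpD mu (measurable_cube M) (mr1 e) _ p0') _.
    by apply: measurable_funD => //; exact: measurable_funD.
  rewrite muleDr ?ge0_adde_def ?inE ?Jp_ge0// leeD2r// lee_wpmul2l ?lee_fin ?powR_ge0//.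
  exact: mollified_remainder_le.
apply/funext => x; rewrite /r1 /d1 /d2 /d3.
rewrite (_ : \sum_(i < n) h ord0 i * (G e i x - g i x) =
    \sum_(i < n) h ord0 i * G e i x - \sum_(i < n) h ord0 i * g i x); first by ring.
by rewrite -sumrB; apply: eq_bigr => i _; rewrite mulrBr.
Qed.

Lemma diff_quotient_le e M z : 0 < e <= 1 -> cube 1 z ->
  (Jp mu (cube M) p (fun x => e^-1 * (a (x - e *: z) - a x) + \sum_(i < n) z ord0 i * g i x)%R
   <= (2 `^ p * K2)%:E * \sum_(i < n) modulus p (M + 1) (g i) e)%E.
Proof.
move=> /andP[e0 e1] z1; pose h := - (e *: z).
have he : `|h| <= e by rewrite normrN normrZ gtr0_norm// ler_piMr// ltW.
rewrite (_ : (fun x => _) = (fun x => e^-1 * (a (x + h) - a x - \sum_(i < n) h ord0 i * g i x))); last first.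
  apply/funext => x; rewrite [in RHS]mulrBr; congr (_ + _).
  rewrite mulr_sumr -sumrN; apply: eq_bigr => i _.
  by rewrite /h !mxE mulNr mulrN opprK !mulrA mulVf ?mul1r// gt_eqF.
rewrite JpZ; last 2 first.
- exact: measurable_cube.
- apply: measurable_funB; last by apply: measurable_sum => i; exact: measurable_funM.
  by apply: measurable_funB => //; exact: (measurable_shift h ma).
apply: (@le_trans _ _ ((`|e^-1| `^ p)%:E * ((2 `^ p)%:E * ((K2 * e `^ p)%:E *
    \sum_(i < n) modulus p (M + 1) (g i) e)))%E).
  by rewrite lee_wpmul2l ?lee_fin ?powR_ge0//; exact: remainder_le.
(* The factor [e^-1 ^ p] of the difference quotient cancels against the [t ^ p] of [remainder_le] at
   [t = e]. *)
rewrite !muleA -!EFinM le_eqVlt; apply/orP; left; apply/eqP; congr (_%:E * _)%E.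
rewrite gtr0_norm ?invr_gt0//.
have E : e^-1 `^ p * e `^ p = 1.
  by rewrite -powRM ?invr_ge0 ?(ltW e0)// mulVf ?powR1// gt_eqF.
by rewrite -[RHS]mulr1 -E; ring.
Qed.

Lemma diff_quotient_bound : exists2 c : R, 0 <= c & forall e M z,
  0 < e <= 1 -> cube 1 z ->
  (Jp mu (cube M) p (fun x => e^-1 * (a (x - e *: z) - a x) + \sum_(i < n) z ord0 i * g i x)%R
   <= c%:E * \sum_(i < n) modulus p (M + 1) (g i) e)%E.
Proof.
exists (2 `^ p * K2); last exact: diff_quotient_le.
by rewrite mulr_ge0 ?powR_ge0// mulr_ge0 ?Jensen_cst_ge0// mulr_ge0 ?powR_ge0.
Qed.

End difference_quotient.

(** * The commutator *)

Section weak.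
Context {R : realType} {n : nat}.
Local Notation V := 'rV[R]_n.
Local Notation mu := (lebesgue_rV n : {measure set V -> \bar R}).
Implicit Types (x y z v : V) (s t e M C p : R) (u phi k rho : V -> R).

Definition loc_bounded u := forall M, exists C, forall x, cube M x -> `|u x| <= C.

Lemma loc_boundedM u k : loc_bounded u -> loc_bounded k -> loc_bounded (fun x => u x * k x).
Proof.
move=> bu bk M; have [C hC] := bu M; have [C' hC'] := bk M.
by exists (C * C') => x xM; rewrite normrM ler_pM ?hC ?hC'.
Qed.

Lemma loc_boundedD u k : loc_bounded u -> loc_bounded k -> loc_bounded (fun x => u x + k x).
Proof.
move=> bu bk M; have [C hC] := bu M; have [C' hC'] := bk M.
by exists (C + C') => x xM; rewrite (le_trans (ler_normD _ _))// lerD ?hC ?hC'.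
Qed.

Lemma loc_boundedN u : loc_bounded u -> loc_bounded (fun x => - u x).
Proof. by move=> bu M; have [C hC] := bu M; exists C => x; rewrite normrN; exact: hC. Qed.

Lemma loc_boundedB u k : loc_bounded u -> loc_bounded k -> loc_bounded (fun x => u x - k x).
Proof. by move=> bu bk; apply: loc_boundedD => //; exact: loc_boundedN. Qed.

Lemma loc_bounded_integrable u M : measurable_fun setT u -> loc_bounded u ->
  (forall z, u z != 0 -> cube M z) -> mu.-integrable setT (EFin \o u).
Proof.
move=> mu' bu us; have [C hC] := bu M.
have uE : EFin \o u = (EFin \o u) \_ (cube M).
  apply/funext => x; rewrite patchE; case: ifPn => // xM /=.
  by have [->//|/us xM'] := eqVneq (u x) 0; move: xM; rewrite mem_set.
rewrite uE; apply/(integrable_mkcond _ (measurable_cube M)).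
apply: (measurable_bounded_integrable (measurable_cube M)).
- exact: lebesgue_cube_fin.
- exact: measurable_funTS.
- exists C; split; first exact: num_real.
  by move=> c Cc z /hC h; apply: le_trans h (ltW Cc).
Qed.

(** Integration by parts: [int_derive0] applied to the product of [u] and the test function. It asks
    only for derivatives along the axes, with local bounds, which is what the product rule gives for
    the commutator. *)
Lemma weak_gradient_classical u : measurable_fun setT u -> loc_bounded u ->
  (forall i x, derivable u x (delta_mx ord0 i)) ->
  (forall i, measurable_fun setT (partial i u)) ->
  (forall i, loc_bounded (partial i u)) ->
  weak_gradient u (fun i => partial i u).
Proof.
move=> mu' bu du mdu bdu; split; first exact/(Lloc_locLp _ ltr01)/locLp_bounded.
move=> i; split.
  by apply/(Lloc_locLp _ ltr01); apply: locLp_bounded => //; exact: bdu.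
move=> phi [sphi cphi]; have [M _ hM] := compact_sub_cube cphi.
have phis z : phi z != 0 -> cube M z by move=> h; apply: hM; exact: subset_closure.
have [C [phiC dphiC dphis]] := smooth_supported_bounded sphi phis.
have mphi : measurable_fun setT phi.
  by apply: continuous_measurable_rV; exact: smooth_continuous.
have mdphi : measurable_fun setT (partial i phi).
  by apply: continuous_measurable_rV; apply: smooth_continuous; exact: smooth_partial.
have bphi : loc_bounded phi by move=> N; exists C.
have bdphi : loc_bounded (partial i phi) by move=> N; exists C => x _; exact: dphiC.
have dE x : 'D_(delta_mx ord0 i) (fun x => u x * phi x) x =
    u x * partial i phi x + partial i u x * phi x.
  rewrite [LHS](deriveM (du i x) (@smooth_derivable R n phi x _ sphi)).
  by rewrite [X in _ + X]mulrC.
have i1 : mu.-integrable setT (EFin \o (fun x => u x * partial i phi x)).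
  apply: (@loc_bounded_integrable _ M); first exact: measurable_funM.
    exact: loc_boundedM.
  by move=> z; rewrite mulf_eq0 negb_or => /andP[_]; exact: dphis.
have i2 : mu.-integrable setT (EFin \o (fun x => partial i u x * phi x)).
  apply: (@loc_bounded_integrable _ M); first exact: measurable_funM.
    exact: loc_boundedM.
  by move=> z; rewrite mulf_eq0 negb_or => /andP[_]; exact: phis.
have bpsi : loc_bounded (fun x => u x * phi x) by exact: loc_boundedM.
have bdpsi : loc_bounded (fun x => u x * partial i phi x + partial i u x * phi x).
  by apply: loc_boundedD; exact: loc_boundedM.
have psis z : u z * phi z != 0 -> cube M z.
  by rewrite mulf_eq0 negb_or => /andP[_]; exact: phis.
have [C1 hC1] := bpsi M; have [C2 hC2] := bdpsi M.
have := @int_derive0 R n M (`|C1| + `|C2|) (fun x => u x * phi x) (delta_mx ord0 i) _ _ psis _ _ _.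
rewrite (eq_Rintegral _ (fun x _ => dE x)) RintegralD// => h; apply/eqP.
rewrite -addr_eq0; apply/eqP; apply: h.
- exact: measurable_funM.
- rewrite (funext dE); apply: measurable_funD; exact: measurable_funM.
- move=> x; exact: (derivableM (du i x) (@smooth_derivable R n phi x _ sphi)).
- move=> x; have [->|/psis/hC1 xC] := eqVneq (u x * phi x) 0; first by rewrite normr0 addr_ge0.
  by apply: le_trans xC _; rewrite (le_trans (ler_norm C1))// lerDl.
- move=> x; have [xM|xM] := pselect (cube M x); last first.
    by rewrite (supported_derive0 _ psis)// normr0 addr_ge0.
  by rewrite dE (le_trans (hC2 _ xM))// (le_trans (ler_norm C2))// lerDr.
Qed.

(** On [cube M] the average is at most [C * e ^- n] times the integral of [|u|] over [cube (M + 1)].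
    The bound degenerates with [e], but it is used at a fixed scale only. *)
Lemma average_bounded p C k e u : 1 <= p -> locLp p u -> bounded_kernel C k ->
  0 < e <= 1 -> loc_bounded (average k e u).
Proof.
move=> p1 uL kk e01 M; have [mk kC _] := kk; have [mu' _] := uL; have /andP[e0 e1] := e01.
have C0 : 0 <= C by exact: le_trans (kC 0).
have mabs : measurable_fun setT (fun y => `|u y|) by exact: measurableT_comp.
have /integrableP[_ uoo] := locLp_integrable (M + 1) p1 uL.
set I := (\int[mu]_(y in cube (M + 1)) `|(EFin \o u) y|)%E in uoo.
have I0 : (0 <= I)%E by apply: integral_ge0.
have en0 : 0 < e ^+ n by rewrite exprn_gt0.
exists (C * (e ^- n * fine I)) => x xM.
have ui := average_integrable x p1 uL kk e01.
have uxi := affine_integrable x p1 uL e01.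
rewrite -lee_fin EFin_normr_Rintegral//; last exact: measurable_cube.
apply: le_trans (le_abse_integral _ (measurable_cube 1) (measurable_int _ ui)) _.
have mux : measurable_fun setT (fun z : V => u (x - e *: z)) by exact: measurable_affine_comp.
apply: (@le_trans _ _ (C%:E * \int[mu]_(z in cube 1) (`|u (x - e *: z)%R|)%:E)%E).
  rewrite ge0_intZ//; [|exact: measurable_cube|exact: measurableT_comp].
  under eq_integral do rewrite abse_EFin.
  apply: ge0_int_le => //; first exact: measurable_cube.
  - by apply: measurableT_comp => //; exact: measurable_funM.
  - by apply: measurable_funM => //; exact: measurableT_comp.
  - by move=> z _; rewrite normrM mulrC ler_wpM2r.
rewrite EFinM lee_wpmul2l ?lee_fin// EFinM fineK ?ge0_fin_numE//.
have h : ((e ^+ n)%:E * \int[mu]_(z in cube 1) (`|u (x - e *: z)%R|)%:E <= I)%E.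
  apply: le_trans (int_affine_le 1 x e01 mabs (fun y => normr_ge0 _)) _.
  apply: ge0_subset_integral; [exact: measurable_cube|exact: measurable_cube| |by []|].
    by apply/measurable_EFinP; exact: measurable_funTS.
  by apply: sub_cube; rewrite lerD2r.
have := @lee_wpmul2l _ (e ^- n)%:E _ _ _ h; rewrite muleA -EFinM mulVf ?gt_eqF// mul1e.
by apply; rewrite lee_fin invr_ge0 ltW.
Qed.

Lemma Rintegral_supported k : (forall z, k z != 0 -> cube 1 z) ->
  \int[mu]_(z in cube 1) k z = \int[mu]_z k z.
Proof.
move=> ks; rewrite Rintegral_mkcond; congr Rintegral; apply/funext => z.
rewrite patchE; case: ifPn => // zM.
by have [->//|/ks zM'] := eqVneq (k z) 0; move: zM; rewrite mem_set.
Qed.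

Lemma derive_coord j x v : derivable (fun z : V => z ord0 j) x v /\
  'D_v (fun z : V => z ord0 j) x = v ord0 j.
Proof.
have E : (fun s : R => (x + s *: v) ord0 j) = (fun s : R => x ord0 j + s * v ord0 j).
  by apply/funext => s; rewrite !mxE.
have d : is_derive (0 : R) 1 (fun s : R => x ord0 j + s * v ord0 j) (v ord0 j).
  by apply: is_derive_eq; rewrite add0r mul1r scaler0 add0r [_ *: 1]mulr1.
split; first by apply/derivable_line0; rewrite E; have [] := d.
by rewrite -derive_line0 E; have [_ ->] := d.
Qed.

Section moments.
Variable rho : V -> R.
Hypotheses (srho : smooth rho) (rhos : forall z, rho z != 0 -> cube 1 z).

Lemma partial_mean0 i : \int[mu]_(z in cube 1) partial i rho z = 0.
Proof.
have [C [rC drC drs]] := smooth_supported_bounded srho rhos.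
rewrite Rintegral_supported; last exact: drs.
apply: (@int_derive0 R n 1 C rho) => //.
- by apply: continuous_measurable_rV; exact: smooth_continuous.
- by apply: continuous_measurable_rV; apply: smooth_continuous; exact: smooth_partial.
- by move=> x; exact: smooth_derivable.
- by move=> x; exact: drC.
Qed.

(** The derivative of z |-> [z ord0 j * rho z] has integral 0 by [int_derive0]; the product rule
    then gives the moment. *)
Lemma partial_moment i j : \int[mu]_(z in cube 1) (z ord0 j * partial i rho z) =
  - (i == j)%:R * \int[mu]_(z in cube 1) rho z.
Proof.
have [C [rC drC drs]] := smooth_supported_bounded srho rhos.
have C0 : 0 <= C by exact: le_trans (rC 0).
have mr : measurable_fun setT rho.
  by apply: continuous_measurable_rV; exact: smooth_continuous.
have mdr : measurable_fun setT (partial i rho).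
  by apply: continuous_measurable_rV; apply: smooth_continuous; exact: smooth_partial.
pose psi z := z ord0 j * rho z.
have dpsi z : 'D_(delta_mx ord0 i) psi z = (i == j)%:R * rho z + z ord0 j * partial i rho z.
  have [dz Dz] := derive_coord j z (delta_mx ord0 i).
  rewrite [LHS](deriveM dz (@smooth_derivable R n rho z _ srho)) Dz addrC mxE eqxx/= eq_sym.
  by rewrite [rho z *: _]mulrC.
have psis z : psi z != 0 -> cube 1 z.
  by rewrite mulf_eq0 negb_or => /andP[_]; exact: rhos.
(* On the support the coordinate is at most 1 in absolute value, so the bound [C] of the kernel
   survives multiplication by it. *)
have zr k z : (forall z, `|k z| <= C) -> (forall z, k z != 0 -> cube 1 z) -> `|z ord0 j * k z| <= C.
  move=> kC ks; have [->|/ks zk] := eqVneq (k z) 0; first by rewrite mulr0 normr0.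
  rewrite normrM; apply: le_trans (kC z); rewrite ler_piMl//.
  exact: le_trans (coord_norm_le z j) zk.
have ms : measurable_fun setT (fun z : V => z ord0 j) by exact: measurable_coord.
have h : \int[mu]_z 'D_(delta_mx ord0 i) psi z = 0.
  apply: (@int_derive0 R n 1 (C + C)) => //.
  - exact: measurable_funM.
  - by rewrite (funext dpsi); apply: measurable_funD; apply: measurable_funM.
  - move=> z; have [dz _] := derive_coord j z (delta_mx ord0 i).
    exact: (derivableM dz (@smooth_derivable R n rho z _ srho)).
  - by move=> z; rewrite (le_trans (zr _ _ rC rhos))// lerDl.
  - move=> z; rewrite dpsi (le_trans (ler_normD _ _))// lerD//; last exact: zr (drC i) (drs i).
    rewrite normrM (le_trans _ (rC z))// ler_piMl// ger0_norm// lern1; exact: leq_b1.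
have b1 k : measurable_fun setT k -> (forall z, `|k z| <= C) ->
    mu.-integrable (cube 1) (EFin \o k).
  move=> mk kC; apply: (measurable_bounded_integrable (measurable_cube 1)).
  - exact: lebesgue_cube_fin.
  - exact: measurable_funTS.
  - exists C; split; first exact: num_real.
    by move=> c Cc z _; apply: le_trans (kC z) (ltW Cc).
rewrite -Rintegral_supported in h; last first.
  by move=> z hz; apply: contraPP (negP hz) => zM /=; rewrite (supported_derive0 _ psis) ?eqxx.
move: h; rewrite (eq_Rintegral _ (fun x _ => dpsi x)) RintegralD; last 3 first.
- exact: measurable_cube.
- exact: (integrableZl (measurable_cube 1) (i == j)%:R (b1 _ mr rC)).
- apply: b1; first exact: measurable_funM.
  by move=> z; exact: zr (drC i) (drs i).
rewrite RintegralZl; last 2 first.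
- exact: measurable_cube.
- exact: b1.
by move=> /eqP; rewrite addrC addr_eq0 mulNr => /eqP.
Qed.

End moments.

Lemma le_modulus_mono p M u s t : s <= t -> (modulus p M u s <= modulus p M u t)%E.
Proof.
move=> st; apply: ge_ereal_sup => _ [h hs <-]; apply: le_modulus.
exact: le_trans st.
Qed.

Lemma modulus_lty p M u t : 0 <= p -> 0 <= t -> locLp p u -> (modulus p M u t < +oo)%E.
Proof.
move=> p0 t0 [mu' uoo].
apply: (@le_lt_trans _ _ ((2 `^ p)%:E * (Jp mu (cube (M + t)) p u + Jp mu (cube M) p u))%E).
  apply: ge_ereal_sup => _ [h ht <-].
  have mh : measurable_fun setT (fun x : V => u (x + h)) by exact: measurable_shift.
  apply: le_trans (JpD _ (measurable_cube M) mh (measurable_funN mu') p0) _.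
  rewrite JpN lee_wpmul2l ?lee_fin ?powR_ge0// leeD2r//.
  exact: Jp_shift_le.
apply: lte_mul_pinfty; [by rewrite lee_fin powR_ge0|by []|].
exact: lte_add_pinfty.
Qed.

End weak.

(** * The residual and the four terms of its partial derivatives *)

Section commutator.
Context {R : realType} {n : nat}.
Local Notation V := 'rV[R]_n.
Local Notation mu := (lebesgue_rV n : {measure set V -> \bar R}).
Implicit Types (x y z : V) (e t M l : R).
Variables (rho a f : V -> R) (g : 'I_n -> V -> R) (p q r : R).
Hypotheses (srho : smooth rho) (rhos : forall z, rho z != 0 -> cube 1 z).
Hypotheses (rho1 : \int[mu]_(z in cube 1) rho z = 1).
Hypotheses (p1 : 1 <= p) (q1 : 1 <= q) (r1 : 1 <= r) (rE : r^-1 = p^-1 + q^-1).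
Hypotheses (aL : locLp p a) (gL : forall i, locLp p (g i)) (fL : locLp q f).
Hypothesis wg : weak_gradient a g.

Let p0 : 0 < p. Proof. exact: lt_le_trans p1. Qed.
Let q0 : 0 < q. Proof. exact: lt_le_trans q1. Qed.
Let r0 : 0 < r. Proof. exact: lt_le_trans r1. Qed.
Let ma : measurable_fun setT a. Proof. by case: aL. Qed.
Let mf : measurable_fun setT f. Proof. by case: fL. Qed.
Let mg i : measurable_fun setT (g i). Proof. by case: (gL i). Qed.

Let C := projT1 (cid (smooth_bounded_kernel srho rhos)).
Let kC : bounded_kernel C rho.
Proof. by rewrite /C; case: cid => /= ? []. Qed.
Let kCi i : bounded_kernel C (partial i rho).
Proof. by rewrite /C; case: cid => /= ? []. Qed.

Let rE' : r^-1 = q^-1 + p^-1. Proof. by rewrite addrC. Qed.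

Lemma locLpM (u v : V -> R) : locLp p u -> locLp q v -> locLp r (fun x => u x * v x).
Proof.
move=> [mu' uoo] [mv voo]; split=> [|M]; first exact: measurable_funM.
apply: le_lt_trans (JpM mu (measurable_cube M) mu' mv p0 q0 rE ltr01) _.
by rewrite !powR1 !mul1e; apply: lte_add_pinfty.
Qed.

Let af x := a x * f x.
Let afL : locLp r af. Proof. exact: locLpM. Qed.
Let maf : measurable_fun setT af. Proof. by case: afL. Qed.

Definition residual e x := average rho e a x * average rho e f x - average rho e af x.

Let mav k (u : V -> R) e : bounded_kernel C k -> measurable_fun setT u ->
  measurable_fun setT (average k e u).
Proof. by move=> kk mu'; exact: (average_measurable e mu' kk). Qed.

(** Both the product of the averages and the average of the product tend to [a * f] in L^r. *)
Lemma residual_vanish M : vanish (fun e => Jp mu (cube M) r (residual e)).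
Proof.
have v1 : vanish (fun e => Jp mu (cube M) r (fun x =>
    average rho e a x * average rho e f x - a x * f x)).
  apply: (Jp_cvgM (measurable_cube M) p0 q0 rE _ _ ma mf _ _ (average_cvg M rho1 p1 kC aL) (average_cvg M rho1 q1 kC fL)).
  - by move=> e _; exact: mav.
  - by move=> e _; exact: mav.
  - by case: aL.
  - by case: fL.
have v2 : vanish (fun e => Jp mu (cube M) r (fun x => - (average rho e af x - af x))).
  by apply: vanish_le (average_cvg M rho1 r1 kC afL) => e _; rewrite JpN.
have m1 e : measurable_fun setT (fun x => average rho e a x * average rho e f x - a x * f x).
  by apply: measurable_funB; apply: measurable_funM => //; exact: mav.
have m2 e : measurable_fun setT (fun x => - (average rho e af x - af x)).
  by apply: measurable_funN; apply: measurable_funB => //; exact: mav.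
have := Jp_vanishD (measurable_cube M) (ltW r0) (fun e _ => m1 e) (fun e _ => m2 e) v1 v2.
apply: vanish_le => e _; rewrite le_eqVlt; apply/orP; left; apply/eqP; congr Jp.
by apply/funext => x; rewrite /residual /af; ring.
Qed.

Section partial_residual.
Variable i : 'I_n.

Let kappa j z := z ord0 j * partial i rho z.

Let kappa_kernel j : bounded_kernel C (kappa j).
Proof.
have [mk kk ks] := kCi i; split.
- by apply: measurable_funM => //; exact: measurable_coord.
- move=> z; rewrite /kappa; have [->|/ks zk] := eqVneq (partial i rho z) 0.
    by rewrite mulr0 normr0; exact: le_trans (kk 0).
  rewrite normrM; apply: le_trans (kk z); rewrite ler_piMl//.
  exact: le_trans (coord_norm_le z j) zk.
- by move=> z; rewrite mulf_eq0 negb_or => /andP[_]; exact: ks.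
Qed.

(** The displacement is [- (e *: xz.2)], hence the plus sign in front of the linear part. *)
Let D e (xz : V * V) := e^-1 * (a (xz.1 - e *: xz.2) - a xz.1)
  + \sum_(j < n) xz.2 ord0 j * g j xz.1.

Let w e (xz : V * V) := f (xz.1 - e *: xz.2) * (partial i rho xz.2 * D e xz).

Let T1 e x := average rho e (g i) x * average rho e f x - g i x * f x.
Let T2 e x := (e^-1 * (average rho e a x - a x)) * average (partial i rho) e f x.
Let T3 e x := \sum_(j < n) g j x * (average (kappa j) e f x + (i == j)%:R * f x).
Let T4 e x := \int[mu]_(z in cube 1) w e (x, z).

(** In the factors coming from [f] and [a * f] the derivative stays on the kernel and costs [e^-1];
    in the one coming from [a] it is moved onto the weak gradient. *)
Lemma partial_residual_raw e x : 0 < e <= 1 ->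
  derivable (residual e) x (delta_mx ord0 i) /\
  partial i (residual e) x =
  average rho e a x * (e^-1 * average (partial i rho) e f x) +
  average rho e f x * average rho e (g i) x - e^-1 * average (partial i rho) e af x.
Proof.
move=> e01; pose v : V := delta_mx ord0 i.
have aE p' u : 1 <= p' -> locLp p' u -> average rho e u = convolution u (rescale rho e).
  by move=> p'1 uL; apply/funext => y; rewrite (averageE y p'1 uL kC e01).
have [dA DA] := mollified_derive srho rhos x v p1 aL e01.
have [dF DF] := mollified_derive srho rhos x v q1 fL e01.
have [dAF DAF] := mollified_derive srho rhos x v r1 afL e01.
rewrite -(aE _ _ p1 aL) in dA DA; rewrite -(aE _ _ q1 fL) in dF DF.
rewrite -(aE _ _ r1 afL) in dAF DAF.
split; first exact: (derivableB (derivableM dA dF) dAF).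
rewrite /partial -/v [LHS](deriveB (derivableM dA dF) dAF) (deriveM dA dF) DA DF DAF.
by rewrite (average_weak_gradient srho rhos x p1 p1 aL (gL i) wg e01).
Qed.

Lemma T4E e x : 0 < e <= 1 ->
  T4 e x = e^-1 * average (partial i rho) e af x
    - (e^-1 * a x) * average (partial i rho) e f x
    + \sum_(j < n) g j x * average (kappa j) e f x.
Proof.
move=> e01; have i1 := average_integrable x r1 afL (kCi i) e01.
have i2 := average_integrable x q1 fL (kCi i) e01.
have i3 j := average_integrable x q1 fL (kappa_kernel j) e01.
have mc := measurable_cube (1 : R) : measurable (cube 1 : set V).
have z1 := integrableZl mc e^-1 i1; have z2 := integrableZl mc (e^-1 * a x) i2.
have z3 j := integrableZl mc (g j x) (i3 j).
rewrite /average -!RintegralZl//.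
have sumE : \sum_(j < n) g j x * \int[mu]_(z in cube 1) (f (x - e *: z) * kappa j z) =
    \int[mu]_(z in cube 1) (\sum_(j < n) g j x * (f (x - e *: z) * kappa j z)).
  by rewrite Rintegral_sum//; apply: eq_bigr => j _; rewrite RintegralZl//; exact: i3.
rewrite sumE -RintegralB// -RintegralD//.
- apply: eq_Rintegral => z _; rewrite /w /D /= mulrDr mulrDr; congr (_ + _).
    by rewrite /af; ring.
  rewrite 2!mulr_sumr; apply: eq_bigr => j _; rewrite /kappa; ring.
- by rewrite (_ : _ \o _ = (fun z => (e^-1 * (af (x - e *: z) * partial i rho z))%:E -
    (e^-1 * a x * (f (x - e *: z) * partial i rho z))%:E)%E)//; exact: integrableB.
- rewrite (_ : _ \o _ = (fun z => \sum_(j < n) (g j x * (f (x - e *: z) * kappa j z))%:E)%E).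
    apply: integrable_sum => // j _; exact: z3.
  by apply/funext => z; rewrite /= sumEFin.
Qed.

(** The term [g i x * f x] removed in [T1] returns as the diagonal part of [T3], while the part of
    [T2] containing [a x] and the moment sum of [T3] cancel against the expansion [T4E]. *)
Lemma partial_residualE e x : 0 < e <= 1 ->
  partial i (residual e) x = T1 e x + (T2 e x + (T3 e x - T4 e x)).
Proof.
move=> e01; have [_ ->] := partial_residual_raw x e01; rewrite T4E//.
have -> : T3 e x = \sum_(j < n) g j x * average (kappa j) e f x + g i x * f x.
  rewrite /T3; under eq_bigr do rewrite mulrDr.
  rewrite big_split/=; congr (_ + _); rewrite (bigD1 i)//= eqxx mul1r big1 ?addr0//.
  by move=> j /negbTE ji; rewrite eq_sym ji mul0r mulr0.
by rewrite /T1 /T2; ring.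
Qed.

Lemma T1_vanish M : vanish (fun e => Jp mu (cube M) r (T1 e)).
Proof.
apply: (Jp_cvgM (measurable_cube M) p0 q0 rE _ _ (mg i) mf _ _ (average_cvg M rho1 p1 kC (gL i)) (average_cvg M rho1 q1 kC fL)).
- by move=> e _; exact: mav.
- by move=> e _; exact: mav.
- by case: (gL i).
- by case: fL.
Qed.

Let finite_Jp p' u M : locLp p' u ->
  (Jp mu (cube M) p' u <= (fine (Jp mu (cube M) p' u))%:E)%E.
Proof. by move=> [_ uoo]; rewrite fineK// ge0_fin_numE ?Jp_ge0. Qed.

(** The kernel [kappa j] has integral [- (i == j)], so the bracket tends to 0 in L^q while [g j]
    stays fixed in L^p. *)
Lemma T3_vanish M : vanish (fun e => Jp mu (cube M) r (T3 e)).
Proof.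
have mt j e : measurable_fun setT (fun x => average (kappa j) e f x + (i == j)%:R * f x).
  by apply: measurable_funD; [exact: mav|exact: measurable_funM].
apply: (@vanish_le _ _ (fun e => (n%:R `^ r)%:E * \sum_(j < n) Jp mu (cube M) r
    (fun x => g j x * (average (kappa j) e f x + (i == j)%:R * f x))%R)%E).
  move=> e _; apply: (Jp_sum _ (measurable_cube M) _ r0) => j.
  exact: measurable_funM.
apply: vanishZ; first exact: powR_ge0.
apply: vanish_sum => j.
apply: (Jp_vanishM (measurable_cube M) p0 q0 rE (u := fun=> g j) (B := fine (Jp mu (cube M) p (g j)))).
- by move=> e _.
- by move=> e _.
- by move=> e _; exact: finite_Jp.
have := average_vanish M q1 (kappa_kernel j) fL.
rewrite (partial_moment srho rhos) rho1 mulr1.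
apply: vanish_le => e _; rewrite le_eqVlt; apply/orP; left; apply/eqP; congr Jp.
by apply/funext => x; rewrite mulNr opprK.
Qed.

Let mD e : measurable_fun setT (D e).
Proof.
apply: measurable_funD.
  apply: measurable_funM => //; apply: measurable_funB; first exact: measurable_pair_affine.
  exact: (measurableT_comp ma measurable_fst).
apply: measurable_sum => j; apply: measurable_funM.
  exact: (measurableT_comp (measurable_coord j) measurable_snd).
exact: (measurableT_comp (mg j) measurable_fst).
Qed.

Let mDz e z : measurable_fun setT (fun x => D e (x, z)).
Proof. exact: (measurableT_comp (mD e) (measurable_pair2 z)). Qed.

(** As [rho] has integral 1, the quotient is the average over [z] of [rho z] times the difference
    quotient of [a]. The latter is [D e (x, z) - N z x], where the modulus of [g] at scale 1 bounds
    [D] and the L^p size of [g] bounds [N]. *)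
Lemma quotient_bounded M : exists B, forall e, 0 < e <= 1 ->
  (Jp mu (cube M) p (fun x => e^-1 * (average rho e a x - a x))%R <= B%:E)%E.
Proof.
have [c c0 hc] := diff_quotient_bound srho rhos rho1 p1 aL gL wg.
pose N z x := \sum_(j < n) z ord0 j * g j x.
pose X := (c%:E * \sum_(j < n) modulus p (M + 1) (g j) 1)%E.
pose Y := ((n%:R `^ p)%:E * \sum_(j < n) Jp mu (cube M) p (g j))%E.
pose B0 := ((C `^ p)%:E * ((2 `^ p)%:E * (X + Y)))%E.
pose B1 := ((Jensen_cst (lebesgue_rV n) (cube 1) p)%:E * B0)%E.
have X0 : (0 <= X)%E.
  by rewrite mule_ge0 ?lee_fin// sume_ge0// => j _; exact: modulus_ge0.
have Y0 : (0 <= Y)%E.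
  by rewrite mule_ge0 ?lee_fin ?powR_ge0// sume_ge0// => j _; exact: Jp_ge0.
have B0_ge0 : (0 <= B0)%E by rewrite !mule_ge0 ?lee_fin ?powR_ge0 ?adde_ge0.
have B0oo : (B0 < +oo)%E.
  rewrite lte_mul_pinfty ?lee_fin ?powR_ge0// lte_mul_pinfty ?lee_fin ?powR_ge0//.
  rewrite lte_add_pinfty// lte_mul_pinfty ?lee_fin ?powR_ge0//; apply: lte_sum_pinfty => j _.
    by apply: modulus_lty => //; exact: ltW.
  by case: (gL j).
have B1E : B1 = (fine B1)%:E.
  rewrite fineK// ge0_fin_numE; first by rewrite lte_mul_pinfty ?lee_fin ?Jensen_cst_ge0.
  by rewrite mule_ge0 ?lee_fin ?Jensen_cst_ge0.
exists (fine B1) => e e01; rewrite -B1E.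
have [mr rC rs] := kC.
rewrite (_ : (fun x => _) = (fun x => \int[mu]_(z in cube 1)
    (rho z * (e^-1 * (a (x - e *: z) - a x))))); last first.
  apply/funext => x; have i1 := average_integrable x p1 aL kC e01.
  have i2 := integrableZl (measurable_cube 1) (a x) (kernel_integrable kC).
  (* The subtracted [a x] is multiplied by the integral of [rho], which is 1, in order to enter the
     integral. *)
  rewrite -[X in _ * (_ - X)]mulr1 -[X in _ * (_ - _ * X)]rho1 -RintegralZl; last 2 first.
  - exact: measurable_cube.
  - exact: kernel_integrable kC.
  rewrite -RintegralB//; last exact: measurable_cube.
  rewrite -RintegralZl; last 2 first.
  - exact: measurable_cube.
  - exact: (integrableB (measurable_cube 1) i1 i2).
  by apply: eq_Rintegral => z _; ring.
apply: (Jp_param_le (m1 := lebesgue_rV n) (m2 := lebesgue_rV n) (measurable_cube M) (measurable_cube 1)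
  (w := fun xz : V * V => rho xz.2 * (e^-1 * (a (xz.1 - e *: xz.2) - a xz.1)))) => //.
- apply: measurable_funM; first exact: (measurableT_comp mr measurable_snd).
  apply: measurable_funM => //; apply: measurable_funB; first exact: measurable_pair_affine.
  exact: (measurableT_comp ma measurable_fst).
- exact: lebesgue_cube_fin.
move=> z z1 /=; have mNz : measurable_fun setT (N z).
  by apply: measurable_sum => j; exact: measurable_funM.
have E x : e^-1 * (a (x - e *: z) - a x) = D e (x, z) + - N z x by rewrite /D /= addrK.
have mq : measurable_fun setT (fun x : V => e^-1 * (a (x - e *: z) - a x)).
  by rewrite (funext E); apply: measurable_funD => //; exact: measurable_funN.
rewrite JpZ//; last exact: measurable_cube.
apply: lee_pmul; rewrite ?Jp_ge0 ?lee_fin ?powR_ge0//.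
  by apply: le_powR; rewrite ?(ltW p0).
rewrite (funext E).
apply: le_trans (JpD mu (measurable_cube M) (mDz e z) (measurable_funN mNz) (ltW p0)) _.
rewrite lee_wpmul2l ?lee_fin ?powR_ge0// leeD//.
  apply: le_trans (hc _ M _ e01 z1) _; rewrite lee_wpmul2l ?lee_fin//.
  by apply: lee_sum => j _; apply: le_modulus_mono; case/andP: e01.
rewrite JpN; apply: le_trans (Jp_sum _ (measurable_cube M) _ p0) _.
  by move=> j; exact: measurable_funM.
rewrite lee_wpmul2l ?lee_fin ?powR_ge0//; apply: lee_sum => j _.
rewrite JpZ//; last exact: measurable_cube.
rewrite -[leRHS]mul1e lee_wpmul2r ?Jp_ge0// lee_fin.
have := le_powR (ltW p0) (normr_ge0 _) (le_trans (coord_norm_le z j) z1).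
by rewrite powR1.
Qed.

(** The singular quotient is only bounded; the decay comes from the other factor, as [partial i rho]
    has integral 0. *)
Lemma T2_vanish M : vanish (fun e => Jp mu (cube M) r (T2 e)).
Proof.
have [B hB] := quotient_bounded M.
apply: (Jp_vanishM (measurable_cube M) p0 q0 rE (B := B)).
- move=> e _; apply: measurable_funM => //; apply: measurable_funB => //; exact: mav.
- by move=> e _; exact: mav.
- exact: hB.
have := average_vanish M q1 (kCi i) fL; rewrite (partial_mean0 srho rhos).
apply: vanish_le => e _; rewrite le_eqVlt; apply/orP; left; apply/eqP; congr Jp.
by apply/funext => x; rewrite mul0r subr0.
Qed.

Let mw e : measurable_fun setT (w e).
Proof.
apply: measurable_funM; first exact: measurable_pair_affine.
apply: measurable_funM => //.
by have [mk _ _] := kCi i; exact: (measurableT_comp mk measurable_snd).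
Qed.

Let J : R := Jensen_cst (lebesgue_rV n) (cube 1) r.

(** Young's inequality on each slice in [z], then [Jp_param_le]. Here [f] is the bounded factor and
    [D] the vanishing one, so the exponents occur in the order [q], [p]. *)
Lemma T4_le M c : (forall e z, 0 < e <= 1 -> cube 1 z ->
    (Jp mu (cube M) p (fun x => D e (x, z)) <=
     c%:E * \sum_(j < n) modulus p (M + 1) (g j) e)%E) ->
  forall l e, 0 < l -> 0 < e <= 1 ->
  (Jp mu (cube M) r (T4 e) <=
    (l `^ q)%:E * (J * fine (Jp mu (cube (M + 1)) q f))%:E +
    (l `^ (- p))%:E * (J%:E * ((C `^ p)%:E * (c%:E * \sum_(j < n) modulus p (M + 1) (g j) e))))%E.
Proof.
move=> hc l e l0 e01; have /andP[e0 e1] := e01.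
pose X := ((C `^ p)%:E * (c%:E * \sum_(j < n) modulus p (M + 1) (g j) e))%E.
have h0 : cube 1 (0 : V) by rewrite /cube/= normr0.
have X0 : (0 <= X)%E.
  rewrite mule_ge0 ?lee_fin ?powR_ge0//.
  exact: le_trans (Jp_ge0 _ _ _ _) (hc e 0 e01 h0).
have J0 : 0 <= J by exact: Jensen_cst_ge0.
have [_ foo] := fL.
apply: (@le_trans _ _ (J%:E * ((l `^ q)%:E * Jp mu (cube (M + 1)) q f + (l `^ (- p))%:E * X))%E).
  apply: (Jp_param_le (m1 := lebesgue_rV n) (m2 := lebesgue_rV n) (measurable_cube M) (measurable_cube 1) (mw e)) => //.
    exact: lebesgue_cube_fin.
  move=> z z1; have [_ kk _] := kCi i.
  have mfz : measurable_fun setT (fun x : V => f (x - e *: z)) by exact: (measurable_shift (- (e *: z)) mf).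
  have mkD : measurable_fun setT (fun x => partial i rho z * D e (x, z)) by exact: measurable_funM.
  apply: le_trans (JpM mu (measurable_cube M) mfz mkD q0 p0 rE' l0) _.
  rewrite leeD// lee_wpmul2l ?lee_fin ?powR_ge0//.
    apply: (Jp_shift_le M q mf (h := - (e *: z)) (t := 1)).
    by rewrite normrN normrZ gtr0_norm// (le_trans _ e1)// ler_piMr// ltW.
  rewrite JpZ//; last exact: measurable_cube.
  apply: lee_pmul; rewrite ?Jp_ge0 ?lee_fin ?powR_ge0//; last exact: hc.
  by apply: le_powR; rewrite ?(ltW p0).
have Jf0 : (0 <= Jp mu (cube (M + 1)) q f)%E by exact: Jp_ge0.
rewrite ge0_muleDr; [|by rewrite mule_ge0 ?lee_fin ?powR_ge0|by rewrite mule_ge0 ?lee_fin ?powR_ge0].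
have fE : (fine (Jp mu (cube (M + 1)) q f))%:E = Jp mu (cube (M + 1)) q f.
  by rewrite fineK// ge0_fin_numE.
rewrite (EFinM J) fE -/X (muleCA J%:E) (muleCA J%:E).
exact: lexx.
Qed.

Lemma T4_vanish M : vanish (fun e => Jp mu (cube M) r (T4 e)).
Proof.
have [c c0 hc] := diff_quotient_bound srho rhos rho1 p1 aL gL wg.
apply: (vanish_young q0 (T4_le (fun e z => hc e M z))).
apply: vanishZ; first exact: Jensen_cst_ge0.
apply: vanishZ; first exact: powR_ge0.
apply: vanishZ => //.
by apply: vanish_sum => j; exact: modulus_vanish.
Qed.

Lemma partial_residual_vanish M : vanish (fun e => Jp mu (cube M) r (partial i (residual e))).
Proof.
have m1 e : measurable_fun setT (T1 e).
  by apply: measurable_funB; apply: measurable_funM => //; exact: mav.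
have m2 e : measurable_fun setT (T2 e).
  apply: measurable_funM; last exact: mav.
  by apply: measurable_funM => //; apply: measurable_funB => //; exact: mav.
have m3 e : measurable_fun setT (T3 e).
  apply: measurable_sum => j; apply: measurable_funM => //.
  by apply: measurable_funD; [exact: mav|exact: measurable_funM].
have m4 e : measurable_fun setT (fun x => - T4 e x).
  apply: measurable_funN.
  exact: (measurable_Rint_param (lebesgue_rV n) (measurable_cube 1) (mw e)).
have v4 : vanish (fun e => Jp mu (cube M) r (fun x => - T4 e x)).
  by apply: vanish_le (T4_vanish M) => e _; rewrite JpN.
have r0' := ltW r0; have mc := measurable_cube M : measurable (cube M : set V).
have v34 := Jp_vanishD mc r0' (fun e _ => m3 e) (fun e _ => m4 e) (T3_vanish M) v4.
have v234 := Jp_vanishD mc r0' (fun e _ => m2 e) (fun e _ => measurable_funD (m3 e) (m4 e)) (T2_vanish M) v34.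
have v := Jp_vanishD mc r0' (fun e _ => m1 e)
  (fun e _ => measurable_funD (m2 e) (measurable_funD (m3 e) (m4 e))) (T1_vanish M) v234.
apply: vanish_le v => e e01; rewrite le_eqVlt; apply/orP; left; apply/eqP; congr Jp.
by apply/funext => x; rewrite partial_residualE.
Qed.

Lemma measurable_partial_residual e : 0 < e <= 1 -> measurable_fun setT (partial i (residual e)).
Proof.
move=> e01; rewrite (funext (fun x => (partial_residual_raw x e01).2)).
apply: measurable_funB; last by apply: measurable_funM => //; exact: mav.
apply: measurable_funD; apply: measurable_funM; try exact: mav.
by apply: measurable_funM => //; exact: mav.
Qed.

Lemma loc_bounded_partial_residual e : 0 < e <= 1 -> loc_bounded (partial i (residual e)).
Proof.
move=> e01; rewrite (funext (fun x => (partial_residual_raw x e01).2)).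
have cst_bd c : loc_bounded (fun=> c : R) by move=> M; exists `|c|.
apply: loc_boundedB; last first.
  by apply: loc_boundedM => //; exact: (average_bounded r1 afL (kCi i) e01).
apply: loc_boundedD; apply: loc_boundedM.
- exact: (average_bounded p1 aL kC e01).
- by apply: loc_boundedM => //; exact: (average_bounded q1 fL (kCi i) e01).
- exact: (average_bounded q1 fL kC e01).
- exact: (average_bounded p1 (gL i) kC e01).
Qed.

End partial_residual.

Lemma measurable_residual e : measurable_fun setT (residual e).
Proof. by apply: measurable_funB; [apply: measurable_funM|]; exact: mav. Qed.

Lemma residual_weak_gradient e : 0 < e <= 1 ->
  weak_gradient (residual e) (fun i => partial i (residual e)).
Proof.
move=> e01; apply: weak_gradient_classical.
- exact: measurable_residual.
- apply: loc_boundedB; last exact: (average_bounded r1 afL kC e01).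
  by apply: loc_boundedM; [exact: (average_bounded p1 aL kC e01)|exact: (average_bounded q1 fL kC e01)].
- by move=> i x; exact: (partial_residual_raw i x e01).1.
- by move=> i; exact: measurable_partial_residual.
- by move=> i; exact: loc_bounded_partial_residual.
Qed.

(** The infimum defining [W1norm] is at most its value at the classical gradient, and the compact
    set is enlarged to a cube, on which the estimates hold. *)
Lemma commutator_vanish K : compact K ->
  vanish (fun e => W1norm r K (residual e)).
Proof.
move=> cK; have [M _ KM] := compact_sub_cube cK; have mK := compact_measurable_rV cK.
apply: (@vanish_le _ _ (fun e => Lnorm_on r K (residual e) +
    \sum_(i < n) Lnorm_on r K (partial i (residual e)))%E).
  move=> e e01; apply: ereal_inf_lbound => /=.
  by exists (fun i => partial i (residual e)) => //; exact: residual_weak_gradient.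
have vL (u : R -> V -> R) : (forall e, 0 < e <= 1 -> measurable_fun setT (u e)) ->
    vanish (fun e => Jp mu (cube M) r (u e)) -> vanish (fun e => Lnorm_on r K (u e)).
  move=> mu' vu; apply: (@vanish_le _ _ (fun e => Jp mu (cube M) r (u e) `^ r^-1)%E).
    move=> e e01; rewrite Lnorm_onE//; last exact: mu'.
    apply: gt0_ler_poweR; rewrite ?invr_ge0 ?(ltW r0)// ?in_itv/= ?Jp_ge0 ?leey//.
    apply: Jp_subset => //; [exact: measurable_cube|exact: mu'].
  by apply: vanish_poweR => // [|e]; [rewrite invr_gt0|exact: Jp_ge0].
apply: vanishD; first by apply: vL (residual_vanish M) => e _; exact: measurable_residual.
apply: vanish_sum => i; apply: vL (partial_residual_vanish i M) => e e01.
exact: measurable_partial_residual.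
Qed.

End commutator.

(** * The exponent condition and the return to convolutions *)

Lemma W1norm_ge0 {R : realType} n (p : R) (K : set 'rV[R]_n) u : (0 <= W1norm p K u)%E.
Proof.
apply: le_ereal_inf_tmp => _ [g _ <-]; rewrite adde_ge0 ?Lnorm_ge0//.
by apply: sume_ge0 => i _; exact: Lnorm_ge0.
Qed.

(** Yields [r >= 1] in the theorem. For [p = 1] the conjugate is infinite and cannot be at most the
    real number [q]. *)
Lemma hoelder_conjugate_le {R : realType} (p q : R) : 1 <= p -> 1 <= q ->
  (hoelder_conjugate p%:E <= q%:E)%E -> p^-1 + q^-1 <= 1.
Proof.
rewrite le_eqVlt => /predU1P[<-|p1] q1; first by rewrite hoelder_conjugate1 leye_eq.
have p0 : 0 < p by rewrite (lt_trans ltr01).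
have q0 : 0 < q by rewrite (lt_le_trans ltr01).
have p10 : 0 < p - 1 by rewrite subr_gt0.
rewrite /hoelder_conjugate/= eqe gt_eqF// -EFinB inver gt_eqF// -EFinM lee_fin.
rewrite ler_pdivrMr// => pq; rewrite -(ler_pM2r (mulr_gt0 p0 q0)).
rewrite mulrDl mul1r mulKf ?gt_eqF// mulrC -mulrA mulfV ?gt_eqF// mulr1.
by move: pq; rewrite mulrBr mulr1 lerBrDr addrC [q * p]mulrC.
Qed.

Theorem proposition3p3 (R : realType) (n : nat) (n_gt0 : (0 < n)%N)
  (rho : 'rV[R]_n -> R) (rhoP : mollifier rho)
  (p q r : R) (p_ge1 : 1 <= p) (q_ge1 : 1 <= q)
  (pq : (hoelder_conjugate p%:E <= q%:E)%E)
  (rE : r^-1 = p^-1 + q^-1)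
  (a f : 'rV[R]_n -> R) (aW : W1loc p a) (fL : Lloc q f)
  (K : set 'rV[R]_n) (cK : compact K) :
  W1norm r K (fun x =>
      convolution a (rescale rho e) x * convolution f (rescale rho e) x
      - convolution (fun y => a y * f y) (rescale rho e) x)
    @[e --> 0^'+] --> 0%E.
Proof.
have [srho rho_ge0 rhosq rho_int] := rhoP.
have [aL [g wg gL]] := aW.
have p0 : 0 < p by rewrite (lt_le_trans ltr01).
have q0 : 0 < q by rewrite (lt_le_trans ltr01).
(* The Euclidean unit ball lies in the unit cube: the square of each coordinate is at most the sum
   of the squares. *)
have rhos z : rho z != 0 -> cube 1 z.
  move=> /rhosq z1; apply: norm_rV_le => // i.
  rewrite -(@ler_pXn2r _ 2)// ?nnegrE// expr1n real_normK ?num_real//.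
  by apply: le_trans z1; rewrite (bigD1 i)//= lerDl sumr_ge0// => j _; exact: sqr_ge0.
have r0 : 0 < r by rewrite -invr_gt0 rE addr_gt0// invr_gt0.
have r1 : 1 <= r by rewrite -[r]invrK invf_ge1 ?invr_gt0// rE; exact: hoelder_conjugate_le.
have aL' : locLp p a by exact/(Lloc_locLp _ p0).
have fL' : locLp q f by exact/(Lloc_locLp _ q0).
have gL' i : locLp p (g i) by exact/(Lloc_locLp _ p0).
have rho1 : \int[lebesgue_rV n]_(z in cube 1) rho z = 1.
  by have := Rintegral_supported rhos; rewrite rho_int.
have [C [kC _]] := smooth_bounded_kernel srho rhos.
apply: vanish_cvg => [e|]; first exact: W1norm_ge0.
(* For [e] in ]0, 1] each convolution is the corresponding average, so the function in the norm is
   [residual e]. *)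
apply: vanish_le (commutator_vanish srho rhos rho1 p_ge1 q_ge1 r1 rE aL' gL' fL' wg cK).
move=> e e01; rewrite le_eqVlt; apply/orP; left; apply/eqP; congr W1norm.
apply/funext => x; rewrite /residual (averageE x p_ge1 aL' kC e01).
by rewrite (averageE x q_ge1 fL' kC e01) (averageE x r1 (locLpM p_ge1 q_ge1 rE aL' fL') kC e01).
Qed.
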